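(* Let $f \in L^1(\mathbb{R})$ and let $N > 0$. Suppose that \[ \iint_{\mathbb{R}^2} \bigl| f(x) \, \hat f(y) \bigr| \, e^{\lambda |xy|} \, dx \, dy = O\bigl( (1-\lambda)^{-N} \bigr) \qquad \text{as } \lambda \to 1^-. \] Then there exist $a \in \mathbb{R}^+$ and a polynomial $p$ such that $f = p \, \gamma_a$ (almost everywhere), where $\gamma_a(x) = e^{-a x^2/2}$.
   Context: For $a \in \mathbb{R}^+$, the gaussian $\gamma_a$ is defined by $\gamma_a(x) = e^{-a x^2/2}$ for $x \in \mathbb{R}$. For $f \in L^1(\mathbb{R})$, the Fourier transform is $\hat f(y) = \frac{1}{\sqrt{2\pi}} \int_{\mathbb{R}} f(x) e^{-ixy}\, dx$. *)

(* Defs.v *)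
From HB Require Import structures.
From mathcomp Require Import all_boot all_order all_algebra.
From mathcomp Require Import all_classical all_reals all_analysis.
Set Implicit Arguments. Unset Strict Implicit. Unset Printing Implicit Defensive.
Import Order.TTheory GRing.Theory Num.Theory.
Import numFieldNormedType.Exports.
Local Open Scope classical_set_scope.
Local Open Scope ring_scope.

(* A complex-valued function f : R -> C is represented by its real part u and
   imaginary part v, i.e. f = u + i v. *)

Definition gaussian {R : realType} (a x : R) : R := expR (- (a * x ^+ 2) / 2).

(* Real and imaginary parts of the Fourier transform
   hat f(y) = 1/sqrt(2 pi) \int f(x) e^{-ixy} dx, with f = u + i v:
   f(x) e^{-ixy} = (u cos(xy) + v sin(xy)) + i (v cos(xy) - u sin(xy)). *)
Definition fourier_re {R : realType} (u v : R -> R) (y : R) : R :=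
  (Num.sqrt (2 * pi))^-1 *
  Rintegral (@lebesgue_measure R) setT (fun x => u x * cos (x * y) + v x * sin (x * y)).

Definition fourier_im {R : realType} (u v : R -> R) (y : R) : R :=
  (Num.sqrt (2 * pi))^-1 *
  Rintegral (@lebesgue_measure R) setT (fun x => v x * cos (x * y) - u x * sin (x * y)).

Definition cmod_fun {R : realType} (u v : R -> R) (x : R) : R :=
  Num.sqrt (u x ^+ 2 + v x ^+ 2).

Definition fourier_abs {R : realType} (u v : R -> R) (y : R) : R :=
  Num.sqrt (fourier_re u v y ^+ 2 + fourier_im u v y ^+ 2).

Definition beurling_integral {R : realType} (u v : R -> R) (lam : R) : \bar R :=
  (\int[@lebesgue_measure R]_(y in setT)
     \int[@lebesgue_measure R]_(x in setT)
        (cmod_fun u v x * fourier_abs u v y * expR (lam * `|x * y|))%:E)%E.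

(* Main.v *)
(* Damp [f] to [g t = f t * exp (- t^2 / 2)] and let [E z] be the integral of
   [g t * exp (- i t z)], an entire function of order at most 2. On the real line
   [E] is the convolution of the Fourier transform of [f] with a Gaussian, so the
   hypothesis with [1 - lam] of order [1 / (1 + y^2)] gives
   [|E y| * \int |g t| exp |t y| dt = O ((1 + y^2)^M)]; hence [E y * E w] has the
   same bound whenever [|Im w| <= |y|]. By Phragmen-Lindelof in each quadrant,
   [E z * E (i z)] has polynomial growth, so it is a polynomial. Dividing out its
   zeros leaves a zero-free function of order 2, and [ln |E|] is a harmonic function
   of quadratic growth: [E z = q z * exp (b z^2)]. The bounds on the real line force
   [b] to be real, and negative unless [f = 0]. Uniqueness of the Fourier transform
   identifies [g] with a polynomial times a Gaussian, hence [f] too, and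
   integrability of [f] forces its Gaussian to decay. *)
Require Import Defs.
From HB Require Import structures.
From mathcomp Require Import all_boot all_order all_algebra.
From mathcomp Require Import all_classical all_reals all_analysis.
From mathcomp Require Import cyclic separable cyclotomic complex ring lra zify measurable_realfun.
Import Order.TTheory GRing.Theory Num.Theory.
Import numFieldNormedType.Exports.
Local Open Scope classical_set_scope.
Local Open Scope ring_scope.

Set Implicit Arguments. Unset Strict Implicit. Unset Printing Implicit Defensive.
Import complex Normc.
Local Open Scope complex_scope.

(** * Roots of unity and the modulus on [R[i]] *)

Section ComplexModulus.
Variable R : realType.
Implicit Types (z w : R[i]) (x : R).

(** The hypothesis controls only products of a value of [f] with a value of its transform, so
    polynomial bounds are available only for products of two values of [E]. The quarter turn in
    [E z * E (i z)] is chosen so that on each half axis one factor sits at a real point, where the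
    bound holds whatever the other argument of the same modulus. The unit Gaussian is its own
    transform: damping [f] by it amounts to averaging the transform of [f] against its translates,
    and both operations need only the integrability of [f]. Growth of order 2 is exactly critical
    for a quadrant, so the opening must be reduced a little before Phragmen-Lindelof applies. Once
    the zeros are gone, [E z * E (i z) = c] also provides the lower bound on [ln |E|] and an entire
    inverse of [E], while [z^2 + (i z)^2 = 0] shows why the quadratic coefficient stays free. The
    complex analysis rests on averages over roots of unity: they give the coefficient estimate and
    the maximum principle, and the latter gives division by a zero, Liouville's theorem and the
    identity theorem. *)

Lemma prim_root_exists n : (0 < n)%N -> exists z : R[i], n.-primitive_root z.
Proof.
pose p : {poly R[i]} := 'X^n - 1; have [r Dp] := closed_field_poly_normal p.
move=> n_gt0; rewrite (monicP _) ?monicXnsubC // scale1r in Dp.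
have rn1 : all n.-unity_root r by apply/allP=> z; rewrite -root_prod_XsubC -Dp.
have sz_r : (n < (size r).+1)%N.
  by rewrite -(size_prod_XsubC r id) -Dp size_XnsubC.
have [|z] := hasP (has_prim_root n_gt0 rn1 _ sz_r); last by exists z.
by rewrite -separable_prod_XsubC -Dp separable_Xn_sub_1 // pnatr_eq0 -lt0n.
Qed.

Lemma sum_prim_root n (z : R[i]) k : n.-primitive_root z ->
  \sum_(j < n) z ^+ j ^+ k = if (n %| k)%N then n%:R else 0.
Proof.
move=> pz; under eq_bigr do rewrite exprAC.
have := subrX1 (z ^+ k) n; rewrite exprAC (prim_expr_order pz) expr1n subrr.
move/esym/eqP; rewrite mulf_eq0 subr_eq0 -(prim_order_dvd pz).
case: ifP => [nk _|_ /eqP //].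
have /eqP -> : z ^+ k == 1 by rewrite -(prim_order_dvd pz).
by under eq_bigr do rewrite expr1n; rewrite sumr_const card_ord.
Qed.

Lemma normc_ge0 z : 0 <= normc z.
Proof. by case: z => a b; rewrite sqrtr_ge0. Qed.

Lemma normcX z n : normc (z ^+ n) = normc z ^+ n.
Proof. by elim: n => [|n IH]; rewrite ?normc1 // !exprS normcM IH. Qed.

Lemma normc_prim_root n z : n.-primitive_root z -> normc z = 1.
Proof.
move=> pz; apply/eqP; rewrite -(@pexpr_eq1 _ _ n) ?normc_ge0 //.
  by rewrite -normcX (prim_expr_order pz) normc1.
exact: prim_order_gt0 pz.
Qed.

Lemma normcB z w : normc (z - w) <= normc z + normc w.
Proof. by rewrite -(normcN w) le_normcD. Qed.

Lemma normc_distC z w : normc (z - w) = normc (w - z).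
Proof. by rewrite -opprB normcN. Qed.

Lemma normc_sum I (s : seq I) (P : pred I) (F : I -> R[i]) :
  normc (\sum_(i <- s | P i) F i) <= \sum_(i <- s | P i) normc (F i).
Proof.
elim/big_rec2: _ => [|i x z _ le_z]; first by rewrite normc0.
by apply: le_trans (le_normcD _ _) _; rewrite lerD2l.
Qed.

Lemma normc_real x : normc x%:C = `|x|.
Proof. by rewrite /= expr0n addr0 sqrtr_sqr. Qed.

Lemma normc_eq0 z : (normc z == 0) = (z == 0).
Proof. by apply/eqP/eqP => [/eq0_normc //|->]; rewrite normc0. Qed.

Lemma normc_gt0 z : (0 < normc z) = (z != 0).
Proof. by rewrite lt_def normc_eq0 normc_ge0 andbT. Qed.

Lemma normc_geRe z : `|Re z| <= normc z.
Proof.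
case: z => a b /=; rewrite -sqrtr_sqr ler_sqrt ?sqr_ge0 ?addr_ge0 ?sqr_ge0 //.
by rewrite lerDl sqr_ge0.
Qed.

Lemma normc_geIm z : `|Im z| <= normc z.
Proof.
case: z => a b /=; rewrite -sqrtr_sqr ler_sqrt ?sqr_ge0 ?addr_ge0 ?sqr_ge0 //.
by rewrite lerDr sqr_ge0.
Qed.

Lemma normc_leReIm z : normc z <= `|Re z| + `|Im z|.
Proof.
rewrite {1}[z]complexE; apply: le_trans (le_normcD _ _) _.
by rewrite normcM !normc_real /= expr0n add0r expr1n sqrtr1 mul1r.
Qed.

Lemma sqr_normc z : normc z ^+ 2 = Re z ^+ 2 + Im z ^+ 2.
Proof. by case: z => a b /=; rewrite sqr_sqrtr ?addr_ge0 ?sqr_ge0. Qed.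

Lemma ReD z w : Re (z + w) = Re z + Re w. Proof. by case: z w => ? ? []. Qed.
Lemma ImD z w : Im (z + w) = Im z + Im w. Proof. by case: z w => ? ? []. Qed.
Lemma ReM z w : Re (z * w) = Re z * Re w - Im z * Im w.
Proof. by case: z w => ? ? []. Qed.
Lemma ImM z w : Im (z * w) = Re z * Im w + Im z * Re w.
Proof. by case: z w => ? ? []. Qed.
Lemma ReN z : Re (- z) = - Re z. Proof. by case: z. Qed.
Lemma ImN z : Im (- z) = - Im z. Proof. by case: z. Qed.

Lemma ReB z w : Re (z - w) = Re z - Re w. Proof. by rewrite ReD ReN. Qed.
Lemma ImB z w : Im (z - w) = Im z - Im w. Proof. by rewrite ImD ImN. Qed.

Lemma Re_sum I (s : seq I) (P : pred I) (F : I -> R[i]) :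
  Re (\sum_(i <- s | P i) F i) = \sum_(i <- s | P i) Re (F i).
Proof. by apply: (big_morph (@Re R) ReD). Qed.

Lemma complex_eq z w : Re z = Re w -> Im z = Im w -> z = w.
Proof. by case: z w => ? ? [? ?] /= -> ->. Qed.

(* [`|z| = Re (u z)] for the unit [u := z^* / |z|]. *)
Lemma normc_rotate z : exists2 u, normc u = 1 & Re (u * z) = normc z.
Proof.
have [->|z0] := eqVneq z 0.
  by exists 1; rewrite ?normc1 // mulr0 normc0.
have nz : normc z != 0 by rewrite normc_eq0.
exists ((Re z / normc z) -i* (Im z / normc z)).
  apply/eqP; rewrite -(@pexpr_eq1 _ _ 2) ?normc_ge0 // sqr_normc /= sqrrN.
  by rewrite !expr_div_n -mulrDl -sqr_normc divff // expf_neq0.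
rewrite ReM /= mulNr opprK [_ / _ * _]mulrAC [X in _ + X]mulrAC -mulrDl -!expr2.
by rewrite -sqr_normc expr2 mulfK.
Qed.

End ComplexModulus.

(* Entire functions are handled as locally uniform limits of polynomials, so
   that no complex derivative or contour integral is needed. *)
Definition entire (R : realType) (h : R[i] -> R[i]) := forall r e : R, 0 < e ->
  exists p : {poly R[i]}, forall z, normc z <= r -> normc (h z - p.[z]) <= e.

(** * Closure properties of entire functions and the coefficient estimate *)

Section Entire.
Variable R : realType.
Implicit Types (z w : R[i]) (r e : R) (h k : R[i] -> R[i]) (p q : {poly R[i]}).

Lemma ext_entire h k : h =1 k -> entire h -> entire k.
Proof. by move=> /funext ->. Qed.

Lemma entire_poly p : entire (horner p).
Proof. by move=> r e e0; exists p => z _; rewrite subrr normc0 ltW. Qed.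

Lemma poly_bounded p r : exists2 M, 0 < M & forall z, normc z <= r -> normc p.[z] <= M.
Proof.
elim/poly_ind: p => [|p c [M M0 hM]].
  by exists 1 => // z _; rewrite horner0 normc0.
exists (M * `|r| + normc c + 1) => [|z zr].
  by rewrite ltr_wpDl // addr_ge0 ?normc_ge0 // mulr_ge0 // ltW.
rewrite hornerMXaddC; apply: le_trans (le_normcD _ _) _.
rewrite -addrA lerD ?normcM ?ler_wpDr // ler_pM ?normc_ge0 ?hM //.
exact: le_trans zr (ler_norm _).
Qed.

Lemma poly_lipschitz p r : exists2 L, 0 < L & forall z w, normc z <= r ->
  normc w <= r -> normc (p.[z] - p.[w]) <= L * normc (z - w).
Proof.
elim/poly_ind: p => [|p c [L L0 hL]].
  by exists 1 => // z w _ _; rewrite !horner0 subrr normc0 mul1r normc_ge0.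
have [M M0 hM] := poly_bounded p r.
exists (L * `|r| + M) => [|z w zr wr]; first by rewrite ltr_wpDl ?mulr_ge0 // ltW.
rewrite !hornerMXaddC.
have -> : p.[z] * z + c - (p.[w] * w + c) = (p.[z] - p.[w]) * z + p.[w] * (z - w) by ring.
apply: le_trans (le_normcD _ _) _; rewrite !normcM mulrDl mulrAC lerD //.
  by rewrite ler_pM ?normc_ge0 ?hL // (le_trans zr) ?ler_norm.
by rewrite ler_wpM2r ?normc_ge0 ?hM.
Qed.

Lemma entire_bounded h r : entire h ->
  exists2 M, 0 < M & forall z, normc z <= r -> normc (h z) <= M.
Proof.
move=> /(_ r 1 ltr01)[p hp]; have [M M0 hM] := poly_bounded p r.
exists (1 + M) => [|z zr]; first by rewrite addr_gt0.
by rewrite -(subrK p.[z] (h z)); apply: le_trans (le_normcD _ _) _; rewrite lerD ?hp ?hM.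
Qed.

Lemma entire_continuous h z e : entire h -> 0 < e ->
  exists2 d, 0 < d & forall w, normc (w - z) < d -> normc (h w - h z) <= e.
Proof.
move=> hh e0; have e4 : 0 < e / 4 by rewrite divr_gt0.
have [p hp] := hh (normc z + 1) _ e4.
have [L L0 hL] := poly_lipschitz p (normc z + 1).
exists (Num.min 1 (e / 4 / L)) => [|w]; first by rewrite lt_min ltr01 divr_gt0.
rewrite lt_min => /andP[w1 we].
have wr : normc w <= normc z + 1.
  by rewrite -(subrK z w); apply: le_trans (le_normcD _ _) _; rewrite addrC lerD2l ltW.
have zr : normc z <= normc z + 1 by rewrite lerDl.
have -> : h w - h z = h w - p.[w] + (p.[w] - p.[z]) - (h z - p.[z]) by ring.
apply: le_trans (normcB _ _) _.
have := le_normcD (h w - p.[w]) (p.[w] - p.[z]); have := hp w wr; have := hp z zr.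
have := hL w z wr zr; have : L * normc (w - z) <= e / 4 by rewrite mulrC -ler_pdivlMr // ltW.
lra.
Qed.

Lemma entireD h k : entire h -> entire k -> entire (fun z => h z + k z).
Proof.
move=> hh hk r e e0; have e2 : 0 < e / 2 by rewrite divr_gt0.
have [p hp] := hh r _ e2; have [q hq] := hk r _ e2; exists (p + q) => z zr.
rewrite hornerD opprD addrACA; apply: le_trans (le_normcD _ _) _.
by rewrite [leRHS](splitr e) lerD ?hp ?hq.
Qed.

(** The approximants are chosen in turn: [q] for [k], with an error scaled by a bound [M] of [h],
    then [p] for [h], with an error scaled by a bound [N] of [q], because [N] depends on [q]. *)
Lemma entireM h k : entire h -> entire k -> entire (fun z => h z * k z).
Proof.
move=> hh hk r e e0.
have [M M0 hM] := entire_bounded r hh.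
have [q hq] : exists q, forall z, normc z <= r -> normc (k z - q.[z]) <= e / 2 / M.
  by apply: hk; rewrite !divr_gt0.
have [N N0 hN] := poly_bounded q r.
have [p hp] : exists p, forall z, normc z <= r -> normc (h z - p.[z]) <= e / 2 / N.
  by apply: hh; rewrite !divr_gt0.
exists (p * q) => z zr; rewrite hornerM.
have -> : h z * k z - p.[z] * q.[z] = h z * (k z - q.[z]) + (h z - p.[z]) * q.[z] by ring.
apply: le_trans (le_normcD _ _) _; rewrite !normcM [leRHS](splitr e) lerD //.
  rewrite -[leRHS](divfK (negbT (gt_eqF M0))) mulrC.
  by rewrite ler_pM ?normc_ge0 ?hq ?hM.
by rewrite -[leRHS](divfK (negbT (gt_eqF N0))) ler_pM ?normc_ge0 ?hp ?hN.
Qed.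

Lemma entire_comp h k : entire h -> entire k -> entire (h \o k).
Proof.
move=> hh hk r e e0; have e2 : 0 < e / 2 by rewrite divr_gt0.
have [M M0 hM] := entire_bounded r hk.
have [p hp] := hh (M + 1) _ e2; have [L L0 hL] := poly_lipschitz p (M + 1).
(* The cap at 1 keeps [q.[z]] in the disc of radius [M + 1], where [p] approximates [h] and is
   Lipschitz. *)
have [q hq] : exists q, forall z, normc z <= r -> normc (k z - q.[z]) <= Num.min 1 (e / 2 / L).
  by apply: hk; rewrite lt_min ltr01 !divr_gt0.
exists (p \Po q) => z zr; rewrite horner_comp /=.
have := hq z zr; rewrite le_min => /andP[q1 qe].
have kr : normc (k z) <= M + 1 by rewrite ler_wpDr ?hM.
have qr : normc q.[z] <= M + 1.
  rewrite -[q.[z]](subKr (k z)); apply: le_trans (normcB _ _) _.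
  by rewrite lerD ?hM.
rewrite -(subrKA p.[k z]); apply: le_trans (le_normcD _ _) _.
rewrite [leRHS](splitr e) lerD ?hp //; apply: le_trans (hL _ _ kr qr) _.
by rewrite mulrC -ler_pdivlMr.
Qed.

Lemma entire_cst (c : R[i]) : entire (fun=> c).
Proof. by apply: (ext_entire _ (entire_poly c%:P)) => z; rewrite hornerC. Qed.

Lemma entire_id : entire (@id R[i]).
Proof. by apply: (ext_entire _ (entire_poly 'X)) => z; rewrite hornerX. Qed.

Lemma entireN h : entire h -> entire (fun z => - h z).
Proof.
move=> hh; apply: (ext_entire _ (entireM (entire_cst (-1)) hh)) => z.
by rewrite mulN1r.
Qed.

Lemma entireB h k : entire h -> entire k -> entire (fun z => h z - k z).
Proof. by move=> hh hk; apply: entireD => //; apply: entireN. Qed.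

Lemma entireZ (c : R[i]) h : entire h -> entire (fun z => c * h z).
Proof. exact: entireM (entire_cst c). Qed.

Lemma entire_scale h (c : R[i]) : entire h -> entire (fun z => h (c * z)).
Proof. by move=> hh; apply: (entire_comp hh (entireZ c entire_id)). Qed.

(* Averaging over the [n]-th roots of unity replaces the contour integral. *)
Lemma root_average p n (w : R[i]) (r : R) (m : nat) : n.-primitive_root w ->
  (size p <= n)%N ->
  \sum_(j < n) p.[r%:C * w ^+ j] * (w ^+ j) ^+ m
   = n%:R * \sum_(l < n | (n %| l + m)%N) p`_l * r%:C ^+ l.
Proof.
move=> pw sp.
transitivity (\sum_(j < n) \sum_(l < n) p`_l * r%:C ^+ l * (w ^+ j) ^+ (l + m)).
  apply: eq_bigr => j _; rewrite (horner_coef_wide _ sp) mulr_suml.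
  by apply: eq_bigr => l _; rewrite exprMn exprD !mulrA.
rewrite exchange_big mulr_sumr [RHS]big_mkcond /=; apply: eq_bigr => l _.
by rewrite -mulr_sumr (sum_prim_root _ pw); case: ifP; rewrite ?mulr0 // mulrC.
Qed.

(** Averaging [p] against the frequency [- m] isolates its coefficient of index [m]; averaging the
    conjugate of [p] against the same frequency gives 0, since [m] is positive. The sum of the two
    averages involves [2 * Re p] only. Taking [n] above [size p + m] prevents any aliasing modulo
    [n]. *)
Lemma coef_bound_Re p (r B : R) (m : nat) : (0 < m)%N -> 0 <= r ->
  (forall z, normc z = r -> `|Re p.[z]| <= B) -> normc p`_m * r ^+ m <= 2 * B.
Proof.
move=> m0 r0 hB; pose n := (size p + m).+1.
have [w pw] := @prim_root_exists R n isT.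
have sp : (size p <= n)%N by rewrite /n; lia.
have nw j : normc (w ^+ j) = 1 by rewrite normcX (normc_prim_root pw) expr1n.
have wn j : (w ^+ j) ^+ n = 1 by rewrite exprAC (prim_expr_order pw) expr1n.
have conjw j : (w ^+ j)^* = (w ^+ j)^-1.
  apply: (mulIf (_ : w ^+ j != 0)); first by rewrite -normc_eq0 nw oner_neq0.
  rewrite mulVf -?normc_eq0 ?nw ?oner_neq0 //; apply: complex_eq.
    by case: (w ^+ j) (nw j) => a b /= ab; rewrite mulNr opprK -!expr2 -[RHS](expr1n _ 2) -ab
         sqr_sqrtr ?addr_ge0 ?sqr_ge0.
  by case: (w ^+ j) => a b /=; ring.
have conjwm j : ((w ^+ j) ^+ m)^* = (w ^+ j) ^+ (n - m).
  rewrite rmorphXn /= conjw; apply: (mulIf (_ : (w ^+ j) ^+ m != 0)).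
    by rewrite -normc_eq0 normcX nw expr1n oner_neq0.
  rewrite -exprMn mulVf ?expr1n -?exprD; first by rewrite subnK ?wn // /n; lia.
  by rewrite -normc_eq0 nw oner_neq0.
have mn : (m < n)%N by rewrite /n; lia.
have A1 : \sum_(j < n) p.[r%:C * w ^+ j] * (w ^+ j) ^+ (n - m) = n%:R * (p`_m * r%:C ^+ m).
  rewrite (root_average _ _ pw sp); congr (_ * _).
  rewrite (bigD1 (Ordinal mn)) /=; last by rewrite subnKC // ltnW.
  rewrite big1 ?addr0 // => l /andP[/dvdnP[q hq] /negP []].
  apply/eqP/val_inj => /=; move: (ltn_ord l) mn m0; move: (nat_of_ord l) hq => {}l.
  by clearbody n; case: q => [|[|q]]; rewrite ?mulSn; lia.
have A2 : \sum_(j < n) (p.[r%:C * w ^+ j])^* * (w ^+ j) ^+ (n - m) = 0.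
  under eq_bigr do rewrite -conjwm -rmorphM.
  rewrite -rmorph_sum (root_average _ _ pw sp) big1 ?mulr0 ?rmorph0 //= => l /dvdnP[q hq].
  rewrite nth_default ?mul0r // leqNgt; apply/negP => hl.
  have hn : (l + m < n)%N by rewrite /n ltnS leq_add2r ltnW.
  move: hn hq {hl}; move: (nat_of_ord l) => {}l; clearbody n.
  by case: q => [|q]; rewrite ?mulSn; lia.
have S : \sum_(j < n) (2 * Re p.[r%:C * w ^+ j])%:C * (w ^+ j) ^+ (n - m)
    = n%:R * (p`_m * r%:C ^+ m).
  rewrite -A1 -[RHS]addr0 -[X in _ + X]A2 -big_split; apply: eq_bigr => j _ /=.
  by rewrite -mulrDl; congr (_ * _); case: p.[_] => a b; apply: complex_eq => /=; ring.
have : normc (n%:R * (p`_m * r%:C ^+ m)) <= n%:R * (2 * B).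
  rewrite -S; apply: le_trans (normc_sum _ _ _) _.
  have -> : n%:R * (2 * B) = \sum_(j < n) (2 * B) by rewrite sumr_const card_ord mulr_natl.
  apply: ler_sum => j _; rewrite normcM normcX nw expr1n mulr1 normc_real.
  rewrite normrM ger0_norm ?ler_pM2l // hB // normcM normc_real nw mulr1.
  by rewrite ger0_norm.
have -> : n%:R = (n%:R : R)%:C by rewrite rmorph_nat.
rewrite !normcM normcX !normc_real [`|n%:R|]ger0_norm // (ger0_norm r0).
by rewrite ler_pM2l // ltr0n.
Qed.

End Entire.

(** * The maximum principle for polynomials on a rectangle *)

Section MaximumPrinciple.
Variable R : realType.
Implicit Types (z w : R[i]) (r e : R) (h k : R[i] -> R[i]) (p q : {poly R[i]}).

Lemma poly_continuous_ReIm p :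
  continuous (fun x : R * R => Re p.[x.1 +i* x.2]) /\
  continuous (fun x : R * R => Im p.[x.1 +i* x.2]).
Proof.
elim/poly_ind: p => [|p c [cR cI]].
  by split; under eq_fun do rewrite horner0 /=; apply: cst_continuous.
split; [under eq_fun do rewrite hornerMXaddC ReD ReM /= |
        under eq_fun do rewrite hornerMXaddC ImD ImM /=] => x;
  (apply: (@cvgD _ R^o); last exact: cvg_cst).
- apply: (@cvgB _ R^o); apply: cvgM; [exact: cR|exact: cvg_fst|exact: cI|exact: cvg_snd].
- apply: (@cvgD _ R^o); apply: cvgM; [exact: cR|exact: cvg_snd|exact: cI|exact: cvg_fst].
Qed.

Lemma poly_continuous_normc p : continuous (fun x : R * R => normc p.[x.1 +i* x.2]).
Proof.
have [cR cI] := poly_continuous_ReIm p.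
have -> : (fun x : R * R => normc p.[x.1 +i* x.2]) =
    Num.sqrt \o (fun x => Re p.[x.1 +i* x.2] ^+ 2 + Im p.[x.1 +i* x.2] ^+ 2).
  by apply/funext => x /=; case: p.[_].
move=> x; apply: continuous_comp; last exact: sqrt_continuous.
by apply: (@cvgD _ R^o); apply: cvgM; [exact: cR|exact: cR|exact: cI|exact: cI].
Qed.

Definition rect (a b c d : R) z := (a <= Re z <= b) && (c <= Im z <= d).

(** The modulus of [p] is only subharmonic, so its maximum could be attained inside; adding
    [e * |z|^2] makes the mean over a small circle strictly exceed the value at the centre, which
    rules out an interior maximum. *)
Lemma poly_max_rect p (a b c d B : R) :
  (forall z, rect a b c d z -> [|| Re z == a, Re z == b, Im z == c | Im z == d] ->
    normc p.[z] <= B) ->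
  forall z, rect a b c d z -> normc p.[z] <= B.
Proof.
move=> hB z1 /andP[/andP[az1 z1b] /andP[cz1 z1d]].
rewrite leNgt; apply/negP => Bz1.
pose S := (`|a| + `|b|) ^+ 2 + (`|c| + `|d|) ^+ 2 + 1.
have S0 : 0 < S by rewrite ltr_wpDl // addr_ge0 ?sqr_ge0.
(* [S] bounds [|z|^2] on the rectangle, so the perturbation is at most half of the supposed excess
   over [B]: the maximum of [phi] cannot lie on the boundary either. *)
pose e := (normc p.[z1] - B) / 2 / S.
have e0 : 0 < e by rewrite !divr_gt0 // subr_gt0.
have eS : e * S = (normc p.[z1] - B) / 2 by rewrite /e divfK // gt_eqF.
pose phi z := normc p.[z] + e * (Re z ^+ 2 + Im z ^+ 2).
have leS z : rect a b c d z -> Re z ^+ 2 + Im z ^+ 2 <= S.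
  move=> /andP[/andP[h1 h2] /andP[h3 h4]]; rewrite /S -[leLHS]addr0 lerD // lerD //.
    rewrite -[leLHS]real_normK ?num_real // ler_sqr ?nnegrE ?addr_ge0 // ler_norml.
    have := ler_norm a; have := ler_norm (- a); rewrite normrN.
    have := ler_norm b; have := ler_norm (- b); rewrite normrN; lra.
  rewrite -[leLHS]real_normK ?num_real // ler_sqr ?nnegrE ?addr_ge0 // ler_norml.
  have := ler_norm c; have := ler_norm (- c); rewrite normrN.
  have := ler_norm d; have := ler_norm (- d); rewrite normrN; lra.
have [[x y]] : exists2 x : R * R, x \in `[a, b] `*` `[c, d] &
    forall t, t \in `[a, b] `*` `[c, d] -> phi (t.1 +i* t.2) <= phi (x.1 +i* x.2).
  apply: compact_EVT_max.
  - by exists (Re z1, Im z1); rewrite /= !in_itv /= az1 z1b cz1 z1d.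
  - by apply: compact_setX; apply: segment_compact.
  - apply: continuous_subspaceT => x; apply: (@cvgD _ R^o).
      exact: poly_continuous_normc.
    by apply: cvgMr; apply: (@cvgD _ R^o); apply: cvgM; (exact: cvg_fst || exact: cvg_snd).
rewrite inE /= !in_itv /= => -[/andP[ax xb] /andP[cy yd]] hmax.
set z0 := x +i* y in hmax *.
have max0 z : rect a b c d z -> phi z <= phi z0.
  move=> /andP[hz1 hz2]; have := hmax (Re z, Im z); rewrite inE /= !in_itv /= hz1 hz2.
  by case: z {hz1 hz2} => u v; apply; split.
have r0 : rect a b c d z0 by rewrite /rect /= ax xb cy yd.
have int0 : [&& a < x, x < b, c < y & y < d].
  apply: contraT => bd; suff : phi z1 < phi z1 by rewrite ltxx.
  apply: (@le_lt_trans _ _ (B + e * S)); last first.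
    rewrite eS /phi; have : 0 <= e * (Re z1 ^+ 2 + Im z1 ^+ 2).
      by rewrite mulr_ge0 ?addr_ge0 ?sqr_ge0 // ltW.
    by move: Bz1; lra.
  apply: (le_trans (max0 _ _)); first by rewrite /rect az1 z1b cz1 z1d.
  rewrite /phi lerD ?ler_pM2l ?leS ?hB //=.
  move: bd; rewrite !lt_neqAle ax xb cy yd !andbT [a == x]eq_sym [c == y]eq_sym.
  by rewrite !negb_and !negbK.
case/and4P: int0 => ax' xb' cy' yd'.
pose r := Num.min (Num.min (x - a) (b - x)) (Num.min (y - c) (d - y)).
have rp : 0 < r by rewrite !lt_min !subr_gt0 ax' xb' cy' yd'.
have : r <= r by []; rewrite {2}/r !le_min => /andP[/andP[r1 r2] /andP[r3 r4]].
(* More nodes than the degree leave only the constant term in the mean of [p]; at least two nodes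
   make the [w ^+ j] sum to 0, which cancels the cross terms in the mean of [|z|^2]. *)
pose n := (size p).+2; have [w pw] := @prim_root_exists R n isT.
have nw j : normc (w ^+ j) = 1 by rewrite normcX (normc_prim_root pw) expr1n.
pose zj (j : 'I_n) := z0 + r%:C * w ^+ j.
have inr j : rect a b c d (zj j).
  have nj : normc (r%:C * w ^+ j) = r by rewrite normcM nw mulr1 normc_real gtr0_norm.
  have := normc_geRe (r%:C * w ^+ j); have := normc_geIm (r%:C * w ^+ j).
  rewrite nj !ler_norml => /andP[h1 h2] /andP[h3 h4].
  by rewrite /rect ReD ImD; apply/andP; split; apply/andP; split;
     move: h1 h2 h3 h4 r1 r2 r3 r4; rewrite /z0 /=; lra.
have mean : \sum_(j < n) p.[zj j] = n%:R * p.[z0].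
  have := @root_average R (p \Po ('X + z0%:P)) n w r 0 pw _.
  rewrite size_comp_poly2 ?size_XaddC // => /(_ (leqW (leqnSn _))).
  under eq_bigr do rewrite expr0 mulr1 horner_comp hornerD hornerX hornerC addrC.
  move=> ->; congr (_ * _); rewrite (bigD1 ord0) //= big1 => [|l /andP[]].
    by rewrite addr0 expr0 mulr1 -horner_coef0 horner_comp hornerD hornerX hornerC add0r.
  by rewrite addn0 => /dvdn_leq; have := ltn_ord l; case: l => -[|l] //= _; rewrite ltnNge => /negP ? /(_ isT).
have mean2 : \sum_(j < n) (Re (zj j) ^+ 2 + Im (zj j) ^+ 2) =
    n%:R * (Re z0 ^+ 2 + Im z0 ^+ 2 + r ^+ 2).
  have s0 : \sum_(j < n) w ^+ j = 0.
    transitivity (\sum_(j < n) w ^+ j ^+ 1); last by rewrite (sum_prim_root _ pw).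
    by apply: eq_bigr => j _; rewrite expr1.
  transitivity (\sum_(j < n) ((Re z0 ^+ 2 + Im z0 ^+ 2 + r ^+ 2) +
      2 * Re (z0^* * r%:C * w ^+ j))).
    apply: eq_bigr => j _; have := sqr_normc (w ^+ j); rewrite nw expr1n => e1.
    have -> : r ^+ 2 = r ^+ 2 * (Re (w ^+ j) ^+ 2 + Im (w ^+ j) ^+ 2) by rewrite -e1 mulr1.
    by rewrite /zj /z0; case: (w ^+ j) => u v /=; ring.
  rewrite big_split /= sumr_const card_ord -mulr_sumr -Re_sum -mulr_sumr.
  by rewrite s0 mulr0 /= mulr0 addr0 mulr_natl.
have : \sum_(j < n) phi (zj j) <= \sum_(j < n) phi z0 by apply: ler_sum => j _; exact: max0.
rewrite big_split /= -mulr_sumr mean2 sumr_const card_ord -mulr_natl.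
have : n%:R * normc p.[z0] <= \sum_(j < n) normc p.[zj j].
  apply: le_trans (normc_sum _ _ _); rewrite mean normcM ler_wpM2r ?normc_ge0 //.
  by rewrite -(rmorph_nat (real_complex R)) normc_real ger0_norm.
have : 0 < n%:R * (e * r ^+ 2) :> R by rewrite mulr_gt0 ?ltr0n // mulr_gt0 // exprn_gt0.
rewrite /phi; set N := n%:R; set A := normc _; set T := \sum_(_ < _) _.
by move=> h1 h2 h3; have : N * (e * r ^+ 2) <= 0; [move: h2 h3; lra|rewrite leNgt h1].
Qed.

End MaximumPrinciple.

(** * Maximum principle, division by a zero, Liouville and identity theorems for entire functions *)

Section EntireTheory.
Variable R : realType.
Implicit Types (z w : R[i]) (r e : R) (h k : R[i] -> R[i]) (p q : {poly R[i]}).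

Lemma entire_max_rect h (a b c d B : R) : entire h ->
  (forall z, rect a b c d z -> [|| Re z == a, Re z == b, Im z == c | Im z == d] ->
    normc (h z) <= B) ->
  forall z, rect a b c d z -> normc (h z) <= B.
Proof.
move=> hh hB z zr; apply/ler_addgt0Pr => e e0.
have e2 : 0 < e / 2 by rewrite divr_gt0.
have [p hp] := hh (`|a| + `|b| + (`|c| + `|d|)) _ e2.
have inr w : rect a b c d w -> normc w <= `|a| + `|b| + (`|c| + `|d|).
  move=> /andP[/andP[h1 h2] /andP[h3 h4]]; apply: le_trans (normc_leReIm _) _.
  apply: lerD; rewrite ler_norml.
    have := ler_norm a; have := ler_norm (- a); rewrite normrN.
    have := ler_norm b; have := ler_norm (- b); rewrite normrN; lra.
  have := ler_norm c; have := ler_norm (- c); rewrite normrN.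
  have := ler_norm d; have := ler_norm (- d); rewrite normrN; lra.
have := @poly_max_rect R p a b c d (B + e / 2) _ z zr; have := hp z (inr z zr).
have := le_normcD (h z - p.[z]) p.[z]; rewrite subrK.
have hb w : rect a b c d w -> [|| Re w == a, Re w == b, Im w == c | Im w == d] ->
    normc p.[w] <= B + e / 2.
  move=> wr wb; rewrite -[p.[w]](subKr (h w)); apply: le_trans (normcB _ _) _.
  by rewrite lerD ?hB ?hp ?inr.
by move=> h1 h2 /(_ hb) h3; move: h1 h2 h3; lra.
Qed.

(** The square of half side [s] around [z0] contains the disc of radius [s], and its boundary lies
    between the circles of radii [s] and [2 * s]; rectangles thus serve as discs. *)
Lemma entire_max_square h z0 (s B : R) : entire h -> 0 < s ->
  (forall z, s <= normc (z - z0) <= 2 * s -> normc (h z) <= B) ->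
  forall z, normc (z - z0) <= s -> normc (h z) <= B.
Proof.
move=> hh s0 hB z zs.
apply: (@entire_max_rect h (Re z0 - s) (Re z0 + s) (Im z0 - s) (Im z0 + s) B hh).
  move=> w /andP[/andP[h1 h2] /andP[h3 h4]] bd; apply: hB; apply/andP; split.
    have := normc_geRe (w - z0); have := normc_geIm (w - z0); rewrite ReB ImB !ler_norml.
    move: bd h1 h2 h3 h4; case/or4P => /eqP -> ; lra.
  apply: le_trans (normc_leReIm _) _; rewrite ReB ImB mulr_natl mulr2n lerD // ler_norml; lra.
have := normc_geRe (z - z0); have := normc_geIm (z - z0); rewrite ReB ImB !ler_norml /rect.
by move: zs; lra.
Qed.

(** Approximate quotients of [h] by [z - z0]; the true quotient is their limit as [e] tends to 0. *)
Definition divides_up_to h z0 r e q := 0 < e /\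
  forall z, normc z <= r -> normc (h z - (z - z0) * q.[z]) <= e.

Lemma divides_up_to_exists h z0 r e : entire h -> h z0 = 0 -> normc z0 <= r -> 0 < e ->
  exists q, divides_up_to h z0 r e q.
Proof.
move=> hh h0 z0r e0; have e2 : 0 < e / 2 by rewrite divr_gt0.
have [p hp] := hh r _ e2.
have : root (p - p.[z0]%:P) z0 by rewrite rootE !hornerE subrr.
case/factor_theorem => q hq; exists q; split=> // z zr.
have -> : (z - z0) * q.[z] = p.[z] - p.[z0].
  by have := congr1 (horner^~ z) hq; rewrite /= !hornerE mulrC => ->.
have := hp _ z0r; rewrite h0 sub0r normcN => hp0.
have -> : h z - (p.[z] - p.[z0]) = h z - p.[z] + p.[z0] by ring.
by apply: le_trans (le_normcD _ _) _; rewrite [leRHS]splitr lerD ?hp.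
Qed.

(** At distance at least 1 from [z0] the division by [z - z0] does not enlarge the error, and the
    maximum principle carries the estimate to the points close to [z0]. The margin 2 in [r] leaves
    room for the annulus that this uses. *)
Lemma divides_up_to_close h z0 r e e' q q' : normc z0 + 2 <= r ->
  divides_up_to h z0 r e q -> divides_up_to h z0 r e' q' ->
  forall z, normc z <= r -> normc (q.[z] - q'.[z]) <= e + e'.
Proof.
move=> r2 [e0 hq] [e0' hq'].
have far z : normc z <= r -> 1 <= normc (z - z0) -> normc (q.[z] - q'.[z]) <= e + e'.
  move=> zr z1; apply: (@le_trans _ _ (normc ((z - z0) * (q.[z] - q'.[z])))).
    by rewrite normcM ler_peMl ?normc_ge0.
  have -> : (z - z0) * (q.[z] - q'.[z]) =
    (h z - (z - z0) * q'.[z]) - (h z - (z - z0) * q.[z]) by ring.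
  by apply: le_trans (normcB _ _) _; rewrite addrC lerD ?hq ?hq'.
move=> z zr; have [/far->//|/ltW z1] := leP 1 (normc (z - z0)).
rewrite -hornerN -hornerD; apply: (entire_max_square (entire_poly _) ltr01 _ z1).
move=> w /andP[w1 w2]; rewrite hornerD hornerN far //.
by rewrite -(subrK z0 w); apply: le_trans (le_normcD _ _) _; move: w2 r2; lra.
Qed.

Lemma entire_div h z0 : entire h -> h z0 = 0 ->
  exists2 k, entire k & forall z, h z = (z - z0) * k z.
Proof.
move=> hh h0; pose r0 := normc z0 + 2; have z0r : normc z0 <= r0 by rewrite lerDl.
(* Only the value of the quotient at [z0] is in question. Each of its real and imaginary parts is
   the supremum of the lower bounds [f q.[z0] - e] given by all approximate quotients; by
   [divides_up_to_close] these never exceed the corresponding upper bounds. *)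
have lim (f : {additive R[i] -> R}) : (forall z, `|f z| <= normc z) ->
    exists a, forall q e, divides_up_to h z0 r0 e q -> `|a - f q.[z0]| <= e.
  move=> hf; pose S := [set x | exists q e, divides_up_to h z0 r0 e q /\ x = f q.[z0] - e].
  have le q e q' e' : divides_up_to h z0 r0 e q -> divides_up_to h z0 r0 e' q' ->
      f q.[z0] - e <= f q'.[z0] + e'.
    move=> d d'; have := divides_up_to_close (lexx _) d d' z0r.
    have := hf (q.[z0] - q'.[z0]); rewrite raddfB ler_norml; lra.
  have [q1 hq1] := divides_up_to_exists hh h0 z0r ltr01.
  exists (sup S) => q e d; rewrite ler_norml.
  have : f q.[z0] - e <= sup S.
    apply: ub_le_sup; last by exists q, e.
    by exists (f q1.[z0] + 1) => x [q' [e' [d' ->]]]; apply: le.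
  have : sup S <= f q.[z0] + e.
    apply: ge_sup; first by exists (f q1.[z0] - 1), q1, 1.
    by move=> x [q' [e' [d' ->]]]; apply: le.
  lra.
have [a ha] := lim (@Re R : {additive _ -> _}) (@normc_geRe R).
have [b hb] := lim (@Im R : {additive _ -> _}) (@normc_geIm R).
exists (fun z => if z == z0 then a +i* b else h z / (z - z0)); last first.
  move=> z; case: eqP => [->|/eqP zz0]; first by rewrite h0 subrr mul0r.
  by rewrite mulrC divfK // subr_eq0.
move=> r e e0; have e2 : 0 < e / 2 by rewrite divr_gt0.
pose r' := Num.max r r0; have r0' : r0 <= r' by rewrite le_max lexx orbT.
have z0r' := le_trans z0r r0'.
have [q hq] := divides_up_to_exists hh h0 z0r' e2.
exists q => z zr; case: eqP => [->|/eqP zz0].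
  have hq0 : divides_up_to h z0 r0 (e / 2) q.
    by split=> // w wr; case: hq => _; apply; apply: le_trans r0'.
  apply: le_trans (normc_leReIm _) _; rewrite ReB ImB [leRHS]splitr.
  by rewrite lerD ?ha ?hb.
have nz : 0 < normc (z - z0) by rewrite normc_gt0 subr_eq0.
apply/ler_addgt0Pr => e1 e10.
(* The finer quotient [q'] may depend on [z], because it is only an intermediary between
   [h z / (z - z0)] and the uniform choice [q]. *)
pose e' := Num.min (e1 / 2) (e1 / 2 * normc (z - z0)).
have e0' : 0 < e' by rewrite lt_min divr_gt0 // mulr_gt0 // divr_gt0.
have [q' hq'] := divides_up_to_exists hh h0 z0r' e0'.
have zr' : normc z <= r' by rewrite (le_trans zr) // le_max lexx.
have := divides_up_to_close r0' hq' hq zr'.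
have : normc (h z / (z - z0) - q'.[z]) <= e1 / 2.
  case: (hq') => _ /(_ z zr') hz.
  have -> : h z / (z - z0) - q'.[z] = (h z - (z - z0) * q'.[z]) / (z - z0).
    by rewrite mulrBl [_ * q'.[z]]mulrC mulfK // subr_eq0.
  rewrite normcM normcV ler_pdivrMr //.
  by apply: le_trans hz _; rewrite ge_min lexx orbT.
have : e' <= e1 / 2 by rewrite ge_min lexx.
have := le_normcD (h z / (z - z0) - q'.[z]) (q'.[z] - q.[z]).
by rewrite subrKA; lra.
Qed.

(** The quotient of [h z - h 0] by [z] is at most [2 * B / |z|], hence small on the boundary of a
    large square, and the maximum principle makes it small everywhere. *)
Lemma entire_liouville h (B : R) : entire h -> (forall z, normc (h z) <= B) ->
  forall z, h z = h 0.
Proof.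
move=> hh hB z.
have [k kk hk] : exists2 k, entire k & forall z, h z - h 0 = (z - 0) * k z.
  by apply: entire_div; [apply: entireB => //; apply: entire_cst | rewrite subrr].
have zk y : y * k y = h y - h 0 by rewrite hk subr0.
suff k0 : k z = 0 by apply/eqP; rewrite -subr_eq0 hk k0 mulr0.
apply/eqP; rewrite -normc_eq0 eq_le normc_ge0 andbT; apply/ler_addgt0Pr => e e0.
have B0 : 0 <= B by apply: le_trans (hB 0); rewrite normc_ge0.
pose s := normc z + (2 * B + 1) / e.
have s0 : 0 < s by rewrite ltr_wpDl ?normc_ge0 // divr_gt0 //; lra.
rewrite add0r; apply: (entire_max_square (z0 := 0) kk s0); last first.
  by rewrite subr0 /s lerDl divr_ge0 ?ltW //; lra.
move=> w /andP[sw _]; rewrite subr0 in sw.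
have w0 : 0 < normc w by apply: lt_le_trans sw.
rewrite -(ler_pM2l w0) -normcM zk.
apply: le_trans (normcB _ _) _; apply: le_trans (lerD (hB w) (hB 0)) _.
have : s * e <= normc w * e by rewrite ler_pM2r.
rewrite /s mulrDl divfK ?gt_eqF //; have : 0 <= normc z * e by rewrite mulr_ge0 ?normc_ge0 ?ltW.
lra.
Qed.

(** Dividing [h z - h 0] by [z] lowers the exponent by one; at exponent 0 the function is
    bounded. *)
Lemma entire_poly_growth h m (B : R) : entire h ->
  (forall z, 1 <= normc z -> normc (h z) <= B * normc z ^+ m) ->
  exists p, forall z, h z = p.[z].
Proof.
elim: m h B => [|m IH] h B hh hB.
  have [M M0 hM] := entire_bounded 1 hh.
  exists (h 0)%:P => z; rewrite hornerC; apply: (entire_liouville (B := `|B| + M) hh) => w.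
  have [w1|/ltW w1] := leP 1 (normc w).
    by rewrite (le_trans (hB _ w1)) // mulr1 ler_wpDr ?ler_norm // ltW.
  by rewrite (le_trans (hM _ w1)) // ler_wpDl.
have [k kk hk] : exists2 k, entire k & forall z, h z - h 0 = (z - 0) * k z.
  by apply: entire_div; [apply: entireB => //; apply: entire_cst | rewrite subrr].
have zk y : y * k y = h y - h 0 by rewrite hk subr0.
have [|p hp] := IH k (B + normc (h 0)) kk.
  move=> z z1; have z0 : 0 < normc z by apply: lt_le_trans z1.
  rewrite -(ler_pM2l z0) -normcM zk.
  apply: le_trans (normcB _ _) _; rewrite mulrCA -exprS mulrDl lerD ?hB //.
  by rewrite ler_peMr ?normc_ge0 // exprn_ege1.
exists ('X * p + (h 0)%:P) => z; rewrite !hornerE -hp.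
by rewrite zk subrK.
Qed.

(** A substitute for Jensen's formula. Dividing out one zero of the unit disc gains [s - 1] beyond
    radius [s], and the maximum principle spreads this gain inside; multiplying back costs at most
    [normc z + 1]. *)
Lemma entire_zeros_bound n (a : nat -> R[i]) h (s M : R) : entire h -> injective a ->
  (forall i, normc (a i) <= 1) -> (forall i, h (a i) = 0) -> 1 < s ->
  (forall z, normc z <= 2 * s -> normc (h z) <= M) ->
  forall z, normc z <= s -> normc (h z) <= M * ((normc z + 1) / (s - 1)) ^+ n.
Proof.
move=> hh ai a1 ha s1 hM z zs; have s0 : 0 < s by apply: lt_trans s1.
have s10 : 0 < s - 1 by rewrite subr_gt0.
elim: n => [|n IH] in a h M hh ai a1 ha hM *.
  by rewrite mulr1 hM // (le_trans zs) //; lra.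
have [k kk hk] := entire_div hh (ha 0%N).
have ka i : k (a i.+1) = 0.
  have /esym/eqP := ha i.+1; rewrite hk eq_sym mulf_eq0 subr_eq0.
  by case/orP => /eqP // /ai.
have far w : s <= normc w <= 2 * s -> normc (k w) <= M / (s - 1).
  move=> /andP[w1 w2]; rewrite ler_pdivlMr //.
  apply: le_trans (hM w w2); rewrite hk normcM mulrC ler_wpM2r ?normc_ge0 //.
  by have := le_normcD (w - a 0%N) (a 0%N); rewrite subrK; have := a1 0%N; lra.
have kM w : normc w <= 2 * s -> normc (k w) <= M / (s - 1).
  have [sw w2|/ltW ws _] := leP s (normc w); first by rewrite far ?sw.
  apply: (entire_max_square (z0 := 0) kk s0); last by rewrite subr0.
  by move=> v; rewrite subr0; apply: far.
have := IH (a \o succn) k (M / (s - 1)) kk.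
move=> /(_ _ _ ka kM) IHk; rewrite hk normcM.
apply: le_trans (_ : (normc z + 1) * (M / (s - 1) * ((normc z + 1) / (s - 1)) ^+ n) <= _).
  apply: ler_pM; rewrite ?normc_ge0 //.
    by apply: le_trans (normcB _ _) _; rewrite lerD2l.
  by apply: IHk => [i j /ai[]|i]; last exact: a1.
by rewrite exprS le_eqVlt; apply/orP; left; apply/eqP; ring.
Qed.

Lemma entire_identity (a : nat -> R[i]) h : entire h -> injective a ->
  (forall i, normc (a i) <= 1) -> (forall i, h (a i) = 0) -> forall z, h z = 0.
Proof.
(* This radius makes [(normc z + 1) / (s - 1)] equal to one half, so that [n] zeros give the factor
   [2^-n]. *)
move=> hh ai a1 ha z; pose s := 2 * normc z + 3.
have zp := normc_ge0 z.
have [M M0 hM] := entire_bounded (2 * s) hh.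
apply/eqP; rewrite -normc_eq0 eq_le normc_ge0 andbT; apply/ler_addgt0Pr => e e0.
rewrite add0r.
have [n hn] : exists n, M / e < 2 ^+ n.
  have := archi_boundP (divr_ge0 (ltW M0) (ltW e0)); set n := Num.bound _ => h1.
  exists n; apply: lt_trans h1 _; rewrite -natrX ltr_nat; exact: ltn_expl.
have := @entire_zeros_bound n a h s M hh ai a1 ha _ hM z _.
rewrite /s => /(_ ltac:(lra) ltac:(lra)).
have -> : (normc z + 1) / (2 * normc z + 3 - 1) = 2^-1.
  have -> : 2 * normc z + 3 - 1 = (normc z + 1) * 2 by ring.
  by rewrite invfM mulrA divff ?mul1r // gt_eqF //; lra.
move=> h1; apply: le_trans h1 _; rewrite exprVn ler_pdivrMr ?exprn_gt0 //.
by rewrite -ler_pdivrMl // mulrC ltW.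
Qed.

End EntireTheory.

(** * The complex exponential and its Taylor remainder *)

Section ComplexExponential.
Variable R : realType.
Implicit Types (z w u : R[i]) (x y s r e : R).

Lemma derive_ge0_le (f df : R -> R) (a b : R) : a <= b ->
  (forall x, a <= x <= b -> is_derive x 1 f (df x)) ->
  (forall x, a <= x <= b -> 0 <= df x) -> f a <= f b.
Proof.
rewrite le_eqVlt => /predU1P[-> //|ab] hf df0.
have [||c] := @MVT _ f df a b ab.
- by move=> x; rewrite in_itv /= => /andP[/ltW ax /ltW xb]; apply: hf; rewrite ax xb.
- apply: derivable_within_continuous => x; rewrite in_itv /= => axb.
  by have [] := hf x axb.
rewrite in_itv /= => /andP[ac cb] e; rewrite -subr_ge0 e mulr_ge0 ?df0 ?(ltW ac) ?(ltW cb) //.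
by rewrite subr_ge0 ltW.
Qed.

Lemma is_derive_fM (f g : R -> R) x a b : is_derive x 1 f a -> is_derive x 1 g b ->
  is_derive x 1 (fun t => f t * g t) (a * g x + f x * b).
Proof.
move=> hf hg; have h := is_deriveM hf hg; apply: is_derive_eq.
by rewrite addrC; congr (_ + _); rewrite [LHS]mulrC.
Qed.

Lemma is_derive_fB (f g : R -> R) x a b : is_derive x 1 f a -> is_derive x 1 g b ->
  is_derive x 1 (fun t => f t - g t) (a - b).
Proof. by move=> hf hg; have h := is_deriveB hf hg; apply: is_derive_eq. Qed.

Lemma is_derive_fD (f g : R -> R) x a b : is_derive x 1 f a -> is_derive x 1 g b ->
  is_derive x 1 (fun t => f t + g t) (a + b).
Proof. by move=> hf hg; have h := is_deriveD hf hg; apply: is_derive_eq. Qed.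

Lemma is_derive_fZ (f : R -> R) x a c : is_derive x 1 f a ->
  is_derive x 1 (fun t => c * f t) (c * a).
Proof.
move=> hf; have h := is_derive_fM (is_derive_cst c _ _) hf.
by apply: is_derive_eq; rewrite mul0r add0r.
Qed.

Lemma is_derive_comp (f g : R -> R) x a b : is_derive (g x) 1 f a -> is_derive x 1 g b ->
  is_derive x 1 (fun t => f (g t)) (a * b).
Proof. exact: is_derive1_comp. Qed.

Lemma is_derive_lin c x : is_derive x 1 (fun t : R => t * c) c.
Proof.
have h := is_derive_fM (is_derive_id x 1) (is_derive_cst c x 1).
by apply: is_derive_eq; rewrite mul1r mulr0 addr0.
Qed.

Lemma is_derive_fX n x : is_derive x 1 (fun t : R => t ^+ n) (n%:R * x ^+ n.-1).
Proof.
have := is_derive_poly 'X^n x; rewrite derivXn hornerMn hornerXn mulr_natl.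
by congr is_derive; apply/funext => t; rewrite hornerXn.
Qed.

Definition cexp z : R[i] := (expR (Re z) * cos (Im z)) +i* (expR (Re z) * sin (Im z)).

Lemma cexp0 : cexp 0 = 1.
Proof. by apply: complex_eq; rewrite /= expR0 ?cos0 ?sin0 ?mulr1 ?mulr0. Qed.

Lemma cexpD z w : cexp (z + w) = cexp z * cexp w.
Proof.
by apply: complex_eq; rewrite ?ReM ?ImM /= ReD ImD expRD ?cosD ?sinD; ring.
Qed.

Lemma normc_cexp z : normc (cexp z) = expR (Re z).
Proof.
rewrite /= !exprMn -mulrDr cos2Dsin2 mulr1 sqrtr_sqr ger0_norm // expR_ge0.
Qed.

Lemma cexp_neq0 z : cexp z != 0.
Proof. by rewrite -normc_eq0 normc_cexp gt_eqF // expR_gt0. Qed.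

Lemma cexpN z : cexp (- z) = (cexp z)^-1.
Proof. by apply: (mulIf (cexp_neq0 z)); rewrite -cexpD addNr cexp0 mulVf // cexp_neq0. Qed.

Lemma cexp_real x : cexp x%:C = (expR x)%:C.
Proof. by apply: complex_eq; rewrite /= ?cos0 ?sin0 ?mulr1 ?mulr0. Qed.

Lemma is_derive_cexp z u s : is_derive s 1 (fun t : R => Re (u * cexp (t%:C * z)))
  (Re (u * z * cexp (s%:C * z))).
Proof.
case: z u => x y [p q].
have -> : (fun t : R => Re ((p +i* q) * cexp (t%:C * (x +i* y)))) =
    (fun t => expR (t * x) * (p * cos (t * y) - q * sin (t * y))).
  by apply/funext => t; rewrite ReM /= !mul0r subr0 addr0; ring.
have h := is_derive_fM (is_derive_comp (is_derive_expR _) (is_derive_lin x s))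
  (is_derive_fB (is_derive_fZ p (is_derive_comp (is_derive_cos _) (is_derive_lin y s)))
     (is_derive_fZ q (is_derive_comp (is_derive_sin _) (is_derive_lin y s)))).
by apply: is_derive_eq; rewrite ReM /= !mul0r subr0 addr0; ring.
Qed.

Definition exp_poly n : {poly R[i]} := \poly_(k < n) (k`!%:R)^-1.

Definition exp_tail n r := expR r - \sum_(k < n) r ^+ k / k`!%:R.

Lemma derive_exp_sum n s : is_derive s 1
  (fun t : R => \sum_(k < n.+1) t ^+ k / k`!%:R) (\sum_(k < n) s ^+ k / k`!%:R).
Proof.
elim: n => [|n IH].
  rewrite big_ord0; have := is_derive_cst (1 : R) s 1; congr is_derive.
  by apply/funext => t; rewrite big_ord1 expr0 fact0 divr1.
rewrite big_ord_recr /=.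
have -> : (fun t : R => \sum_(k < n.+2) t ^+ k / k`!%:R) =
  (fun t => \sum_(k < n.+1) t ^+ k / k`!%:R + (n.+1)`!%:R^-1 * t ^+ n.+1).
  by apply/funext => t; rewrite big_ord_recr /= [X in _ + X]mulrC.
apply: is_derive_fD => //; have h := is_derive_fZ (n.+1)`!%:R^-1 (is_derive_fX n.+1 s).
apply: is_derive_eq; rewrite factS natrM invfM /= [LHS]mulrC -mulrA mulrCA.
by rewrite mulVKf ?pnatr_eq0.
Qed.

Lemma ReZ x z : Re (x%:C * z) = x * Re z.
Proof. by rewrite ReM /= mul0r subr0. Qed.

Lemma exp_polyS n z : (exp_poly n.+1).[z] = (exp_poly n).[z] + z ^+ n / n`!%:R.
Proof. by rewrite !horner_poly big_ord_recr /= [_^-1 * _]mulrC. Qed.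

Lemma is_derive_exp_poly n u z (t : R) : is_derive t 1
  (fun s : R => Re (u * (exp_poly n.+1).[s%:C * z])) (Re (u * z * (exp_poly n).[t%:C * z])).
Proof.
elim: n => [|n IH].
  rewrite horner_poly big_ord0 mulr0; have := is_derive_cst (Re u) t 1; congr is_derive.
  by apply/funext => s; rewrite horner_poly big_ord1 expr0 fact0 invr1 !mulr1.
have -> : (fun s : R => Re (u * (exp_poly n.+2).[s%:C * z])) =
    (fun s => Re (u * (exp_poly n.+1).[s%:C * z]) + Re (u * z ^+ n.+1 / (n.+1)`!%:R) * s ^+ n.+1).
  apply/funext => s; rewrite exp_polyS mulrDr ReD; congr (_ + _).
  by rewrite [RHS]mulrC -ReZ rmorphXn exprMn; congr Re; ring.
rewrite exp_polyS mulrDr ReD; apply: is_derive_fD => //.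
have h := is_derive_fZ (Re (u * z ^+ n.+1 / (n.+1)`!%:R)) (is_derive_fX n.+1 t).
apply: is_derive_eq; rewrite /= mulrC -ReZ; congr Re.
rewrite rmorphM rmorphXn rmorph_nat /= factS natrM invfM exprMn exprS.
have n0 : n.+1%:R != 0 :> R[i] by rewrite pnatr_eq0.
set N := n.+1%:R in n0 *.
have -> : N * t%:C ^+ n * (u * (z * z ^+ n) * (N^-1 * n`!%:R^-1)) =
  N * N^-1 * (u * z * (t%:C ^+ n * z ^+ n * n`!%:R^-1)) by ring.
by rewrite divff // mul1r.
Qed.

(** Induction through the derivative along the ray [t * z]: differentiation lowers the order of both
    remainders by one, and the bound on the derivatives integrates from 0 to 1. A rotation [u] turns
    the modulus at [t = 1] into a real part, so real monotonicity suffices. *)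
Lemma cexp_taylor n z : normc (cexp z - (exp_poly n).[z]) <= exp_tail n (normc z).
Proof.
elim: n z => [|n IH] z.
  rewrite horner_poly /exp_tail !big_ord0 !subr0 normc_cexp ler_expR.
  exact: le_trans (ler_norm _) (normc_geRe _).
have [u u1 <-] := normc_rotate (cexp z - (exp_poly n.+1).[z]).
pose phi t := Re (u * cexp (t%:C * z)) - Re (u * (exp_poly n.+1).[t%:C * z]).
pose psi (t : R) := exp_tail n.+1 (t * normc z).
have dpsi (t : R) : is_derive t 1 psi (normc z * exp_tail n (t * normc z)).
  have := is_derive_comp (is_derive_fB (is_derive_expR _) (derive_exp_sum n _))
    (is_derive_lin (normc z) t).
  by rewrite mulrC.
have dphi (t : R) : is_derive t 1 phi (Re (u * z * (cexp (t%:C * z) - (exp_poly n).[t%:C * z]))).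
  by rewrite mulrBr ReB; apply: is_derive_fB; [apply: is_derive_cexp|apply: is_derive_exp_poly].
have : psi 0 - phi 0 <= psi 1 - phi 1.
  apply: derive_ge0_le ler01 (fun t _ => is_derive_fB (dpsi t) (dphi t)) _ => t /andP[t0 _].
  rewrite subr_ge0; apply: le_trans (ler_norm _) _; apply: le_trans (normc_geRe _) _.
  rewrite !normcM u1 mul1r ler_wpM2l ?normc_ge0 //.
  by apply: le_trans (IH _) _; rewrite normcM normc_real ger0_norm.
have -> : psi 0 = 0.
  rewrite /psi /exp_tail mul0r expR0 big_ord_recl big1 => [|i _].
    by rewrite expr0 fact0 divr1 addr0 subrr.
  by rewrite expr0n mul0r.
have -> : phi 0 = 0.
  rewrite /phi mul0r cexp0 horner_poly big_ord_recl big1 => [|i _].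
    by rewrite expr0 fact0 invr1 mulr1 addr0 subrr.
  by rewrite expr0n mulr0.
by rewrite /psi /phi !mul1r mulrBr ReB subr0 subr_ge0.
Qed.

Lemma exp_tail_cvg r : exp_tail ^~ r @ \oo --> (0 : R).
Proof.
have -> : exp_tail ^~ r = (fun n => expR r - series (exp_coeff r) n).
  by apply/funext => n; rewrite /exp_tail /series /= big_mkord.
rewrite -(subrr (expR r)); apply: cvgB; [exact: cvg_cst|].
exact: is_cvg_series_exp_coeff.
Qed.

Lemma exp_tail_ge0 n r : 0 <= r -> 0 <= exp_tail n r.
Proof.
move=> r0; have := cexp_taylor n r%:C; rewrite normc_real ger0_norm //.
exact: le_trans (normc_ge0 _).
Qed.

Lemma exp_tail_le_exp n r : 0 <= r -> exp_tail n r <= expR r.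
Proof.
by move=> r0; rewrite /exp_tail gerBl sumr_ge0 // => i _; rewrite divr_ge0 // exprn_ge0.
Qed.

Lemma exp_tail_homo n : {in Num.nneg &, {homo exp_tail n : x y / x <= y}}.
Proof.
move=> x y; rewrite !nnegrE => x0 y0 xy; case: n => [|n].
  by rewrite /exp_tail !big_ord0 !subr0 ler_expR.
apply: derive_ge0_le xy (fun t _ => is_derive_fB (is_derive_expR t) (derive_exp_sum n t)) _.
by move=> t /andP[xt _]; apply: (exp_tail_ge0 n); apply: le_trans xt.
Qed.

Lemma entire_cexp : entire cexp.
Proof.
move=> r e e0; have := exp_tail_cvg `|r|.
move=> /cvgrPdist_le /(_ e e0)[n _ /(_ n (leqnn n))]; rewrite sub0r normrN.
move=> hn; exists (exp_poly n) => z zr; apply: le_trans (cexp_taylor _ _) _.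
apply: le_trans hn; apply: le_trans (ler_norm _).
by apply: exp_tail_homo; rewrite ?nnegrE ?normc_ge0 // (le_trans zr) ?ler_norm.
Qed.

End ComplexExponential.

(** * Phragmen-Lindelof in a sector and in a quadrant *)

Section PhragmenLindelof.
Variable R : realType.
Implicit Types (z w : R[i]) (r e : R) (h k : R[i] -> R[i]).

Lemma cos_ge (x y : R) : `|x| <= y -> y <= pi -> cos y <= cos x.
Proof.
move=> xy ypi; rewrite -(cos_norm x); have x0 := normr_ge0 x.
rewrite leNgt ltr_cos ?in_itv /= ?x0 ?ypi ?(le_trans xy) ?(le_trans x0) // -leNgt //.
Qed.

(** Removes the comparison factor at the end of Phragmen-Lindelof, where the point is fixed and [e]
    is arbitrary. *)
Lemma le_expR_eps (x y c : R) : 0 <= y -> 0 <= c ->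
  (forall e, 0 < e -> x <= y * expR (e * c)) -> x <= y.
Proof.
move=> y0 c0 h; rewrite leNgt; apply/negP => yx.
have y0' : 0 < y.
  rewrite lt_def y0 andbT; apply/eqP => ye.
  by have := h 1 ltr01; rewrite ye mul0r leNgt (le_lt_trans y0 yx).
pose e := ln (x / y) / (c + 1); have c10 : 0 < c + 1 by rewrite ltr_wpDl.
have xy1 : 1 < x / y by rewrite ltr_pdivlMr // mul1r.
have e0 : 0 < e by rewrite divr_gt0 // ln_gt0.
have := h e e0; rewrite leNgt => /negP; apply.
rewrite -ltr_pdivlMl // [ltRHS]mulrC -[ltRHS]lnK ?posrE ?(lt_trans ltr01) // ltr_expR.
by rewrite -[ltRHS](divfK (lt0r_neq0 c10)) ltr_pM2l // ltrDl.
Qed.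

(** With [expR s] as the modulus of a point outside the unit disc, this compares [(1 + |z|^2)^M]
    with [|z|^(2 M)]. *)
Lemma poly_le_expR (s B : R) M : 0 <= s -> 0 <= B ->
  B * (1 + expR (2 * s)) ^+ M <= B * 2 ^+ M * expR (2 * M%:R * s).
Proof.
move=> s0 B0; rewrite -mulrA ler_wpM2l //.
have -> : 2 * M%:R * s = M%:R * (2 * s) by ring.
rewrite (expRM_natl M (2 * s)) -exprMn.
apply: lerXn2r; rewrite ?nnegrE ?addr_ge0 ?mulr_ge0 ?expR_ge0 //.
have : 1 <= expR (2 * s) by rewrite -expR0 ler_expR mulr_ge0.
lra.
Qed.

(* With [w = log z], a sector becomes a strip, and the comparison function
   [exp (- e z ^ rho)] is entire in [w] for any real exponent [rho > 2]. *)
Lemma phragmen_lindelof_strip h (a b A B : R) M : entire h -> a < b -> b - a < pi / 2 ->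
  0 <= A -> 0 <= B ->
  (forall s t, 0 <= s -> a <= t <= b -> normc (h (s +i* t)) <= A * expR (expR (2 * s))) ->
  (forall s t, 0 <= s -> (t == a) || (t == b) ->
     normc (h (s +i* t)) <= B * (1 + expR (2 * s)) ^+ M) ->
  forall s t, 0 <= s -> a <= t <= b ->
    normc (h (s +i* t)) <= (A * expR 1 + B * 2 ^+ M) * expR (2 * M%:R * s).
Proof.
move=> hh ab ba A0 B0 hA hB s0 t0 s00 t0ab.
have ba0 : 0 < b - a by rewrite subr_gt0.
have pi0 : 0 < pi :> R := pi_gt0 R.
set K := A * expR 1 + B * 2 ^+ M.
have AK : A * expR 1 <= K by rewrite lerDl mulr_ge0 // exprn_ge0.
have BK : B * 2 ^+ M <= K by rewrite lerDr mulr_ge0 ?expR_ge0.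
(* The midpoint of 2 and [pi / (b - a)]: above 2 it beats the growth of [h], and below
   [pi / (b - a)] it keeps [cos (rho * (t - phi))] at least [kap] on the whole strip. *)
pose rho := (2 + pi / (b - a)) / 2.
have rho2 : 2 < pi / (b - a) by rewrite ltr_pdivlMr //; move: ba; lra.
have rho0 : 0 < rho - 2 by rewrite /rho; move: rho2; lra.
have rhopi : rho * (b - a) / 2 < pi / 2.
  rewrite ltr_pM2r // -ltr_pdivlMr // /rho; move: rho2; lra.
have rho_ge0 : 0 <= rho by move: rho0; lra.
pose phi := (a + b) / 2.
pose kap := cos (rho * (b - a) / 2).
have kap0 : 0 < kap.
  apply: cos_gt0_pihalf; rewrite rhopi andbT; apply: (@lt_le_trans _ _ 0).
    by rewrite oppr_lt0 divr_gt0.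
  by rewrite divr_ge0 // mulr_ge0 // ltW.
have coskap t : a <= t <= b -> kap <= cos (rho * (t - phi)).
  move=> tab; apply: cos_ge; last by move: rhopi; lra.
  rewrite normrM (ger0_norm rho_ge0) -mulrA ler_wpM2l // ler_norml /phi.
  by move: tab; lra.
apply: (@le_expR_eps _ _ (expR (rho * s0))); rewrite ?expR_ge0 //.
  by rewrite mulr_ge0 ?expR_ge0 // (le_trans _ AK) // mulr_ge0 ?expR_ge0.
move=> e e0.
(* From this abscissa on [e * kap * expR (rho * s)] exceeds [expR (2 * s)], so on the far edge the
   comparison function absorbs the whole growth of [h]. *)
pose T := Num.max s0 (- ln (e * kap) / (rho - 2)).
have ek0 : 0 < e * kap by rewrite mulr_gt0.
have T0 : 0 <= T by rewrite le_max s00.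
have hT : expR (2 * T) <= e * kap * expR (rho * T).
  rewrite -{1}(lnK ek0) -expRD ler_expR.
  have : - ln (e * kap) / (rho - 2) <= T by rewrite le_max lexx orbT.
  by rewrite ler_pdivrMr //; lra.
(* In the variable [expR] of [z] the first factor is the power of exponent [- 2 M], which
   compensates the polynomial bound on the sides; the second is the comparison function, centred on
   the bisector [phi]. *)
pose psi z := h z * (cexp ((- (2 * M%:R))%:C * z) *
  cexp ((- e)%:C * cexp (rho%:C * (z - 0 +i* phi)))).
have entire_psi : entire psi.
  apply: entireM => //; apply: entireM; first exact/entire_scale/entire_cexp.
  apply: (entire_comp (@entire_cexp R)); apply: entireZ.
  apply: (entire_comp (@entire_cexp R)); apply: entireZ.
  by apply: entireB; [apply: entire_id|apply: entire_cst].
have normpsi s t : normc (psi (s +i* t)) = normc (h (s +i* t)) *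
    (expR (- (2 * M%:R * s)) * expR (- (e * (expR (rho * s) * cos (rho * (t - phi)))))).
  rewrite /psi !normcM !normc_cexp !ReZ /= oppr0 addr0 !mul0r !subr0 !addr0 !mulNr.
  by [].
have Epos s t : a <= t <= b -> expR (- (e * (expR (rho * s) * cos (rho * (t - phi))))) <= 1.
  move=> tab; rewrite -expR0 ler_expR oppr_le0 !mulr_ge0 ?expR_ge0 ?(ltW e0) //.
  by rewrite (le_trans (ltW kap0)) ?coskap.
have Mpos s : 0 <= s -> expR (- (2 * M%:R * s)) <= 1.
  by move=> sp; rewrite -expR0 ler_expR oppr_le0 !mulr_ge0.
have aab : a <= a <= b by rewrite lexx ltW.
have abb : a <= b <= b by rewrite lexx ltW.
have bound : normc (psi (s0 +i* t0)) <= K.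
  apply: (@entire_max_rect _ psi 0 T a b _ entire_psi); last first.
    by rewrite /rect /= s00 t0ab andbT le_max lexx.
  move=> [s t] /andP[/andP[/= sp sT] tab] bd; rewrite normpsi.
  have side : (t == a) || (t == b) -> normc (h (s +i* t)) * (expR (- (2 * M%:R * s)) *
      expR (- (e * (expR (rho * s) * cos (rho * (t - phi)))))) <= K.
    move=> tt; apply: le_trans BK.
    have -> : B * 2 ^+ M = B * 2 ^+ M * expR (2 * M%:R * s) * (expR (- (2 * M%:R * s)) * 1).
      by rewrite mulr1 -mulrA -expRD subrr expR0 mulr1.
    rewrite ler_pM ?normc_ge0 ?mulr_ge0 ?expR_ge0 //.
      by apply: le_trans (hB s t sp tt) _; apply: poly_le_expR.
    by rewrite ler_wpM2l ?expR_ge0 // Epos.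
  case/or4P: bd => [/eqP se|/eqP se|ta|tb]; last 2 first.
  - by apply: side; rewrite ta.
  - by apply: side; rewrite tb orbT.
  - apply: le_trans AK; rewrite -[leRHS]mulr1 ler_pM ?normc_ge0 ?mulr_ge0 ?expR_ge0 //.
      by have := hA s t sp tab; rewrite se mulr0 expR0.
    by apply: mulr_ile1; [exact: expR_ge0|exact: expR_ge0|exact: Mpos|exact: Epos].
  apply: le_trans AK; apply: (@le_trans _ _ (A * 1)); last first.
    by rewrite ler_wpM2l // (le_trans _ (expR_ge1Dx 1)) // lerDl.
  have -> : A * 1 = A * expR (expR (2 * s)) * (1 * expR (- expR (2 * s))).
    by rewrite mul1r -mulrA -expRD subrr expR0.
  rewrite ler_pM ?normc_ge0 ?mulr_ge0 ?expR_ge0 ?hA //.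
  apply: ler_pM; [exact: expR_ge0|exact: expR_ge0|exact: Mpos|rewrite ler_expR lerN2 se].
  apply: le_trans hT _; rewrite -mulrA ler_wpM2l ?(ltW e0) // mulrC.
  by rewrite ler_wpM2l ?expR_ge0 ?coskap.
move: bound; rewrite normpsi !expRN -invfM ler_pdivrMr ?mulr_gt0 ?expR_gt0 //.
move=> h1; apply: le_trans h1 _; rewrite -[leRHS]mulrA; apply: ler_wpM2l.
  by rewrite (le_trans _ AK) // mulr_ge0 ?expR_ge0.
apply: ler_wpM2l; first exact: expR_ge0.
rewrite ler_expR ler_wpM2l ?(ltW e0) // -[leRHS]mulr1 ler_wpM2l ?expR_ge0 // cos_le1.
Qed.

Lemma quadrant_polar z : 1 <= normc z -> 0 <= Re z -> 0 <= Im z ->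
  exists s t, [/\ 0 <= s, 0 <= t <= pi / 2, expR s = normc z & z = cexp (s +i* t)].
Proof.
move=> z1 re im; have z0 : 0 < normc z by apply: lt_le_trans z1.
have rez : Re z <= normc z by rewrite (le_trans (ler_norm _)) ?normc_geRe.
pose c := Re z / normc z.
have c01 : 0 <= c <= 1 by rewrite /c divr_ge0 ?(ltW z0) //= ler_pdivrMr // mul1r.
have c11 : -1 <= c <= 1 by move: c01; lra.
have pi0 : 0 < pi :> R := pi_gt0 R.
exists (ln (normc z)), (acos c); split.
- by rewrite ln_ge0.
- rewrite acos_ge0 //= leNgt; apply/negP => h.
  have : cos (acos c) < cos (pi / 2).
    rewrite ltr_cos ?in_itv /= ?acos_ge0 ?acos_lepi //.
    by apply/andP; split; lra.
  by rewrite acosK // cos_pihalf ltNge; case/andP: c01 => ->.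
- by rewrite lnK.
- apply: complex_eq; rewrite /= lnK ?posrE //.
    by rewrite acosK // /c mulrC divfK // gt_eqF.
  rewrite sin_acos // -{1}(ger0_norm (ltW z0)) -sqrtr_sqr -sqrtrM ?sqr_ge0 //.
  rewrite mulrBr mulr1 /c expr_div_n mulrCA divff ?mulr1 ?expf_neq0 ?gt_eqF //.
  by rewrite sqr_normc addrAC subrr add0r sqrtr_sqr ger0_norm.
Qed.

(* [A1] is rotated by a small angle [al]: on each edge of the sector [al, pi/2]
   one factor is then evaluated on an axis, and the opening is below [pi/2]. *)
Lemma quadrant_bound A1 A2 (K B : R) M : entire A1 -> entire A2 -> 0 <= K -> 0 <= B ->
  (forall z, normc (A1 z) <= K * expR (normc z ^+ 2 / 2)) ->
  (forall z, normc (A2 z) <= K * expR (normc z ^+ 2 / 2)) ->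
  (forall r w, 0 < r -> normc w = r -> normc (A1 r%:C * A2 w) <= B * (1 + r ^+ 2) ^+ M) ->
  (forall r w, 0 < r -> normc w = r -> normc (A1 w * A2 (0 +i* r)) <= B * (1 + r ^+ 2) ^+ M) ->
  forall z, 1 <= normc z -> 0 <= Re z -> 0 <= Im z ->
  normc (A1 z * A2 z) <= (K ^+ 2 * expR 1 + B * 2 ^+ M) * normc z ^+ (2 * M).
Proof.
move=> h1 h2 K0 B0 g1 g2 b1 b2 z z1 re im.
have [s [t [s0 /andP[t0 tpi] es ->]]] := quadrant_polar z1 re im.
have e2s x : expR x ^+ 2 = expR (2 * x) :> R by rewrite -expRM_natl.
have -> : normc (cexp (s +i* t)) ^+ (2 * M) = expR (2 * M%:R * s).
  by rewrite normc_cexp -expRM_natl natrM.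
have nK : 0 <= K ^+ 2 * expR 1 by rewrite mulr_ge0 ?sqr_ge0 ?expR_ge0.
have norm_e x y : normc (cexp (x +i* y)) = expR x by rewrite normc_cexp.
(* On the positive half axis there is no room for a rotation, but there the first factor is already
   at a real point. *)
move: t0; rewrite le_eqVlt => /predU1P[<-|t0].
  have -> : cexp (s +i* 0) = (expR s)%:C by exact: cexp_real.
  have ns : normc (expR s)%:C = expR s by rewrite normc_real ger0_norm ?expR_ge0.
  apply: le_trans (b1 _ _ (expR_gt0 s) ns) _; rewrite e2s.
  apply: le_trans (poly_le_expR _ s0 B0) _.
  by rewrite ler_wpM2r ?expR_ge0 // lerDr.
(* The bound for the rotated product does not depend on the angle, so continuity of [f] at 0
   transfers it to the original product up to [e]. *)
pose f (x : R[i]) := A1 (cexp (s +i* t - x)) * A2 (cexp (s +i* t)).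
have hf : entire f.
  apply: entireM; last exact: entire_cst.
  apply: (entire_comp h1); apply: (entire_comp (@entire_cexp R)).
  by apply: entireB; [apply: entire_cst|apply: entire_id].
apply/ler_addgt0Pr => e e0; have [d d0 hd] := entire_continuous 0 hf e0.
have pi0 : 0 < pi :> R := pi_gt0 R.
(* The first bound gives closeness to [f 0]; the second keeps the argument [t] of the point inside
   the sector from [al] to [pi / 2]. *)
pose al := Num.min (d / 2) (t / 2).
have al0 : 0 < al by rewrite lt_min !divr_gt0.
have ald : al <= d / 2 by rewrite ge_min lexx.
have alt : al <= t / 2 by rewrite ge_min lexx orbT.
have := hd (0 +i* al); rewrite subr0 /= expr0n add0r sqrtr_sqr (gtr0_norm al0).
move=> /(_ ltac:(lra)); rewrite normc_distC => hc.
have -> : A1 (cexp (s +i* t)) * A2 (cexp (s +i* t)) = f 0 by rewrite /f subr0.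
rewrite -(subrK (f (0 +i* al)) (f 0)) addrC; apply: le_trans (le_normcD _ _) _.
apply: lerD => //.
pose h z := A1 (cexp (z - 0 +i* al)) * A2 (cexp z).
apply: (@phragmen_lindelof_strip h al (pi / 2)) => //; rewrite ?sqr_ge0 //.
- apply: entireM; last exact: (entire_comp h2 (@entire_cexp R)).
  apply: (entire_comp h1); apply: (entire_comp (@entire_cexp R)).
  by apply: entireB; [apply: entire_id|apply: entire_cst].
- lra.
- lra.
- move=> x y x0 _; rewrite /h normcM.
  have -> : K ^+ 2 * expR (expR (2 * x)) = K * expR (expR x ^+ 2 / 2) * (K * expR (expR x ^+ 2 / 2)).
    by rewrite mulrACA -expr2 -expRD -splitr e2s.
  rewrite ler_pM ?normc_ge0 //.
    by apply: le_trans (g1 _) _; rewrite normc_cexp ReB /= subr0.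
  by apply: le_trans (g2 _) _; rewrite normc_cexp.
- move=> x y x0 /orP[/eqP->|/eqP->]; rewrite -e2s /h.
    have -> : x +i* al - 0 +i* al = x%:C by apply: complex_eq; rewrite /= ?subr0 ?subrr.
    by rewrite cexp_real; apply: b1; rewrite ?expR_gt0 ?norm_e.
  have -> : cexp (x +i* (pi / 2)) = 0 +i* expR x.
    by apply: complex_eq; rewrite /= ?cos_pihalf ?sin_pihalf ?mulr0 ?mulr1.
  by apply: b2; rewrite ?expR_gt0 // normc_cexp ReB /= subr0.
- by apply/andP; split; lra.
Qed.

End PhragmenLindelof.

(** * Approximation of [ln |h|] by real parts of polynomials, for zero-free [h] *)

Section HarmonicApproximation.
Variable R : realType.
Implicit Types (z w : R[i]) (r e : R) (h k : R[i] -> R[i]) (p q : {poly R[i]}).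

(** The Taylor polynomial of degree [n] of [ln (1 - z)] at 0. *)
Definition log_poly n : {poly R[i]} := \poly_(k < n.+1) (if k is 0 then 0 else - k%:R^-1).

Lemma log_polyS n z : (log_poly n.+1).[z] = (log_poly n).[z] - z ^+ n.+1 / n.+1%:R.
Proof. by rewrite !horner_poly big_ord_recr /= mulNr [_^-1 * _]mulrC. Qed.

Lemma is_derive_log_poly n z (t : R) : is_derive t 1 (fun s : R => Re (log_poly n).[s%:C * z])
  (- Re (z * \sum_(k < n) (t%:C * z) ^+ k)).
Proof.
elim: n => [|n IH].
  rewrite big_ord0 mulr0 oppr0; have := is_derive_cst (0 : R) t 1; congr is_derive.
  by apply/funext => s; rewrite horner_poly big_ord1 mul0r.
have -> : (fun s : R => Re (log_poly n.+1).[s%:C * z]) =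
    (fun s => Re (log_poly n).[s%:C * z] + (- Re (z ^+ n.+1 / n.+1%:R)) * s ^+ n.+1).
  apply/funext => s; rewrite log_polyS ReB mulNr; congr (_ - _).
  by rewrite [RHS]mulrC -ReZ rmorphXn exprMn mulrA.
rewrite big_ord_recr /= mulrDr ReD opprD; apply: is_derive_fD => //.
have h := is_derive_fZ (- Re (z ^+ n.+1 / n.+1%:R)) (is_derive_fX n.+1 t).
apply: is_derive_eq; rewrite mulNr mulrC -ReZ; congr (- Re _).
rewrite rmorphM rmorphXn rmorph_nat /= exprMn exprS.
have n0 : n.+1%:R != 0 :> R[i] by rewrite pnatr_eq0.
set N := n.+1%:R in n0 *.
have -> : N * t%:C ^+ n * (z * z ^+ n / N) = N / N * (z * (t%:C ^+ n * z ^+ n)) by ring.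
by rewrite divff // mul1r.
Qed.

Lemma sqr_normc_1B z (t : R) : normc (1 - t%:C * z) ^+ 2 = (1 - t * Re z) ^+ 2 + (t * Im z) ^+ 2.
Proof. by rewrite sqr_normc !ReB !ImB !ReM !ImM /=; ring. Qed.

Lemma is_derive_ln_normc z (t : R) : 1 - t%:C * z != 0 ->
  is_derive t 1 (fun s : R => ln (normc (1 - s%:C * z) ^+ 2) / 2) (- Re (z / (1 - t%:C * z))).
Proof.
move=> z0; set D := fun s : R => (1 - s * Re z) ^+ 2 + (s * Im z) ^+ 2.
have -> : (fun s : R => ln (normc (1 - s%:C * z) ^+ 2) / 2) = (fun s => 2^-1 * ln (D s)).
  by apply/funext => s; rewrite sqr_normc_1B mulrC.
have D0 : 0 < D t by rewrite /D -sqr_normc_1B exprn_gt0 // normc_gt0.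
have dD : is_derive t 1 D (2 * (1 - t * Re z) * (- Re z) + 2 * (t * Im z) * Im z).
  apply: is_derive_fD.
    have h := @is_derive_comp _ (fun u => u ^+ 2) (fun s => 1 - s * Re z) t _ _
      (is_derive_fX 2 _) (is_derive_fB (is_derive_cst (1 : R) t 1) (is_derive_lin (Re z) t)).
    by apply: is_derive_eq; rewrite /= sub0r expr1.
  by have h := @is_derive_comp _ (fun u => u ^+ 2) (fun s => s * Im z) t _ _
      (is_derive_fX 2 _) (is_derive_lin (Im z) t); apply: is_derive_eq; rewrite /= expr1.
have h := is_derive_fZ 2^-1 (is_derive_comp (is_derive1_ln D0) dD).
apply: is_derive_eq.
have -> : z / (1 - t%:C * z) = (D t)^-1%:C * (z * (1 - t%:C * z)^*).
  apply: (mulIf z0); rewrite mulfVK //.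
  have -> : (D t)^-1%:C * (z * (1 - t%:C * z)^*) * (1 - t%:C * z) =
    z * ((D t)^-1%:C * ((1 - t%:C * z) * (1 - t%:C * z)^*)) by ring.
  have -> : (1 - t%:C * z) * (1 - t%:C * z)^* = (D t)%:C.
    by case: z {z0 D0 dD h} @D => a b D; apply: complex_eq => /=; rewrite /D /=; ring.
  by rewrite -rmorphM mulVf ?gt_eqF // mulr1.
by rewrite ReZ; case: z {z0 dD h} @D D0 => a b D D0 /=; field; rewrite gt_eqF.
Qed.

(** Along the segment from 0 to [w] the two derivatives differ by the remainder of a geometric
    series, [w * (t * w)^n / (1 - t * w)], and [|w| <= 1/2 <= |1 - t * w|]. *)
Lemma log_poly_approx n w : normc w <= 2^-1 ->
  `|ln (normc (1 - w)) - Re (log_poly n).[w]| <= 2^-1 ^+ n.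
Proof.
move=> w2; have nz (t : R) : 0 <= t <= 1 -> 2^-1 <= normc (1 - t%:C * w).
  move=> /andP[t0 t1]; have := le_normcD (1 - t%:C * w) (t%:C * w).
  rewrite subrK normc1 normcM normc_real ger0_norm //.
  have : t * normc w <= 1 * normc w by rewrite ler_wpM2r ?normc_ge0.
  lra.
have nz' (t : R) : 0 <= t <= 1 -> 1 - t%:C * w != 0.
  by move=> /nz h; rewrite -normc_gt0; apply: lt_le_trans h; rewrite invr_gt0.
(* Half the logarithm of the square avoids differentiating a square root. *)
pose f (t : R) := ln (normc (1 - t%:C * w) ^+ 2) / 2 - Re (log_poly n).[t%:C * w].
pose df (t : R) := - Re (w / (1 - t%:C * w)) - - Re (w * \sum_(k < n) (t%:C * w) ^+ k).
have hf (t : R) : 0 <= t <= 1 -> is_derive t 1 f (df t).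
  move=> /nz' t0; apply: is_derive_fB; first exact: is_derive_ln_normc.
  exact: is_derive_log_poly.
have hdf (t : R) : 0 <= t <= 1 -> `|df t| <= 2^-1 ^+ n.
  move=> t01; have t0 := nz' t t01.
  have -> : df t = - Re (w * ((t%:C * w) ^+ n / (1 - t%:C * w))).
    rewrite /df opprK -ReN -ReD -ReN; congr Re.
    apply: (mulIf t0); rewrite mulrDl !mulNr mulrA !mulfVK //.
    have := subrX1 (t%:C * w) n => e.
    have -> : w * (\sum_(k < n) (t%:C * w) ^+ k) * (1 - t%:C * w) =
      - (w * ((t%:C * w - 1) * (\sum_(k < n) (t%:C * w) ^+ k))) by ring.
    by rewrite -e; ring.
  rewrite normrN; apply: le_trans (normc_geRe _) _.
  rewrite !normcM normcV normcX mulrCA -[leRHS]mulr1.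
  apply: ler_pM.
  - by rewrite exprn_ge0 ?normc_ge0.
  - by rewrite divr_ge0 ?normc_ge0.
  - apply: lerXn2r; rewrite ?nnegrE ?normc_ge0 ?invr_ge0 //.
    apply: le_trans w2; rewrite normcM normc_real; case/andP: t01 => ? ?.
    by rewrite ger0_norm // ler_piMl ?normc_ge0.
  - rewrite ler_pdivrMr; last by apply: lt_le_trans (nz t t01); rewrite invr_gt0.
    by rewrite mul1r (le_trans w2) ?nz.
have f0 : f 0 = 0.
  rewrite /f mul0r subr0 normc1 expr1n ln1 mul0r sub0r horner_poly big1 ?oppr0 //.
  by move=> [[|i] ?] _ /=; rewrite ?mul0r // expr0n mulr0.
have f1 : f 1 = ln (normc (1 - w)) - Re (log_poly n).[w].
  have := nz 1; rewrite /f mul1r => /(_ ltac:(lra)) n1.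
  have n1p : 0 < normc (1 - w) by apply: lt_le_trans n1; rewrite invr_gt0.
  by rewrite lnXn // mulr2n; lra.
rewrite -f1 ler_norml.
have up : f 1 <= 2^-1 ^+ n.
  have := @derive_ge0_le _ (fun t => t * 2^-1 ^+ n - f t) _ 0 1 ler01
    (fun t ht => is_derive_fB (is_derive_lin _ t) (hf t ht)).
  rewrite f0 mul0r mul1r subrr subr_ge0; apply => t /hdf; rewrite ler_norml; lra.
have lo : - 2^-1 ^+ n <= f 1.
  have := @derive_ge0_le _ (fun t => f t - t * (- 2^-1 ^+ n)) _ 0 1 ler01
    (fun t ht => is_derive_fB (hf t ht) (is_derive_lin _ t)).
  rewrite f0 mul0r mul1r subrr subr_ge0; apply => t /hdf; rewrite ler_norml; lra.
by rewrite up lo.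
Qed.

Lemma half_pow_small e : 0 < e -> exists n, 2^-1 ^+ n <= e.
Proof.
move=> e0; have := archi_boundP (ltW (_ : 0 < e^-1)); rewrite invr_gt0 => /(_ e0).
set n := Num.bound _ => h; exists n; rewrite exprVn -[leRHS]invrK.
rewrite lef_pV2 ?posrE ?exprn_gt0 ?invr_gt0 //; apply: ltW; apply: lt_trans h _.
by rewrite -natrX ltr_nat ltn_expl.
Qed.

(* The zeros being far away, [ln |1 - z/a|] is close to the real part of the
   truncated logarithmic series: no branch of the logarithm is needed. *)
Lemma log_approx_factors (s : seq R[i]) (r e : R) : 0 < e -> 0 < r ->
  (forall a, a \in s -> 2 * r <= normc a) ->
  exists q, forall z, normc z <= r ->
    `|ln (normc (\prod_(a <- s) ('X - a%:P)).[z]) - Re q.[z]| <= e.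
Proof.
move=> + r0; elim: s e => [|a s IH] e e0 hs.
  by exists 0 => z _; rewrite big_nil !hornerE normc1 ln1 subrr normr0 ltW.
have e2 : 0 < e / 2 by rewrite divr_gt0.
have [|q hq] := IH _ e2; first by move=> b bs; apply: hs; rewrite inE bs orbT.
have [n hn] := half_pow_small e2.
have ra : 2 * r <= normc a by apply: hs; rewrite mem_head.
have a0 : 0 < normc a by apply: lt_le_trans ra; rewrite mulr_gt0.
have a0' : a != 0 by rewrite -normc_gt0.
exists (q + ((ln (normc a))%:C)%:P + (log_poly n \Po (a^-1 *: 'X))) => z zr.
rewrite big_cons hornerM hornerXsubC !hornerD hornerC horner_comp hornerZ hornerX !ReD.
have za : normc (a^-1 * z) <= 2^-1.
  rewrite normcM normcV ler_pdivrMl // ler_pdivlMr // mulrC.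
  by apply: le_trans ra; rewrite ler_pM2l.
have -> : z - a = - a * (1 - a^-1 * z).
  have -> : - a * (1 - a^-1 * z) = a * a^-1 * z - a by ring.
  by rewrite divff // mul1r.
have s0 : 0 < normc (\prod_(a <- s) ('X - a%:P)).[z].
  rewrite normc_gt0 -rootE root_prod_XsubC; apply/negP => zs.
  have : 2 * r <= normc z by apply: hs; rewrite inE zs orbT.
  by move: zr r0; lra.
have w0 : 0 < normc (1 - a^-1 * z).
  have := le_normcD (1 - a^-1 * z) (a^-1 * z); rewrite subrK normc1; move: za; lra.
rewrite !normcM normcN !lnM ?posrE ?mulr_gt0 //.
have := hq z zr; have := log_poly_approx n za; move: hn; rewrite !ler_norml /=.
lra.
Qed.

Lemma log_approx_poly p (r e : R) : 0 < e -> 0 < r ->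
  (forall z, normc z <= 2 * r -> p.[z] != 0) ->
  exists q, forall z, normc z <= r -> `|ln (normc p.[z]) - Re q.[z]| <= e.
Proof.
move=> e0 r0 hp; have [s ps] := closed_field_poly_normal p.
have p0 : p != 0.
  by apply: contraNneq (hp 0 _) => [->|]; rewrite ?horner0 // normc0 mulr_ge0 // ltW.
have lc : lead_coef p != 0 by rewrite lead_coef_eq0.
have [q hq] : exists q, forall z, normc z <= r ->
    `|ln (normc (\prod_(a <- s) ('X - a%:P)).[z]) - Re q.[z]| <= e.
  apply: log_approx_factors => // a as_; rewrite leNgt; apply/negP => /ltW /hp /eqP; apply.
  have /rootP ra : root (\prod_(b <- s) ('X - b%:P)) a by rewrite root_prod_XsubC.
  by rewrite ps hornerZ ra mulr0.
exists (q + (ln (normc (lead_coef p)))%:C%:P) => z zr.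
have : p.[z] != 0 by apply: hp; apply: le_trans zr _; rewrite ler_peMl ?ler1n // ltW.
rewrite {1 2}ps hornerZ mulf_eq0 negb_or => /andP[_ pz].
rewrite normcM lnM ?posrE ?normc_gt0 // hornerD hornerC ReD /=.
by have := hq z zr; rewrite !ler_norml; lra.
Qed.

(** A bound on the inverse [k] over a disc forces a polynomial [p] close enough to [h] to satisfy
    [|p * k - 1| <= 1/2]. So [p] has no zero there, the approximation of [ln |p|] applies, and
    [ln |p| - ln |h|] is [ln |p * k|], which is small. *)
Lemma log_approx h k (r e : R) : entire h -> entire k -> (forall z, h z * k z = 1) ->
  0 < e -> exists q, forall z, normc z <= r -> `|ln (normc (h z)) - Re q.[z]| <= e.
Proof.
move=> hh hk hk1 e0; pose r' := `|r| + 1.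
have r0 : 0 < r' by rewrite ltr_wpDl.
have [M M0 hM] := entire_bounded (2 * r') hk.
(* For [tau <= 1/2] the logarithm of a number between [1 - tau] and [1 + tau] is at most [2 * tau]
   in absolute value, and this leaves half of [e] for the polynomial. *)
pose tau := Num.min (2^-1) (e / 4).
have tau0 : 0 < tau by rewrite lt_min invr_gt0 divr_gt0 //; lra.
have tau2 : tau <= 2^-1 by rewrite ge_min lexx.
have taue : tau <= e / 4 by rewrite ge_min lexx orbT.
have [p hp] := hh (2 * r') _ (divr_gt0 tau0 M0).
have close z : normc z <= 2 * r' -> normc (p.[z] * k z - 1) <= tau.
  move=> zr; rewrite -(hk1 z) -mulrBl normcM normc_distC.
  by rewrite -[leRHS](divfK (lt0r_neq0 M0)) ler_pM ?normc_ge0 ?hp ?hM.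
have bnd z : normc z <= 2 * r' -> 1 - tau <= normc (p.[z] * k z) <= 1 + tau.
  move=> /close; have := le_normcD (p.[z] * k z - 1) 1; rewrite subrK normc1.
  have := normcB (p.[z] * k z) (p.[z] * k z - 1); rewrite subKr normc1; lra.
have [||q hq] := @log_approx_poly p r' (e / 2) _ r0.
- by rewrite divr_gt0.
- move=> z /bnd; apply: contraTneq => ->; rewrite mul0r normc0; move: tau2; lra.
exists q => z zr; have zr' : normc z <= r'.
  by rewrite /r' (le_trans zr) // (le_trans (ler_norm _)) // lerDl.
have zr2 : normc z <= 2 * r' by apply: le_trans zr' _; rewrite ler_peMl ?ler1n // ltW.
have kz : 0 < normc (k z).
  by rewrite normc_gt0; apply/eqP => kz; have /eqP := hk1 z; rewrite kz mulr0 eq_sym oner_eq0.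
have hz : normc (h z) = (normc (k z))^-1.
  by apply: (mulIf (lt0r_neq0 kz)); rewrite -normcM hk1 normc1 mulVf // lt0r_neq0.
have := bnd z zr2; rewrite normcM => /andP[b1 b2].
have pz : 0 < normc p.[z].
  rewrite lt_def normc_ge0 andbT; apply/eqP => pz0; move: b1; rewrite pz0 mul0r.
  by move: tau2; lra.
have l1 : ln (normc p.[z]) + ln (normc (k z)) <= tau.
  rewrite -lnM ?posrE //; apply: (@le_trans _ _ (ln (1 + tau))); last first.
    by apply: le_ln1Dx; move: tau0; lra.
  by rewrite ler_ln ?posrE ?mulr_gt0 //; move: tau0; lra.
have l2 : - (2 * tau) <= ln (normc p.[z]) + ln (normc (k z)).
  rewrite -lnM ?posrE // -[leRHS]opprK lerN2 -lnV ?posrE ?mulr_gt0 //.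
  apply: (@le_trans _ _ (ln (1 + 2 * tau))); last by apply: le_ln1Dx; move: tau0; lra.
  rewrite ler_ln ?posrE ?invr_gt0 ?mulr_gt0 //; last by move: tau0; lra.
  rewrite -[leLHS]mul1r ler_pdivrMr ?mulr_gt0 //.
  apply: (@le_trans _ _ ((1 + 2 * tau) * (1 - tau))); last first.
    by rewrite ler_wpM2l //; move: tau0; lra.
  have : 0 <= tau * (1 - 2 * tau) by rewrite mulr_ge0 ?(ltW tau0) //; move: tau2; lra.
  lra.
rewrite hz lnV ?posrE //; have := hq z zr'; rewrite !ler_norml; move: l1 l2 taue; lra.
Qed.

End HarmonicApproximation.

(** * Harmonic functions of quadratic growth *)

Section OrderTwo.
Variable R : realType.
Implicit Types (z w : R[i]) (r e : R) (h k : R[i] -> R[i]) (p q : {poly R[i]}).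

(** By [coef_bound_Re] the coefficient of index [i + 3] is at most [2 * B / r^(i + 3)]; the tail is
    a geometric series of ratio at most one half, which doubles the constant. *)
Lemma quadratic_tail q (r s B : R) : 0 < s -> 2 * s <= r ->
  (forall z, normc z <= r -> `|Re q.[z]| <= B) ->
  forall z, normc z <= s ->
  `|Re q.[z] - Re (take_poly 3 q).[z]| <= 4 * B * (s / r) ^+ 3.
Proof.
move=> s0 sr hB z zs; have r0 : 0 < r by move: s0 sr; lra.
have B0 : 0 <= B by apply: le_trans (hB 0 _); rewrite ?normr_ge0 // normc0 ltW.
have -> : Re q.[z] - Re (take_poly 3 q).[z] = Re ((drop_poly 3 q).[z] * z ^+ 3).
  rewrite -ReB; congr Re; rewrite -{1}(poly_take_drop 3 q) hornerD hornerM hornerXn.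
  by rewrite addrAC subrr add0r.
apply: le_trans (normc_geRe _) _; rewrite normcM normcX expr_div_n.
have -> : 4 * B * (s ^+ 3 / r ^+ 3) = 4 * B / r ^+ 3 * s ^+ 3 by ring.
apply: ler_pM; rewrite ?normc_ge0 ?exprn_ge0 ?normc_ge0 //; last first.
  by apply: lerXn2r; rewrite ?nnegrE ?normc_ge0 ?(ltW s0).
rewrite horner_coef; apply: le_trans (normc_sum _ _ _) _.
set d := size _.
apply: (@le_trans _ _ (\sum_(i < d) 2 * B / r ^+ 3 * 2^-1 ^+ i)).
  apply: ler_sum => i _; rewrite normcM normcX coef_drop_poly.
  have c : normc q`_(i + 3) * r ^+ (i + 3) <= 2 * B.
    by apply: (coef_bound_Re _ (ltW r0)) => [|w wr]; [rewrite addn3|rewrite hB ?wr].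
  have rp : 0 < r ^+ (i + 3) by rewrite exprn_gt0.
  move: c; rewrite -ler_pdivlMr // => c.
  apply: le_trans (ler_pM (normc_ge0 _) _ c (lexx _)) _; first by rewrite exprn_ge0 ?normc_ge0.
  rewrite exprD invfM [_ * (_ / _)]mulrA -!mulrA ler_wpM2l // ler_wpM2l //.
  rewrite mulrCA ler_wpM2l ?invr_ge0 ?exprn_ge0 ?(ltW r0) //.
  rewrite mulrC -expr_div_n; apply: lerXn2r; rewrite ?nnegrE ?invr_ge0 ?divr_ge0 ?normc_ge0 ?(ltW r0) //.
  by rewrite ler_pdivrMr //; move: zs sr; lra.
rewrite -mulr_sumr.
have -> : 4 * B / r ^+ 3 = 2 * B / r ^+ 3 * 2 by ring.
apply: ler_wpM2l; first by rewrite divr_ge0 ?mulr_ge0 ?exprn_ge0 ?(ltW r0).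
have := subrX1 (2^-1 : R) d.
have : 0 <= 2^-1 ^+ d :> R by rewrite exprn_ge0 ?invr_ge0.
by lra.
Qed.

(** On a disc of radius [r] the bound is of order [r^2] while the cubic tail carries a factor
    [r^-3], so the terms of degree at least 3 disappear as [r] grows. *)
Lemma harmonic_liouville (U : R[i] -> R) (A B : R) : 0 <= A -> 0 <= B ->
  (forall r e, 0 < e -> exists q, forall z, normc z <= r -> `|U z - Re q.[z]| <= e) ->
  (forall z, `|U z| <= A * normc z ^+ 2 + B) ->
  exists c0 c1 c2 : R[i], forall z, U z = Re (c0 + c1 * z + c2 * z ^+ 2).
Proof.
move=> A0 B0 hU gU.
(* The real part of a quadratic polynomial is determined by its values at 0, 1, -1, i, -i and
   [1 + i]. Interpolating [U] itself there avoids taking limits of the coefficients of the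
   approximants. *)
pose a := U 0; pose b1 := (U 1 - U (-1)) / 2; pose cr := (U 1 + U (-1)) / 2 - U 0.
pose b2 := (U (0 -i* 1) - U (0 +i* 1)) / 2; pose ci := (a + b1 - b2 - U (1 +i* 1)) / 2.
exists a%:C, (b1 +i* b2), (cr +i* ci) => z.
pose s := normc z + 2; have s0 : 0 < s by rewrite ltr_wpDl ?normc_ge0.
pose x := Re z; pose y := Im z.
(* The total weight with which errors at the six nodes and at [z] enter the interpolation identity;
   the outer 1 accounts for [z]. *)
pose K := 1 + (1 + `|x| + `|y| + 2 * `|x ^+ 2 - y ^+ 2| + 4 * `|x * y|).
have K0 : 0 < K by rewrite ltr_pwDl // !addr_ge0 ?mulr_ge0.
have rhs : Re (a%:C + (b1 +i* b2) * z + (cr +i* ci) * z ^+ 2) =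
    a + b1 * x - b2 * y + cr * (x ^+ 2 - y ^+ 2) - 2 * ci * (x * y).
  by rewrite !ReD !ReM !ImM /x /y /=; ring.
rewrite rhs; apply/eqP; rewrite -subr_eq0 -normr_eq0 eq_le normr_ge0 andbT.
apply/ler_addgt0Pr => e e0; rewrite add0r.
pose e' := Num.min 1 (e / K / 2).
have e0' : 0 < e' by rewrite lt_min ltr01 !divr_gt0.
have e1 : e' <= 1 by rewrite ge_min lexx.
have eK : e' <= e / K / 2 by rewrite ge_min lexx orbT.
(* Chosen so that the tail [4 * s^3 * (A + B + 1) / r] is at most half of [e / K]. *)
pose r := 2 * s + 1 + 4 * s ^+ 3 * (A + B + 1) / (e / K / 2).
have AB : 0 < A + B + 1 by rewrite ltr_wpDl // addr_ge0.
have r1 : 2 * s + 1 <= r.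
  rewrite lerDl; apply: divr_ge0; last by rewrite ltW // !divr_gt0.
  by rewrite !mulr_ge0 ?exprn_ge0 ?(ltW s0) ?(ltW AB).
have r0 : 0 < r by move: s0 r1; lra.
have [q hq] := hU r e' e0'.
have hB w : normc w <= r -> `|Re q.[w]| <= (A + B + 1) * r ^+ 2.
  move=> wr; have := hq w wr; have := gU w.
  have : A * normc w ^+ 2 <= A * r ^+ 2.
    by rewrite ler_wpM2l //; apply: lerXn2r; rewrite ?nnegrE ?normc_ge0 ?(ltW r0).
  have : 1 * (B + 1) <= r ^+ 2 * (B + 1).
    by rewrite ler_wpM2r ?addr_ge0 // exprn_ege1 //; move: s0 r1; lra.
  by rewrite !ler_norml; lra.
have sr : 2 * s <= r by move: r1; lra.
have tail := quadratic_tail s0 sr hB.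
have small : 4 * ((A + B + 1) * r ^+ 2) * (s / r) ^+ 3 <= e / K / 2.
  have -> : 4 * ((A + B + 1) * r ^+ 2) * (s / r) ^+ 3 = 4 * s ^+ 3 * (A + B + 1) / r.
    by field; rewrite gt_eqF.
  rewrite ler_pdivrMr // [leRHS]mulrC -ler_pdivrMr ?divr_gt0 // /r lerDr.
  by move: s0; lra.
pose q2 := take_poly 3 q.
have close w : normc w <= s -> `|U w - Re q2.[w]| <= e / K.
  move=> ws; have := tail w ws; have := hq w (le_trans ws _).
  move=> /(_ ltac:(move: s0 sr; lra)); rewrite !ler_norml -/q2; move: small eK; lra.
have hq2 w : q2.[w] = q`_0 + q`_1 * w + q`_2 * w ^+ 2.
  rewrite (@horner_coef_wide _ 3) ?size_take_poly // !big_ord_recl big_ord0 addr0.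
  by rewrite !coef_take_poly /= expr0 expr1 mulr1 addrA.
have zz : normc z <= s by rewrite lerDl.
have zp := normc_ge0 z.
have n1 : normc (1 : R[i]) <= s by rewrite normc1 /s; move: zp; lra.
have nN1 : normc (-1 : R[i]) <= s by rewrite normcN normc1 /s; move: zp; lra.
have ni : normc (0 +i* 1 : R[i]) <= s by rewrite /= expr0n add0r expr1n sqrtr1 /s; move: zp; lra.
have nNi : normc (0 -i* 1 : R[i]) <= s.
  by rewrite /= expr0n add0r sqrrN expr1n sqrtr1 /s; move: zp; lra.
have n0 : normc (0 : R[i]) <= s by rewrite normc0 ltW.
have n11 : normc (1 +i* 1 : R[i]) <= s.
  by apply: le_trans (normc_leReIm _) _; rewrite /= normr1 /s; move: zp; lra.
pose D w := U w - Re q2.[w].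
have UD w : U w = Re q2.[w] + D w by rewrite /D addrC subrK.
have -> : U z - (a + b1 * x - b2 * y + cr * (x ^+ 2 - y ^+ 2) - 2 * ci * (x * y)) =
  D z - (D 0 + (D 1 - D (-1)) / 2 * x - (D (0 -i* 1) - D (0 +i* 1)) / 2 * y
   + ((D 1 + D (-1)) / 2 - D 0) * (x ^+ 2 - y ^+ 2)
   - (D 0 + (D 1 - D (-1)) / 2 - (D (0 -i* 1) - D (0 +i* 1)) / 2 - D (1 +i* 1)) * (x * y)).
  rewrite /ci /cr /b1 /b2 /a !UD !hq2 /x /y.
  move: (D z) (D 0) (D 1) (D (-1)) (D (0 -i* 1)) (D (0 +i* 1)) (D (1 +i* 1)).
  move=> d0 d1 d2 d3 d4 d5 d6; rewrite !expr2 !(ReD, ReM, ImM) /=.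
  by field.
have hD w : normc w <= s -> `|D w| <= e / K by apply: close.
have eKK : e / K * K = e by rewrite divfK // lt0r_neq0.
rewrite -eKK; set E := e / K in hD *; rewrite /K.
have t1 (u v m : R) : `|u| <= m * E -> `|u * v| <= E * (m * `|v|).
  by move=> h; rewrite normrM mulrA [E * m]mulrC ler_wpM2r.
apply: le_trans (ler_normB _ _) _; rewrite [E * (_ + _)]mulrDr [E * 1]mulr1 lerD ?hD //.
apply: le_trans (ler_normB _ _) _; rewrite [E * (_ + _)]mulrDr lerD //; last first.
  apply: t1; have := hD _ n0; have := hD _ n1; have := hD _ nN1; have := hD _ ni.
  by have := hD _ nNi; have := hD _ n11; rewrite !ler_norml -/E; lra.
apply: le_trans (ler_normD _ _) _; rewrite [E * (_ + _)]mulrDr lerD //; last first.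
  by apply: t1; have := hD _ n0; have := hD _ n1; have := hD _ nN1; rewrite !ler_norml -/E; lra.
apply: le_trans (ler_normB _ _) _; rewrite [E * (_ + _)]mulrDr lerD //; last first.
  rewrite -[`|y|]mul1r; apply: t1; have := hD _ ni; have := hD _ nNi.
  by rewrite !ler_norml -/E; lra.
apply: le_trans (ler_normD _ _) _; rewrite [E * (_ + _)]mulrDr [E * 1]mulr1 lerD ?hD //.
rewrite -[`|x|]mul1r; apply: t1; have := hD _ n1; have := hD _ nN1.
by rewrite !ler_norml -/E; lra.
Qed.

End OrderTwo.

(** * Entire functions [h] of order two for which [h z * h (i z)] is a polynomial *)

Section GaussianStructure.
Variable R : realType.
Implicit Types (z w : R[i]) (r e K : R) (h k : R[i] -> R[i]) (p q : {poly R[i]}).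

Lemma mulii : 'i * 'i = -1 :> R[i].
Proof. by rewrite -expr2 sqr_i. Qed.

Lemma normci : normc ('i : R[i]) = 1.
Proof. by rewrite /= expr0n add0r expr1n sqrtr1. Qed.

(** The identity makes [h ('i * z) / c] an entire inverse of [h] and turns the upper bound on
    [ln |h|] into a lower one. So [ln |h|] is the real part of a quadratic; the quotient of [h] by
    the exponential of that quadratic has modulus 1, and is constant by Liouville. *)
Lemma zero_free_order_two h K (c : R[i]) : entire h ->
  (forall z, normc (h z) <= K * expR (normc z ^+ 2 / 2)) ->
  c != 0 -> (forall z, h z * h ('i * z) = c) ->
  exists C b, forall z, h z = C * cexp (b * z ^+ 2).
Proof.
move=> hh hK c0 hc; pose k z := c^-1 * h ('i * z).
have hk : entire k by apply: entireZ; apply: entire_scale.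
have hk1 z : h z * k z = 1 by rewrite /k mulrCA hc mulVf.
have h0 z : h z != 0 by apply: contraNneq c0 => hz; rewrite -(hc z) hz mul0r.
have hp z : 0 < normc (h z) by rewrite normc_gt0.
have K0 : 0 < K.
  by have := lt_le_trans (hp 0) (hK 0); rewrite pmulr_lgt0 ?expR_gt0.
have cp : 0 < normc c by rewrite normc_gt0.
have up z : ln (normc (h z)) <= ln K + normc z ^+ 2 / 2.
  by rewrite -[X in _ <= _ + X]expRK -lnM ?posrE ?expR_gt0 // ler_ln ?posrE // ?mulr_gt0 ?expR_gt0.
have lo z : ln (normc c) - ln K - normc z ^+ 2 / 2 <= ln (normc (h z)).
  have := up ('i * z); rewrite normcM normci mul1r -(hc z) normcM lnM ?posrE //; lra.
have [||c0' [c1 [c2 hU]]] := @harmonic_liouville _ (fun z => ln (normc (h z))) 1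
    (`|ln K| + `|ln (normc c)|) ler01 (addr_ge0 (normr_ge0 _) (normr_ge0 _)).
- by move=> r e e0; apply: log_approx hk hk1 e0.
- move=> z; have := up z; have := lo z; have := sqr_ge0 (normc z).
  have := ler_norm (ln K); have := ler_norm (- ln K).
  have := ler_norm (ln (normc c)); have := ler_norm (- ln (normc c)).
  by rewrite !normrN ler_norml; lra.
(* The sum of [ln |h|] at [z] and at [i z] is constant; in it the quadratic terms cancel, and the
   linear coefficient is [c1 * (1 + 'i)]. *)
have c10 : c1 = 0.
  have S z : ln (normc (h z)) + ln (normc (h ('i * z))) = ln (normc c).
    by rewrite -(hc z) normcM lnM ?posrE.
  have lin z : Re (c1 * (1 + 'i) * z) = 0.
    have := S z; rewrite -(S 0) !hU -!ReD !mulr0 expr0n !mulr0 !addr0 => e.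
    have -> : c1 * (1 + 'i) * z = c0' + c1 * z + c2 * z ^+ 2 +
        (c0' + c1 * ('i * z) + c2 * ('i * z) ^+ 2) - (c0' + c0').
      have -> : c0' + c1 * z + c2 * z ^+ 2 + (c0' + c1 * ('i * z) + c2 * ('i * z) ^+ 2)
          - (c0' + c0') = c1 * (1 + 'i) * z + c2 * z ^+ 2 * (1 + 'i * 'i) by ring.
      by rewrite mulii subrr mulr0 addr0.
    by rewrite ReB e subrr.
  have : c1 * (1 + 'i) = 0.
    apply: complex_eq => /=; first by have := lin 1; rewrite mulr1.
    by have := lin 'i; rewrite ReM /= mulr0 mulr1 sub0r => /eqP; rewrite oppr_eq0 => /eqP.
  move/eqP; rewrite mulf_eq0 => /orP[/eqP //|]; rewrite eq_complex /= addr0.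
  by rewrite oner_eq0.
pose f z := h z * cexp (- (c0' + c2 * z ^+ 2)).
have hf : entire f.
  apply: entireM => //; apply: (entire_comp (@entire_cexp R)); apply: entireN.
  apply: entireD; first exact: entire_cst.
  by apply: entireZ; apply: (entireM (@entire_id R) (@entire_id R)).
have nf z : normc (f z) <= 1.
  rewrite normcM normc_cexp -[normc (h z)]lnK ?posrE // hU c10 mul0r addr0 -expRD ReN.
  by rewrite subrr expR0.
exists (h 0), c2 => z.
have := entire_liouville hf nf z; rewrite /f expr0n mulr0 addr0 opprD cexpD cexpN.
have e0 : (cexp c0')^-1 != 0 by rewrite invr_neq0 // cexp_neq0.
rewrite mulrCA [RHS]mulrC => /(mulfI e0) <-.
by rewrite -mulrA -cexpD addNr cexp0 mulr1.
Qed.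

Lemma poly_ext p q : (forall z, p.[z] = q.[z]) -> p = q.
Proof.
move=> pq; apply/eqP; rewrite -subr_eq0; apply/eqP.
apply: (@roots_geq_poly_eq0 _ _ [seq i%:R | i <- iota 0 (size (p - q))]).
- by apply/allP => x _; rewrite rootE !hornerE pq subrr.
- rewrite map_inj_uniq ?iota_uniq // => i j /eqP; rewrite eqr_nat => /eqP //.
- by rewrite size_map size_iota.
Qed.

Lemma poly_growth p : exists2 B, 0 <= B &
  forall z, 1 <= normc z -> normc p.[z] <= B * normc z ^+ size p.
Proof.
exists (\sum_(i < size p) normc p`_i) => [|z z1]; first by rewrite sumr_ge0 // => i _; rewrite normc_ge0.
rewrite horner_coef; apply: le_trans (normc_sum _ _ _) _; rewrite mulr_suml.
apply: ler_sum => i _; rewrite normcM normcX ler_wpM2l ?normc_ge0 //.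
by rewrite ler_weXn2l // ltnW.
Qed.

(** Induction on the degree of [p]: a zero of [h] splits off from [h] and takes two linear factors
    of [p] with it. If [h] has no zero, [p] has none either, since a root [x] of [p] makes [h]
    vanish at [x] or at ['i * x]. *)
Lemma entire_order_two h K p : entire h ->
  (forall z, normc (h z) <= K * expR (normc z ^+ 2 / 2)) ->
  p != 0 -> (forall z, h z * h ('i * z) = p.[z]) ->
  exists q b, forall z, h z = q.[z] * cexp (b * z ^+ 2).
Proof.
move: {2}(size p) (leqnn (size p)) => n; elim: n p h K => [|n IH] p h K.
  by rewrite leqn0 size_poly_eq0 => /eqP -> _ _; rewrite eqxx.
move=> sp hh hK p0 hp.
have [[z0 hz0]|nz] := pselect (exists z0, h z0 = 0); last first.
  have /size_poly1P[c c0 pc] : size p == 1%N.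
    apply/negPn/negP => /closed_rootP[x /rootP rx]; have := hp x; rewrite rx.
    by move/eqP; rewrite mulf_eq0 => /orP[] /eqP hx; apply: nz; [exists x|exists ('i * x)].
  have [|C [b hb]] := zero_free_order_two hh hK c0; first by move=> z; rewrite hp pc hornerC.
  by exists C%:P, b => z; rewrite hornerC.
have [k hk kE] := entire_div hh hz0.
have kk : entire (fun z => k z * k ('i * z)) by apply: entireM => //; apply: entire_scale.
have kp z : k z * k ('i * z) * ((z - z0) * ('i * z - z0)) = p.[z].
  by rewrite -hp !kE; ring.
have K0 : 0 <= K.
  by have := le_trans (normc_ge0 _) (hK 0); rewrite pmulr_lge0 ?expR_gt0.
(* Near [z0] the quotient is bounded through the annulus [1 <= |w - z0| <= 2], where [|w|] is at
   most [normc z0 + 2]. *)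
pose K' := K * expR ((normc z0 + 2) ^+ 2 / 2).
have e1 (x : R) : 1 <= expR (x ^+ 2 / 2) by rewrite -expR0 ler_expR divr_ge0 ?sqr_ge0.
have far z : 1 <= normc (z - z0) -> normc (k z) <= normc (h z).
  by move=> z1; rewrite kE normcM ler_peMl ?normc_ge0.
have gk z : normc (k z) <= K' * expR (normc z ^+ 2 / 2).
  have [z1|/ltW z1] := leP 1 (normc (z - z0)).
    apply: le_trans (far z z1) _; apply: le_trans (hK z) _.
    by rewrite ler_wpM2r ?expR_ge0 // /K' ler_peMr.
  apply: (@le_trans _ _ K'); last by rewrite ler_peMr // mulr_ge0 ?expR_ge0.
  apply: (entire_max_square hk ltr01 _ z1) => w /andP[w1 w2].
  apply: le_trans (far w w1) _; apply: le_trans (hK w) _; rewrite /K' ler_wpM2l //.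
  rewrite ler_expR ler_pM2r ?invr_gt0 //; apply: lerXn2r.
  - by rewrite nnegrE normc_ge0.
  - by rewrite nnegrE addr_ge0 ?normc_ge0.
  - by have := le_normcD (w - z0) z0; rewrite subrK; move: w2; lra.
have [B B0 hB] := poly_growth p.
have [M M0 hM] := entire_bounded (normc z0 + 1) kk.
(* The new product is again a polynomial: beyond the radius [normc z0 + 1] both divided factors have
   modulus at least 1, so [p] bounds it there. *)
have [z|p1 hp1] := @entire_poly_growth _ _ (size p) (B + M) kk.
  move=> z1; have zz : 1 <= normc z ^+ size p by rewrite exprn_ege1.
  have [zr|/ltW zr] := leP (normc z) (normc z0 + 1).
    apply: le_trans (hM z zr) _; rewrite mulrDl ler_wpDl ?mulr_ge0 ?exprn_ge0 ?normc_ge0 //.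
    by rewrite ler_peMr // ltW.
  apply: (@le_trans _ _ (normc p.[z])); last first.
    by apply: le_trans (hB z z1) _; rewrite ler_wpM2r ?exprn_ge0 ?normc_ge0 // lerDl ltW.
  rewrite -kp [leRHS]normcM ler_peMr ?normc_ge0 // normcM.
  have a1 : 1 <= normc (z - z0).
    by have := le_normcD (z - z0) z0; rewrite subrK; move: zr; lra.
  have a2 : 1 <= normc ('i * z - z0).
    have := le_normcD ('i * z - z0) z0; rewrite subrK normcM normci mul1r; move: zr; lra.
  by rewrite -[1]mulr1 ler_pM.
have pE : p = p1 * (('X - z0%:P) * ('i%:P * 'X - z0%:P)).
  by apply: poly_ext => z; rewrite -kp hp1 !hornerM !hornerD !hornerN hornerM !hornerC hornerX.
have p10 : p1 != 0 by apply: contraNneq p0 => p10; rewrite pE p10 mul0r.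
have ss : (1 < size ('i%:P * 'X - z0%:P : {poly R[i]})%R)%N.
  rewrite ltnNge; apply/negP => /leq_sizeP /(_ 1%N isT).
  rewrite coefB coefCM coefX coefC /= mulr1 subr0 => /eqP.
  by rewrite eq_complex /= oner_eq0 andbF.
have i0 : 'i%:P * 'X - z0%:P != 0 :> {poly R[i]} by rewrite -size_poly_gt0 ltnW.
have sp1 : (size p1 <= n)%N.
  move: sp; rewrite pE !size_mul ?mulf_neq0 ?polyXsubC_eq0 // size_XsubC.
  by move: ss p10; rewrite -size_poly_gt0; move: (size p1) (size _); lia.
have [q [b hq]] := IH p1 k K' sp1 hk gk p10 hp1.
by exists (('X - z0%:P) * q), b => z; rewrite kE hq hornerM hornerXsubC mulrA.
Qed.

End GaussianStructure.

(** * From the product bound to a polynomial times [cexp (b * z ^+ 2)] with real [b] *)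

Section BeurlingStructure.
Variable R : realType.
Implicit Types (z w : R[i]) (r e K : R) (h k : R[i] -> R[i]) (p q : {poly R[i]}).

(* [h z * h ('i * z)] has polynomial growth in each quadrant. *)
Lemma gaussian_structure h K (B : R) M : entire h -> 0 <= B ->
  (forall z, normc (h z) <= K * expR (normc z ^+ 2 / 2)) ->
  (forall (y : R) w, `|Im w| <= `|y| -> normc (h y%:C * h w) <= B * (1 + y ^+ 2) ^+ M) ->
  exists q b, forall z, h z = q.[z] * cexp (b * z ^+ 2).
Proof.
move=> hh B0 hK hB.
have K0 : 0 <= K by have := le_trans (normc_ge0 _) (hK 0); rewrite pmulr_lge0 ?expR_gt0.
pose C := K ^+ 2 * expR 1 + B * 2 ^+ M.
(* The four choices of signs serve the four quadrants: a rotation by a multiple of the quarter turn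
   brings [z] into the first one and changes [h z * h ('i * z)] into such a product, up to the order
   of the factors. *)
have quad (s1 s2 : R) : s1 ^+ 2 = 1 -> s2 ^+ 2 = 1 -> forall z, 1 <= normc z ->
    0 <= Re z -> 0 <= Im z ->
    normc (h (s1%:C * z) * h (s2%:C * 'i * z)) <= C * normc z ^+ (2 * M).
  move=> s11 s21; have n1 : `|s1| = 1 by apply/eqP; rewrite -sqr_norm_eq1 s11.
  have n2 : `|s2| = 1 by apply/eqP; rewrite -sqr_norm_eq1 s21.
  apply: quadrant_bound => //; try exact: entire_scale.
  - by move=> z; apply: le_trans (hK _) _; rewrite normcM normc_real n1 mul1r.
  - by move=> z; apply: le_trans (hK _) _; rewrite !normcM normc_real n2 normci !mul1r.
  - move=> r w r0 wr; rewrite -rmorphM; have := hB (s1 * r) (s2%:C * 'i * w).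
    rewrite exprMn s11 mul1r; apply; apply: le_trans (normc_geIm _) _.
    by rewrite !normcM normc_real n2 normci !mul1r wr normrM n1 mul1r gtr0_norm.
  - move=> r w r0 wr; rewrite mulrC.
    have -> : s2%:C * 'i * (0 +i* r) = (- s2 * r)%:C by apply: complex_eq; rewrite /=; ring.
    have := hB (- s2 * r) (s1%:C * w).
    rewrite exprMn sqrrN s21 mul1r; apply; apply: le_trans (normc_geIm _) _.
    by rewrite !normcM normc_real n1 mul1r wr normrM normrN n2 mul1r gtr0_norm.
have one : (1 : R) ^+ 2 = 1 by rewrite expr1n.
have mone : (-1 : R) ^+ 2 = 1 by rewrite sqrrN expr1n.
have [|z|p hp] := @entire_poly_growth _ (fun z => h z * h ('i * z)) (2 * M) C.
- by apply: entireM => //; apply: entire_scale.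
- move=> z1; have i1 (s : R) : s ^+ 2 = 1 -> normc (s%:C * 'i * z) = normc z.
    move=> s1; rewrite !normcM normc_real normci mulr1.
    by have /eqP -> : `|s| == 1; rewrite ?mul1r // -sqr_norm_eq1 s1.
  have [re|/ltW re] := leP 0 (Re z); have [im|/ltW im] := leP 0 (Im z).
  + by have := quad 1 1 one one z z1 re im; rewrite !mul1r.
  + have := quad 1 (-1) one mone (1%:C * 'i * z); rewrite i1 //.
    have -> : (-1)%:C * 'i * (1%:C * 'i * z) = z.
      by case: z {z1 re im i1} => x y; apply: complex_eq; rewrite /=; ring.
    rewrite !mul1r => H; rewrite mulrC; apply: H => //.
      by rewrite ReM /= mul0r sub0r mul1r oppr_ge0.
    by rewrite ImM /= mul0r add0r mul1r.
  + have := quad (-1) 1 mone one ((-1)%:C * 'i * z); rewrite i1 //.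
    have -> : (-1)%:C * ((-1)%:C * 'i * z) = 'i * z.
      by case: z {z1 re im i1} => x y; apply: complex_eq; rewrite /=; ring.
    have -> : 1%:C * 'i * ((-1)%:C * 'i * z) = z.
      by case: z {z1 re im i1} => x y; apply: complex_eq; rewrite /=; ring.
    move=> H; rewrite mulrC; apply: H => //; case: z {z1 i1} re im => x y /=; lra.
  + have := quad (-1) (-1) mone mone ((-1)%:C * z).
    rewrite normcM normc_real normrN1 mul1r.
    have -> : (-1)%:C * ((-1)%:C * z) = z.
      by case: z {z1 re im i1} => x y; apply: complex_eq; rewrite /=; ring.
    have -> : (-1)%:C * 'i * ((-1)%:C * z) = 'i * z.
      by case: z {z1 re im i1} => x y; apply: complex_eq; rewrite /=; ring.
    by apply=> //; case: z {z1 i1} re im => x y /=; lra.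
have [p0|p0] := eqVneq p 0; last exact: entire_order_two hh hK p0 hp.
exists 0, 0 => z; rewrite horner0 mul0r.
(* When the product vanishes identically, [h] vanishes at [1 / (n + 1)] or at [i / (n + 1)] for
   every [n]. The moduli are distinct, so these are infinitely many zeros in the unit disc. *)
pose a n : R[i] := if h (n.+1%:R^-1)%:C == 0 then (n.+1%:R^-1)%:C else 'i * (n.+1%:R^-1)%:C.
have na n : normc (a n) = n.+1%:R^-1.
  by rewrite /a; case: ifP => _; rewrite ?normcM ?normci ?mul1r normc_real ger0_norm.
apply: (entire_identity (a := a) hh) => [m n /(congr1 (@normc R))|n|n].
- by rewrite !na => /invr_inj /eqP; rewrite eqr_nat => /eqP[].
- by rewrite na invf_le1 // ler1n.
- rewrite /a; case: eqP => // /eqP hn; have := hp (n.+1%:R^-1)%:C.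
  by rewrite p0 horner0 => /eqP; rewrite mulf_eq0 (negbTE hn) => /eqP.
Qed.

Lemma poly_lower_bound p : p != 0 ->
  exists d Y : R, 0 < d /\ forall y : R, Y <= y -> d <= normc p.[y%:C].
Proof.
elim/poly_ind: p => [|p c IH]; first by rewrite eqxx.
have [->|p0] := eqVneq p 0.
  rewrite mul0r add0r polyC_eq0 => c0; exists (normc c), 0.
  by rewrite normc_gt0 c0; split=> // y _; rewrite hornerC.
have [d [Y [d0 hd]]] := IH p0 => _; exists 1, (Num.max (Num.max Y 0) ((normc c + 1) / d)).
split=> // y; rewrite !ge_max => /andP[/andP[Yy y0] dy].
rewrite hornerMXaddC; have := normcB (p.[y%:C] * y%:C + c) c; rewrite addrK.
rewrite normcM normc_real ger0_norm //.
have : normc c + 1 <= normc p.[y%:C] * y.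
  move: dy; rewrite ler_pdivrMr // => dy; apply: le_trans dy _.
  by rewrite mulrC ler_wpM2r ?hd.
lra.
Qed.

Lemma expR_ge_pow (x : R) n : 0 <= x -> x ^+ n / n`!%:R <= expR x.
Proof.
move=> x0; have := exp_tail_ge0 n.+1 x0; rewrite /exp_tail big_ord_recr /= subr_ge0.
apply: le_trans; rewrite lerDr sumr_ge0 // => i _.
by rewrite divr_ge0 ?exprn_ge0.
Qed.

Lemma poly_exp_unbounded p (a B : R) M : p != 0 -> 0 < a ->
  ~ forall y : R, normc p.[y%:C] * expR (a * y ^+ 2) <= B * (1 + y ^+ 2) ^+ M.
Proof.
move=> p0 a0 hB; have [d [Y [d0 hd]]] := poly_lower_bound p0.
have B0 : 0 <= B.
  have := hB 0; rewrite expr0n addr0 expr1n !mulr1; apply: le_trans.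
  by rewrite mulr_ge0 ?normc_ge0 ?expR_ge0.
(* Comparing with the term of order [M + 1] of the series of [expR (a * y ^+ 2)] yields
   [y ^+ 2 <= C], whereas [y] is chosen to be at least [1 + C]. *)
pose C := B * 2 ^+ M * (M.+1)`!%:R / (d * a ^+ M.+1).
pose y := Num.max Y (1 + C).
have C0 : 0 <= C.
  by apply: divr_ge0; rewrite ?mulr_ge0 ?exprn_ge0 ?(ltW d0) ?(ltW a0).
have y1 : 1 <= y by rewrite le_max lerDl C0 orbT.
have yC : 1 + C <= y by rewrite le_max lexx orbT.
have yy : y <= y ^+ 2 by rewrite expr2 ler_peMr // (le_trans ler01).
have y0 : 0 < y by apply: lt_le_trans y1.
have y20 : 0 < y ^+ 2 by rewrite exprn_gt0.
have /hd dy : Y <= y by rewrite le_max lexx.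
have h1 : d * ((a * y ^+ 2) ^+ M.+1 / (M.+1)`!%:R) <= B * (2 * y ^+ 2) ^+ M.
  apply: (@le_trans _ _ (B * (1 + y ^+ 2) ^+ M)); last first.
    by rewrite ler_wpM2l //; apply: lerXn2r; rewrite ?nnegrE; move: y1 yy (ltW y20); lra.
  apply: (le_trans _ (hB y)); apply: ler_pM => //; first exact: ltW.
    by rewrite divr_ge0 // exprn_ge0 // mulr_ge0 // ltW.
  by apply: expR_ge_pow; rewrite mulr_ge0 // ltW.
have : y ^+ 2 <= C.
  rewrite /C ler_pdivlMr ?mulr_gt0 ?exprn_gt0 //.
  rewrite -(ler_pM2r (_ : 0 < (y ^+ 2) ^+ M)) ?exprn_gt0 //.
  move: h1; rewrite mulrA ler_pdivrMr ?ltr0n ?fact_gt0 //.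
  move: (y ^+ 2) => Z; rewrite (exprMn M.+1 a Z) (exprMn M 2 Z) (exprS Z).
  have -> : Z * (d * a ^+ M.+1) * Z ^+ M = d * (a ^+ M.+1 * (Z * Z ^+ M)) by ring.
  by have -> : B * 2 ^+ M * (M.+1)`!%:R * Z ^+ M = B * (2 ^+ M * Z ^+ M) * (M.+1)`!%:R by ring.
by move: yC yy; lra.
Qed.

(** The pair [y], [(s + i) * y] is admissible for every real [s], as the imaginary part of the
    second is [y]. The exponents add up to [a * y^2] with [a = s^2 * Re b - 2 * s * Im b], which a
    small [s] of the right sign makes positive unless [Im b] is 0. *)
Lemma gaussian_structure_real h q (b : R[i]) (B : R) M : q != 0 ->
  (forall z, h z = q.[z] * cexp (b * z ^+ 2)) ->
  (forall (y : R) w, `|Im w| <= `|y| -> normc (h y%:C * h w) <= B * (1 + y ^+ 2) ^+ M) ->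
  Im b = 0.
Proof.
move=> q0 hq hB; apply/eqP/negPn/negP => b0.
(* With this [t] the factor [t * Re b + 2] of [a] is at least 1. *)
pose t := (1 + `|Re b|)^-1; pose s := - (t * Im b).
have t0 : 0 < t by rewrite invr_gt0 ltr_pwDl.
pose a := s ^+ 2 * Re b - 2 * s * Im b.
have a0 : 0 < a.
  have -> : a = t * (Im b) ^+ 2 * (t * Re b + 2) by rewrite /a /s; ring.
  apply: mulr_gt0; first by rewrite mulr_gt0 // exprn_even_gt0.
  have : `|t * Re b| <= 1.
    by rewrite normrM gtr0_norm // mulrC ler_pdivrMr ?ltr_pwDl // mul1r lerDr.
  by rewrite ler_norml; lra.
pose w0 : R[i] := s +i* 1.
have w00 : w0 != 0 by rewrite eq_complex /= oner_eq0 andbF.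
apply: (@poly_exp_unbounded (q * (q \Po (w0 *: 'X))) a B M _ a0).
  rewrite mulf_neq0 //; apply/negP => /eqP qw; move/negP: q0; apply; apply/eqP.
  have := congr1 (fun x => x \Po (w0^-1 *: 'X)) qw.
  rewrite comp_poly0 -comp_polyA comp_polyZ comp_polyX scalerA divff // scale1r.
  by rewrite comp_polyXr.
move=> y; have := hB y (w0 * y%:C); rewrite !hq.
have -> : Im (w0 * y%:C) = y by rewrite /=; ring.
move=> /(_ (lexx _)); rewrite mulrACA -cexpD normcM normc_cexp hornerM horner_comp.
rewrite hornerZ hornerX; congr (_ * expR _ <= _); rewrite /a /w0 /=.
by rewrite -mulrDr !expr2 ReM /=; ring.
Qed.

End BeurlingStructure.

(** * Integrals of complex-valued functions *)

Section ComplexIntegral.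
Context d (T : measurableType d) (R : realType) (mu : {measure set T -> \bar R}).
Implicit Types (f g : T -> R) (F G : T -> R[i]).

Definition rintegrable f := mu.-integrable setT (EFin \o f).

Definition cmeasurable F :=
  measurable_fun setT (fun x => Re (F x)) /\ measurable_fun setT (fun x => Im (F x)).

Definition cintegrable F := rintegrable (fun x => Re (F x)) /\ rintegrable (fun x => Im (F x)).

Definition cint F : R[i] :=
  Rintegral mu setT (fun x => Re (F x)) +i* Rintegral mu setT (fun x => Im (F x)).

Lemma rintegrable_measurable f : rintegrable f -> measurable_fun setT f.
Proof. by move=> /measurable_int /measurable_EFinP. Qed.

Lemma rintegrable_le f g : measurable_fun setT f -> rintegrable g ->
  (forall x, `|f x| <= g x) -> rintegrable f.
Proof.
move=> mf ig fg; apply: le_integrable ig => //; first exact/measurable_EFinP.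
by move=> x _ /=; rewrite lee_fin (le_trans (fg x)) ?ler_norm.
Qed.

Lemma rintegrableD f g : rintegrable f -> rintegrable g -> rintegrable (fun x => f x + g x).
Proof. by move=> hf hg; have := integrableD measurableT hf hg. Qed.

Lemma rintegrableB f g : rintegrable f -> rintegrable g -> rintegrable (fun x => f x - g x).
Proof. by move=> hf hg; have := integrableB measurableT hf hg. Qed.

Lemma rintegrableZ (c : R) f : rintegrable f -> rintegrable (fun x => c * f x).
Proof. by move=> hf; have := integrableZl measurableT c hf. Qed.

Lemma rintegrable_norm f : rintegrable f -> rintegrable (fun x => `|f x|).
Proof. by move=> hf; have := integrable_norm hf. Qed.

Lemma cmeasurableM F G : cmeasurable F -> cmeasurable G -> cmeasurable (fun x => F x * G x).
Proof.
move=> [Fr Fi] [Gr Gi]; split.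
  under eq_fun do rewrite ReM.
  by apply: measurable_funB; apply: measurable_funM.
under eq_fun do rewrite ImM.
by apply: measurable_funD; apply: measurable_funM.
Qed.

Lemma cmeasurable_real f : measurable_fun setT f -> cmeasurable (fun x => (f x)%:C).
Proof. by move=> mf; split. Qed.

Lemma measurable_normc F : cmeasurable F -> measurable_fun setT (fun x => normc (F x)).
Proof.
move=> [Fr Fi].
have -> : (fun x => normc (F x)) = (fun x => Num.sqrt (Re (F x) ^+ 2 + Im (F x) ^+ 2)).
  by apply/funext => x; case: (F x).
apply: (measurableT_comp (continuous_measurable_fun (@sqrt_continuous R))).
by apply: measurable_funD; apply: measurable_funX.
Qed.

Lemma cintegrable_le F g : cmeasurable F -> rintegrable g ->
  (forall x, normc (F x) <= g x) -> cintegrable F.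
Proof.
move=> [Fr Fi] ig Fg; split; apply: rintegrable_le ig _ => // x.
  exact: le_trans (normc_geRe _) (Fg x).
exact: le_trans (normc_geIm _) (Fg x).
Qed.

Lemma cintegrable_measurable F : cintegrable F -> cmeasurable F.
Proof. by move=> [Fr Fi]; split; apply: rintegrable_measurable. Qed.

Lemma cintegrable_normc F : cintegrable F -> rintegrable (fun x => normc (F x)).
Proof.
move=> iF; have [Fr Fi] := iF.
apply: (@rintegrable_le _ (fun x => `|Re (F x)| + `|Im (F x)|)).
- exact/measurable_normc/cintegrable_measurable.
- by apply: rintegrableD; apply: rintegrable_norm.
- by move=> x; rewrite ger0_norm ?normc_ge0 ?normc_leReIm.
Qed.

Lemma cintegrableD F G : cintegrable F -> cintegrable G -> cintegrable (fun x => F x + G x).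
Proof.
move=> [Fr Fi] [Gr Gi]; split.
  by under eq_fun do rewrite ReD; apply: rintegrableD.
by under eq_fun do rewrite ImD; apply: rintegrableD.
Qed.

Lemma cintegrableZ (c : R[i]) F : cintegrable F -> cintegrable (fun x => c * F x).
Proof.
move=> [Fr Fi]; split.
  by under eq_fun do rewrite ReM; apply: rintegrableB; apply: rintegrableZ.
by under eq_fun do rewrite ImM; apply: rintegrableD; apply: rintegrableZ.
Qed.

Lemma eq_cint F G : F =1 G -> cint F = cint G.
Proof. by move=> /funext ->. Qed.

Lemma cintD F G : cintegrable F -> cintegrable G ->
  cint (fun x => F x + G x) = cint F + cint G.
Proof.
move=> [Fr Fi] [Gr Gi]; apply: complex_eq => /=.
  by under eq_Rintegral do rewrite ReD; rewrite RintegralD.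
by under eq_Rintegral do rewrite ImD; rewrite RintegralD.
Qed.

Lemma cintZ (c : R[i]) F : cintegrable F -> cint (fun x => c * F x) = c * cint F.
Proof.
move=> [Fr Fi]; apply: complex_eq; rewrite ?ReM ?ImM /=.
  under eq_Rintegral do rewrite ReM.
  by rewrite RintegralB ?RintegralZl //; apply: rintegrableZ.
under eq_Rintegral do rewrite ImM.
by rewrite RintegralD ?RintegralZl //; apply: rintegrableZ.
Qed.

Lemma cintegrableB F G : cintegrable F -> cintegrable G -> cintegrable (fun x => F x - G x).
Proof.
move=> iF iG; have := cintegrableD iF (cintegrableZ (-1) iG).
by under eq_fun do rewrite mulN1r.
Qed.

Lemma cintB F G : cintegrable F -> cintegrable G ->
  cint (fun x => F x - G x) = cint F - cint G.
Proof.
move=> iF iG; rewrite -[- cint G]mulN1r -cintZ // -cintD //; last exact: cintegrableZ.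
by apply: eq_cint => x; rewrite mulN1r.
Qed.

Lemma cintegrable0 : cintegrable (fun=> 0).
Proof. by split; apply: integrable0. Qed.

Lemma cint0 : cint (fun=> 0) = 0.
Proof. by rewrite /cint /= /Rintegral integral0. Qed.

Lemma cintegrable_sum n (F : nat -> T -> R[i]) : (forall k, cintegrable (F k)) ->
  cintegrable (fun x => \sum_(k < n) F k x).
Proof.
move=> iF; elim: n => [|n IH].
  by under eq_fun do rewrite big_ord0; apply: cintegrable0.
by under eq_fun do rewrite big_ord_recr /=; apply: cintegrableD.
Qed.

Lemma cint_sum n (F : nat -> T -> R[i]) : (forall k, cintegrable (F k)) ->
  cint (fun x => \sum_(k < n) F k x) = \sum_(k < n) cint (F k).
Proof.
move=> iF; elim: n => [|n IH].
  by rewrite big_ord0 -[RHS]cint0; apply: eq_cint => x; rewrite big_ord0.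
rewrite big_ord_recr /= -IH -cintD //; last exact: cintegrable_sum.
by apply: eq_cint => x; rewrite big_ord_recr.
Qed.

Lemma normc_cint F : cintegrable F -> normc (cint F) <= Rintegral mu setT (fun x => normc (F x)).
Proof.
move=> iF; have [u u1 <-] := normc_rotate (cint F).
rewrite -cintZ //; have [iu _] := cintegrableZ u iF.
apply: le_Rintegral => //; first exact: cintegrable_normc.
move=> x _; apply: le_trans (ler_norm _) _; apply: le_trans (normc_geRe _) _.
by rewrite normcM u1 mul1r.
Qed.

End ComplexIntegral.

Arguments rintegrable {d T R} mu f.
Arguments cintegrable {d T R} mu F.
Arguments cint {d T R} mu F.
Arguments cmeasurable {d T R} F.

(** * Dominated convergence for real-valued integrals *)

Section DominatedConvergence.
Context d (T : measurableType d) (R : realType) (mu : {measure set T -> \bar R}).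

Lemma Rintegral_dominated (f_ : nat -> T -> R) (f g : T -> R) :
  (forall n, measurable_fun setT (f_ n)) -> measurable_fun setT f -> rintegrable mu g ->
  (forall n x, `|f_ n x| <= g x) -> (forall x, f_ ^~ x @ \oo --> f x) ->
  Rintegral mu setT (f_ n) @[n --> \oo] --> Rintegral mu setT f.
Proof.
move=> mf_ mf ig fg ff.
have mEf_ n : measurable_fun setT (EFin \o f_ n) by exact/measurable_EFinP.
have mEf : measurable_fun setT (EFin \o f) by exact/measurable_EFinP.
have [||if0 _ h] := @dominated_convergence _ _ _ mu setT measurableT
   (fun n => EFin \o f_ n) (EFin \o f) (EFin \o g) mEf_ mEf _ ig _.
- by apply: aeW => x _; apply: cvg_EFin; [exact: nearW|exact: ff].
- by apply: aeW => x n _ /=; rewrite lee_fin.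
apply: fine_cvg; rewrite fineK; first exact: h.
exact: integrable_fin_num if0.
Qed.

End DominatedConvergence.

(** * The two-sided Laplace transform as an entire function *)

Section Transform.
Variable R : realType.
Local Notation mu := (@lebesgue_measure R).
Implicit Types (z w : R[i]) (g : R -> R[i]).

Lemma cmeasurable_cexp d (T : measurableType d) (F : T -> R[i]) :
  cmeasurable F -> cmeasurable (fun x => cexp (F x)).
Proof.
move=> [Fr Fi]; split; apply: measurable_funM.
- exact: (measurableT_comp (@measurable_expR R)).
- exact: (measurableT_comp (continuous_measurable_fun (@continuous_cos R))).
- exact: (measurableT_comp (@measurable_expR R)).
- exact: (measurableT_comp (continuous_measurable_fun (@continuous_sin R))).
Qed.

Lemma cmeasurable_cst d (T : measurableType d) (c : R[i]) : cmeasurable (fun _ : T => c).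
Proof. by split; apply: measurable_cst. Qed.

Lemma cmeasurable_expZ z : cmeasurable (fun t : R => cexp (z * t%:C)).
Proof.
apply: cmeasurable_cexp; apply: cmeasurableM; first exact: cmeasurable_cst.
by apply: cmeasurable_real; apply: measurable_id.
Qed.

(** Integrability against every exponential makes the transform converge on the whole plane. *)
Definition exp_decay g := cmeasurable g /\
  forall r : R, 0 <= r -> rintegrable mu (fun t => normc (g t) * expR (r * `|t|)).

(** The unnormalised Fourier transform is its restriction to the arguments [0 -i* y]. *)
Definition laplace g z := cint mu (fun t => g t * cexp (z * t%:C)).

Lemma normc_cexp_le z (t : R) : normc (cexp (z * t%:C)) <= expR (`|Re z| * `|t|).
Proof.
by rewrite normc_cexp ler_expR ReM /= mulr0 subr0 -normrM ler_norm.
Qed.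

Lemma laplace_integrable g z : exp_decay g -> cintegrable mu (fun t => g t * cexp (z * t%:C)).
Proof.
move=> [mg ig]; apply: cintegrable_le (ig _ (normr_ge0 (Re z))) _.
  by apply: cmeasurableM => //; apply: cmeasurable_expZ.
by move=> t; rewrite normcM ler_wpM2l ?normc_ge0 ?normc_cexp_le.
Qed.

Lemma decay_pow_integrable g k : exp_decay g -> cintegrable mu (fun t => g t * (t%:C) ^+ k).
Proof.
move=> [mg ig]; have i1 : rintegrable mu (fun t => k`!%:R * (normc (g t) * expR (1 * `|t|))).
  by apply: rintegrableZ; apply: ig.
apply: cintegrable_le i1 _.
  apply: cmeasurableM => //; under eq_fun do rewrite -rmorphXn.
  by apply: cmeasurable_real; apply: measurable_funX; apply: measurable_id.
move=> t; rewrite normcM normcX normc_real mul1r mulrCA ler_wpM2l ?normc_ge0 //.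
by rewrite mulrC -ler_pdivrMr ?ltr0n ?fact_gt0 // expR_ge_pow.
Qed.

(** The approximants are the partial sums of the moment series. On the disc of radius [r] the error
    is at most the integral of [|g t|] times the remainder of the real exponential at [|r| * |t|],
    which tends to 0 by dominated convergence, uniformly in [z]. *)
Lemma entire_laplace g : exp_decay g -> entire (laplace g).
Proof.
move=> dg; have [mg ig] := dg; move=> r e e0.
pose f_ n (t : R) := normc (g t) * exp_tail n (`|r| * `|t|).
have mtail n : measurable_fun setT (fun t : R => exp_tail n (`|r| * `|t|)).
  apply: (measurableT_comp (f := @exp_tail R n) (g := fun t : R => `|r| * `|t|)).
    apply: measurable_funB; first exact: measurable_expR.
    by apply: measurable_sum => k; apply: measurable_funM => //; apply: measurable_funX;
      exact: measurable_id.
  by apply: measurable_funM => //; apply: measurableT_comp => //; exact: measurable_id.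
have mf n : measurable_fun setT (f_ n).
  by apply: measurable_funM => //; apply: measurable_normc.
have tail0 n (t : R) : 0 <= exp_tail n (`|r| * `|t|) by rewrite exp_tail_ge0 ?mulr_ge0.
have fle n t : `|f_ n t| <= normc (g t) * expR (`|r| * `|t|).
  rewrite ger0_norm ?mulr_ge0 ?normc_ge0 // ler_wpM2l ?normc_ge0 //.
  by rewrite exp_tail_le_exp ?mulr_ge0.
have cv : Rintegral mu setT (f_ n) @[n --> \oo] --> Rintegral mu setT (fun _ : R => 0 : R).
  apply: (@Rintegral_dominated _ _ _ mu f_ _ _ mf _ (ig `|r| (normr_ge0 r)) fle).
    exact: measurable_cst.
  move=> t; rewrite -(mulr0 (normc (g t))); apply: cvgM; first exact: cvg_cst.
  exact: exp_tail_cvg.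
have i0 : Rintegral mu setT (fun _ : R => 0 : R) = 0 by rewrite /Rintegral integral0.
move: cv; rewrite i0 => /cvgrPdist_le /(_ e e0)[n _ /(_ n (leqnn n))].
rewrite sub0r normrN => hn.
exists (\poly_(k < n) (cint mu (fun t => g t * t%:C ^+ k) / k`!%:R)) => z zr.
pose F k (t : R) : R[i] := k`!%:R^-1 * z ^+ k * (g t * t%:C ^+ k).
have ik k : cintegrable mu (F k) by apply: cintegrableZ; apply: decay_pow_integrable.
have -> : (\poly_(k < n) (cint mu (fun t => g t * t%:C ^+ k) / k`!%:R)).[z] =
    cint mu (fun t => \sum_(k < n) F k t).
  rewrite horner_poly (cint_sum n ik); apply: eq_bigr => k _.
  rewrite /F cintZ; last exact: decay_pow_integrable.
  by rewrite [RHS]mulrC mulrA.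
have ile := laplace_integrable z dg.
have isum := cintegrable_sum n ik.
rewrite -cintB //; apply: le_trans (normc_cint (cintegrableB ile isum)) _.
apply: le_trans hn; apply: le_trans (ler_norm _).
apply: le_Rintegral => //.
- exact: cintegrable_normc (cintegrableB ile isum).
- exact: (@rintegrable_le _ _ _ mu (f_ n) _ (mf n) (ig _ (normr_ge0 r)) (fle n)).
move=> t _; have -> : g t * cexp (z * t%:C) - \sum_(k < n) F k t =
    g t * (cexp (z * t%:C) - (exp_poly R n).[z * t%:C]).
  rewrite mulrBr; congr (_ - _); rewrite horner_poly mulr_sumr; apply: eq_bigr => k _.
  by rewrite /F exprMn; ring.
rewrite normcM ler_wpM2l ?normc_ge0 //; apply: le_trans (cexp_taylor _ _) _.
rewrite exp_tail_homo ?nnegrE ?normc_ge0 ?mulr_ge0 //.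
rewrite normcM normc_real ler_wpM2r //; exact: le_trans zr (ler_norm _).
Qed.

End Transform.

(** * The transform of a Gaussian *)

Section GaussianTransform.
Variable R : realType.
Local Notation mu := (@lebesgue_measure R).
Implicit Types (z w : R[i]) (b m t x : R).

Lemma Rintegral_gauss b m : 0 < b ->
  rintegrable mu (fun t => expR (- (b * (t - m) ^+ 2) / 2)) /\
  Rintegral mu setT (fun t => expR (- (b * (t - m) ^+ 2) / 2)) = Num.sqrt (2 * pi / b).
Proof.
move=> b0; pose s := Num.sqrt b^-1.
have s0 : s != 0 by rewrite gt_eqF // sqrtr_gt0 invr_gt0.
have ss : s ^+ 2 = b^-1 by rewrite sqr_sqrtr // invr_ge0 ltW.
have pk := normal_peak_gt0 s0.
have e : (fun t => expR (- (b * (t - m) ^+ 2) / 2)) = (fun t => (normal_peak s)^-1 * normal_pdf m s t).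
  apply/funext => t; rewrite normal_pdfE // mulKf ?gt_eqF // /normal_fun ss.
  by congr expR; field; rewrite gt_eqF.
have i1 := @integrable_normal_pdf R m s.
rewrite e; split; first exact: rintegrableZ.
rewrite RintegralZl //= /Rintegral integral_normal_pdf /= mulr1 /normal_peak invrK ss.
by congr Num.sqrt; rewrite -mulr_natl; ring.
Qed.

Lemma measurable_expR_abs (r : R) : measurable_fun setT (fun t : R => expR (r * `|t|)).
Proof.
by apply: (measurableT_comp (@measurable_expR R)); apply: measurable_funM.
Qed.

Lemma exp_decay_gauss b : 0 < b -> exp_decay (fun t : R => (gaussian b t)%:C).
Proof.
move=> b0; have mg : measurable_fun setT (@gaussian R b).
  apply: (measurableT_comp (@measurable_expR R)); apply: measurable_funM => //.
  by apply: measurableT_comp => //; apply: measurable_funM => //; apply: measurable_funX.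
split; first exact: cmeasurable_real.
move=> r r0; have b2 : 0 < b / 2 by rewrite divr_gt0.
have [i1 _] := Rintegral_gauss 0 b2.
have i2 := @rintegrableZ _ _ _ mu (expR (r ^+ 2 / b)) _ i1.
apply: (@rintegrable_le _ _ _ mu _ _ _ i2).
  apply: measurable_funM; first exact/measurable_normc/cmeasurable_real.
  exact: (measurable_expR_abs r).
move=> t; rewrite normc_real /gaussian ger0_norm ?mulr_ge0 ?expR_ge0 //.
rewrite ger0_norm ?expR_ge0 // -!expRD ler_expR subr0 -(real_normK (num_real t)).
rewrite -subr_ge0.
have -> : r ^+ 2 / b + - (b / 2 * `|t| ^+ 2) / 2 - (- (b * `|t| ^+ 2) / 2 + r * `|t|) =
  (r - b * `|t| / 2) ^+ 2 / b by field; rewrite gt_eqF.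
by rewrite divr_ge0 ?sqr_ge0 // ltW.
Qed.

(** At real arguments this is completion of the square. Both sides are entire and agree at the
    points [1 / (n + 1)], hence everywhere; no shift of contour occurs. *)
Lemma laplace_gauss b z : 0 < b ->
  laplace (fun t : R => (gaussian b t)%:C) z =
  (Num.sqrt (2 * pi / b))%:C * cexp ((2 * b)^-1%:C * z ^+ 2).
Proof.
move=> b0; pose h z := laplace (fun t : R => (gaussian b t)%:C) z -
  (Num.sqrt (2 * pi / b))%:C * cexp ((2 * b)^-1%:C * z ^+ 2).
suff h0 : h z = 0 by apply/eqP; rewrite -subr_eq0 -/(h z) h0.
pose a n : R[i] := (n.+1%:R^-1)%:C.
apply: (entire_identity (a := a)) => [|m n|n|n].
- apply: entireB; first exact/entire_laplace/exp_decay_gauss.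
  apply: entireZ; apply: (entire_comp (@entire_cexp R)); apply: entireZ.
  exact: (entireM (@entire_id R) (@entire_id R)).
- by move=> [] /invr_inj /eqP; rewrite eqr_nat => /eqP[].
- by rewrite normc_real ger0_norm // invf_le1 // ler1n.
rewrite /h /a; set x := n.+1%:R^-1.
have [i1 i2] := Rintegral_gauss (x / b) b0.
have e t : (gaussian b t)%:C * cexp (x%:C * t%:C) =
    (expR ((2 * b)^-1 * x ^+ 2))%:C * (expR (- (b * (t - x / b) ^+ 2) / 2))%:C.
  rewrite -rmorphM cexp_real -!rmorphM /gaussian -!expRD; congr ((expR _)%:C).
  by field; rewrite gt_eqF.
rewrite /laplace (@eq_cint _ _ _ mu _ _ e) cintZ; last first.
  by split => //; apply: integrable0.
rewrite /cint /= /Rintegral integral0 /= -/(Rintegral _ _ _) i2.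
have -> : (2 * b)^-1%:C * x%:C ^+ 2 = ((2 * b)^-1 * x ^+ 2)%:C by rewrite rmorphM rmorphXn.
by rewrite cexp_real; apply/eqP; rewrite subr_eq0 mulrC.
Qed.

End GaussianTransform.

(** * Fubini's theorem for complex-valued functions *)

Section ComplexFubini.
Context d1 d2 (T1 : measurableType d1) (T2 : measurableType d2) (R : realType).
Variables (m1 : {sigma_finite_measure set T1 -> \bar R}).
Variables (m2 : {sigma_finite_measure set T2 -> \bar R}).

Lemma rintegrable_tensor (A : T1 -> R) (B : T2 -> R) : rintegrable m1 A -> rintegrable m2 B ->
  rintegrable (m1 \x m2)%E (fun p => A p.1 * B p.2).
Proof.
move=> iA iB.
have mAB : measurable_fun setT (fun p : T1 * T2 => A p.1 * B p.2).
  apply: measurable_funM.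
    exact: (measurableT_comp (rintegrable_measurable iA) (@measurable_fst _ _ T1 T2)).
  exact: (measurableT_comp (rintegrable_measurable iB) (@measurable_snd _ _ T1 T2)).
apply/integrable12ltyP; first exact/measurable_EFinP.
have /integrableP[_ A1] := iA; have /integrableP[_ B1] := iB.
have mB : measurable_fun setT (fun y => (`|B y|)%:E).
  by apply/measurable_EFinP; apply: measurableT_comp => //; exact: rintegrable_measurable iB.
have mA : measurable_fun setT (fun x => (`|A x|)%:E).
  by apply/measurable_EFinP; apply: measurableT_comp => //; exact: rintegrable_measurable iA.
under eq_integral do under eq_integral do rewrite /= normrM EFinM.
under eq_integral do rewrite ge0_integralZl //.
rewrite ge0_integralZr //; last exact: integral_ge0.
by apply: lte_mul_pinfty => //; [exact: integral_ge0|rewrite ge0_fin_numE //; exact: integral_ge0].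
Qed.

(** All slices, and not just almost all, are required to be integrable: then the real-valued inner
    integrals coincide with the extended ones at every point. *)
Lemma Rintegral_fubini (f : T1 * T2 -> R) : rintegrable (m1 \x m2)%E f ->
  (forall x, rintegrable m2 (fun y => f (x, y))) ->
  (forall y, rintegrable m1 (fun x => f (x, y))) ->
  rintegrable m2 (fun y => Rintegral m1 setT (fun x => f (x, y))) /\
  Rintegral m1 setT (fun x => Rintegral m2 setT (fun y => f (x, y))) =
  Rintegral m2 setT (fun y => Rintegral m1 setT (fun x => f (x, y))).
Proof.
move=> iF i2 i1.
have e1 x : (Rintegral m2 setT (fun y => f (x, y)))%:E = (\int[m2]_y (f (x, y))%:E)%E.
  by rewrite fineK //; apply: (integrable_fin_num _ (i2 x)).
have e2 y : (Rintegral m1 setT (fun x => f (x, y)))%:E = (\int[m1]_x (f (x, y))%:E)%E.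
  by rewrite fineK //; apply: (integrable_fin_num _ (i1 y)).
split.
  have mf := measurable_int _ iF; have mG := measurable_fubini_G iF.
  have eG : EFin \o (fun y => Rintegral m1 setT (fun x => f (x, y))) = fubini_G m1 (EFin \o f).
    by apply/funext => y; rewrite /fubini_G -e2.
  rewrite /rintegrable eG; apply/integrableP; split => //.
  have fin := (integrable21ltyP _ _ mf).1 iF; apply: (le_lt_trans _ fin); apply: ge0_le_integral => //.
  - exact: measurableT_comp.
  - apply: (measurable_fun_fubini_tonelli_G (abse \o (EFin \o f))) => //=.
    exact: measurableT_comp.
  - move=> y _; apply: le_abse_integral => //.
    by have /measurable_int := i1 y.
rewrite /Rintegral; congr fine; under eq_integral do rewrite e1.
by under [RHS]eq_integral do rewrite e2; rewrite (Fubini iF).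
Qed.

Lemma cint_fubini (F : T1 * T2 -> R[i]) (h : T1 * T2 -> R) : cmeasurable F ->
  rintegrable (m1 \x m2)%E h -> (forall p, normc (F p) <= h p) ->
  (forall x, cintegrable m2 (fun y => F (x, y))) ->
  (forall y, cintegrable m1 (fun x => F (x, y))) ->
  cintegrable m2 (fun y => cint m1 (fun x => F (x, y))) /\
  cint m1 (fun x => cint m2 (fun y => F (x, y))) = cint m2 (fun y => cint m1 (fun x => F (x, y))).
Proof.
move=> mF ih Fh i2 i1; have [iR iI] := cintegrable_le mF ih Fh.
have [R1 R2] := Rintegral_fubini iR (fun x => (i2 x).1) (fun y => (i1 y).1).
have [I1 I2] := Rintegral_fubini iI (fun x => (i2 x).2) (fun y => (i1 y).2).
by split; [split|apply: complex_eq].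
Qed.

End ComplexFubini.

(** * The damped function and the kernel of the convolution formula *)

Section DampedDefinitions.
Variable R : realType.
Local Notation mu := (@lebesgue_measure R).
Variables (u v : R -> R).

Definition cfun (t : R) : R[i] := u t +i* v t.

Definition damped (t : R) : R[i] := cfun t * (gaussian 1 t)%:C.

(** Without the normalisation: [sqrt (2 * pi)] times the transform given by [fourier_re] and
    [fourier_im]. *)
Definition fourier (s : R) : R[i] := cint mu (fun t : R => cfun t * cexp ((0 -i* s) * t%:C)).

Definition window (y s : R) := expR (- (s - y) ^+ 2 / 2).

Definition fourier_kernel (y : R) (p : R * R) : R[i] :=
  cfun p.1 * (cexp ((0 -i* p.2) * p.1%:C) * (window y p.2)%:C).

End DampedDefinitions.

(** * The transform of the damped function as a Gaussian average of the transform of [f] *)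

Section Convolution.
Variable R : realType.
Local Notation mu := (@lebesgue_measure R).
Variables (u v : R -> R).
Hypothesis iu : mu.-integrable setT (EFin \o u).
Hypothesis iv : mu.-integrable setT (EFin \o v).

Local Notation T := (measurableTypeR R).
Local Notation f := (cfun u v).
Local Notation g := (damped u v).
Local Notation fhat := (fourier u v).
Local Notation kernel := (fourier_kernel u v).

Lemma cfun_integrable : cintegrable mu f. Proof. by split. Qed.

Lemma cmod_integrable : rintegrable mu (cmod_fun u v).
Proof. exact: cintegrable_normc cfun_integrable. Qed.

Lemma phase_fE (s t : R) : f t * cexp ((0 -i* s) * t%:C) =
  (u t * cos (t * s) + v t * sin (t * s)) +i* (v t * cos (t * s) - u t * sin (t * s)).
Proof.
have -> : (0 -i* s) * t%:C = 0 -i* (t * s) by apply: complex_eq; rewrite /=; ring.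
by apply: complex_eq; rewrite /= expR0 cosN sinN; ring.
Qed.

Lemma fhatE s : fhat s = (Num.sqrt (2 * pi))%:C * (fourier_re u v s +i* fourier_im u v s).
Proof.
have s0 : Num.sqrt (2 * pi) != 0 :> R by rewrite gt_eqF // sqrtr_gt0 mulr_gt0 // pi_gt0.
rewrite /fourier (@eq_cint _ _ _ mu _ _ (phase_fE s)) /cint /=.
by apply: complex_eq; rewrite /= !mul0r ?subr0 ?addr0 /fourier_re /fourier_im mulVKf.
Qed.

Lemma normc_fhat s : normc (fhat s) = Num.sqrt (2 * pi) * fourier_abs u v s.
Proof. by rewrite fhatE normcM normc_real ger0_norm. Qed.

Lemma phase_normc (s t : R) : normc (cexp ((0 -i* s) * t%:C)) = 1.
Proof. by rewrite normc_cexp ReM /= mul0r mulr0 subr0 expR0. Qed.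

Lemma window_integrable y : rintegrable mu (window y).
Proof.
have [h _] := Rintegral_gauss y ltr01; move: h; congr (rintegrable _ _).
by apply/funext => s; rewrite /window mul1r.
Qed.

(** Expanding the square turns this into [laplace_gauss] with [b = 1] at the point [y -i* t]. The
    result is a phase times the very Gaussian used for damping. *)
Lemma window_transform y t : cint mu (fun s : R => cexp ((0 -i* s) * t%:C) * (window y s)%:C) =
  (Num.sqrt (2 * pi))%:C * (cexp ((0 -i* y) * t%:C) * (gaussian 1 t)%:C).
Proof.
have e s : cexp ((0 -i* s) * t%:C) * (window y s)%:C =
    (expR (- y ^+ 2 / 2))%:C * ((gaussian 1 s)%:C * cexp ((y -i* t) * s%:C)).
  rewrite -!cexp_real -!cexpD; congr cexp.
  by apply: complex_eq; rewrite /= ?mul1r; field.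
rewrite (@eq_cint _ _ _ mu _ _ e) (@cintZ _ _ _ mu); last first.
  exact: laplace_integrable (exp_decay_gauss ltr01).
have := @laplace_gauss R 1 (y -i* t) ltr01; rewrite /laplace => ->.
rewrite mulr1 divr1 mulrCA; congr (_ * _).
rewrite -!cexp_real -!cexpD; congr cexp.
by apply: complex_eq; rewrite /= ?expr2 /= ?mul1r; field.
Qed.

Lemma cmeasurable_kernel y : @cmeasurable _ (T * T)%type R (kernel y).
Proof.
have [mu_ mv] := cintegrable_measurable cfun_integrable.
apply: cmeasurableM.
  by split; [exact: (measurableT_comp mu_ (@measurable_fst _ _ T T)) |
             exact: (measurableT_comp mv (@measurable_fst _ _ T T))].
apply: cmeasurableM; last first.
  apply: cmeasurable_real.
  have := rintegrable_measurable (window_integrable y) => mw.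
  exact: (measurableT_comp mw (@measurable_snd _ _ T T)).
apply: cmeasurable_cexp; apply: cmeasurableM.
  split; first exact: measurable_cst.
  by apply: measurableT_comp => //; exact: (@measurable_snd _ _ T T).
by apply: cmeasurable_real; exact: (@measurable_fst _ _ T T).
Qed.

Lemma kernel_bound y p : normc (kernel y p) <= cmod_fun u v p.1 * window y p.2.
Proof.
by rewrite /fourier_kernel !normcM phase_normc mul1r normc_real ger0_norm ?expR_ge0.
Qed.

Lemma kernel_slice1 y t : cintegrable mu (fun s => kernel y (t, s)).
Proof.
have i1 := @rintegrableZ _ _ _ mu (cmod_fun u v t) _ (window_integrable y).
apply: (@cintegrable_le _ _ _ mu _ _ _ i1); last by move=> s; exact: kernel_bound.
have [m1 m2] := cmeasurable_kernel y.
by split; [exact: (measurableT_comp m1 (@pair1_measurable _ _ T T t)) |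
           exact: (measurableT_comp m2 (@pair1_measurable _ _ T T t))].
Qed.

Lemma kernel_slice2 y s : cintegrable mu (fun t => kernel y (t, s)).
Proof.
have i0 := cmod_integrable.
have i1 := @rintegrableZ _ _ _ mu (window y s) _ i0.
apply: (@cintegrable_le _ _ _ mu _ _ _ i1); last first.
  by move=> t; rewrite mulrC; exact: kernel_bound.
have [m1 m2] := cmeasurable_kernel y.
by split; [exact: (measurableT_comp m1 (@pair2_measurable _ _ T T s)) |
           exact: (measurableT_comp m2 (@pair2_measurable _ _ T T s))].
Qed.

(** Fubini for a kernel dominated by [cmod_fun u v t * window y s]. The window supplies the
    integrability in [s], since the transform of [f] need not be integrable. *)
Lemma fhat_convolution y :
  cintegrable mu (fun s => fhat s * (window y s)%:C) /\
  (Num.sqrt (2 * pi))%:C * laplace g (0 -i* y) = cint mu (fun s => fhat s * (window y s)%:C).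
Proof.
have i0 := cmod_integrable.
have [iK fub] := @cint_fubini _ _ T T R mu mu (kernel y) _ (cmeasurable_kernel y)
   (rintegrable_tensor i0 (window_integrable y)) (kernel_bound y)
   (kernel_slice1 y) (kernel_slice2 y).
have slice s : cint mu (fun t => kernel y (t, s)) = fhat s * (window y s)%:C.
  rewrite mulrC /fourier -(@cintZ _ _ _ mu); last first.
    apply: (@cintegrable_le _ _ _ mu _ _ _ i0).
      apply: cmeasurableM; first exact: cintegrable_measurable cfun_integrable.
      exact: cmeasurable_expZ.
    by move=> t; rewrite normcM phase_normc mulr1.
  by apply: (@eq_cint _ _ _ mu) => t; rewrite /fourier_kernel /=; ring.
have eK : (fun s => cint mu (fun t => kernel y (t, s))) = (fun s => fhat s * (window y s)%:C).
  exact/funext.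
move: iK fub; rewrite eK => iK <-; split=> //.
have -> : (fun t => cint mu (fun s => kernel y (t, s))) = (fun t =>
   (Num.sqrt (2 * pi))%:C * (g t * cexp ((0 -i* y) * t%:C))).
  apply/funext => t; rewrite /fourier_kernel /= (@cintZ _ _ _ mu).
    by rewrite window_transform /damped; ring.
  apply: (@cintegrable_le _ _ _ mu _ _ _ (window_integrable y)).
    apply: cmeasurableM.
      apply: cmeasurable_cexp; apply: cmeasurableM; last exact: cmeasurable_cst.
      by split; [exact: measurable_cst|exact: measurableT_comp].
    by apply: cmeasurable_real; exact: rintegrable_measurable (window_integrable y).
  by move=> s; rewrite normcM phase_normc mul1r normc_real ger0_norm ?expR_ge0.
rewrite (@cintZ _ _ _ mu) //.
apply: (@cintegrable_le _ _ _ mu _ _ _ i0).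
  apply: cmeasurableM; last exact: cmeasurable_expZ.
  apply: cmeasurableM; first exact: cintegrable_measurable cfun_integrable.
  by have [] := exp_decay_gauss (@ltr01 R).
move=> t; rewrite normcM phase_normc mulr1 normcM normc_real ger0_norm ?expR_ge0 //.
rewrite ler_piMr ?normc_ge0 // /gaussian mul1r -[leRHS]expR0 ler_expR.
by rewrite mulNr oppr_le0 divr_ge0 ?sqr_ge0.
Qed.

End Convolution.

(** * The Beurling integral bounds products of values of the damped transform *)

Section PointwiseBound.
Variable R : realType.
Local Notation mu := (@lebesgue_measure R).
Local Notation T := (measurableTypeR R).

(* The two Gaussian factors pay for replacing [y] by [s] and the exponent [1] by
   [1 - d / (1 + y^2)]; this is where the growth rate in [1 - lam] is used. *)
Lemma exponent_bound (s t y d : R) : 0 < d -> d <= 1 ->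
  - (s - y) ^+ 2 / 2 + (- t ^+ 2 / 2 + `|y| * `|t|) <=
  4 + (1 - d / (1 + y ^+ 2)) * `|t * s|.
Proof.
move=> d0 d1; rewrite normrM.
have hs : (`|s| - `|y|) ^+ 2 <= (s - y) ^+ 2.
  rewrite -[leRHS]real_normK ?num_real // -[leLHS]real_normK ?num_real //.
  by apply: lerXn2r; rewrite ?nnegrE //; exact: ler_dist_dist.
rewrite -(real_normK (num_real t)) -(real_normK (num_real y)).
move: (normr_ge0 s) (normr_ge0 t) (normr_ge0 y) hs.
move: `|s| `|t| `|y| => c b a c0 b0 a0 hs.
pose e := d / (1 + a ^+ 2); rewrite -/e.
have q0 : 0 < 1 + a ^+ 2 by rewrite ltr_pwDl ?sqr_ge0.
have e0 : 0 <= e by rewrite divr_ge0 ?ltW.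
have ea2 : e * a ^+ 2 <= 1.
  by rewrite /e mulrAC ler_pdivrMr // mul1r; have := sqr_ge0 a; nra.
have e1 : e <= 1 by rewrite /e ler_pdivrMr // mul1r; have := sqr_ge0 a; lra.
have ea : e * a <= 2^-1.
  rewrite /e mulrAC ler_pdivrMr //; have := sqr_ge0 (1 - a); nra.
(* If [a < c], replacing [a] by [c] is free and the loss [e * a * b] is at most [b / 2], which the
   term in [b ^+ 2] absorbs. *)
have [ca|ac] := leP c a; last first.
  have h1 : (1 - e) * (b * a) <= (1 - e) * (b * c).
    by rewrite ler_wpM2l ?subr_ge0 // ler_wpM2l // ltW.
  have h2 : b * (e * a) <= b * 2^-1 by rewrite ler_wpM2l.
  have := sqr_ge0 (b - 2^-1); have := sqr_ge0 (c - a); move: h1 h2 hs; nra.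
(* If [b] and [c] are of order [a], the loss [e * b * c] is at most [4 * e * a ^+ 2 <= 4], the
   source of the constant in the statement. If [b] exceeds [4 * a], then [a * b] is at most a
   quarter of [b ^+ 2] and the damping alone suffices. *)
have [b4|b4] := leP b (4 * a).
  have h1 : e * (b * c) <= 4.
    apply: (@le_trans _ _ (e * (4 * a * a))).
      by rewrite ler_wpM2l // ler_pM.
    have -> : e * (4 * a * a) = 4 * (e * a ^+ 2) by ring.
    by move: ea2; lra.
  by have := sqr_ge0 (b - (a - c)); move: h1 hs; nra.
have h1 : 0 <= (1 - e) * (b * c) by rewrite mulr_ge0 ?subr_ge0 // mulr_ge0.
have h2 : b * (4 * a) <= b * b by rewrite ler_wpM2l // ltW.
by have := sqr_ge0 (c - a); move: h1 h2 hs; nra.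
Qed.

Variables (u v : R -> R).
Hypothesis iu : mu.-integrable setT (EFin \o u).
Hypothesis iv : mu.-integrable setT (EFin \o v).
Local Notation f := (cfun u v).
Local Notation g := (damped u v).
Local Notation fhat := (fourier u v).

Let i0 : rintegrable mu (cmod_fun u v) := cmod_integrable iu iv.

Lemma normc_damped t : normc (g t) = cmod_fun u v t * expR (- t ^+ 2 / 2).
Proof. by rewrite normcM normc_real ger0_norm ?expR_ge0 // /gaussian mul1r. Qed.

Lemma damped_bound (r t : R) :
  normc (g t) * expR (r * `|t|) <= expR (r ^+ 2 / 2) * cmod_fun u v t.
Proof.
rewrite normc_damped -mulrA mulrC ler_wpM2r ?normc_ge0 // -?expRD; first exact: sqrtr_ge0.
rewrite ler_expR -(real_normK (num_real t)) -subr_ge0.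
have -> : r ^+ 2 / 2 - (- `|t| ^+ 2 / 2 + r * `|t|) = (r - `|t|) ^+ 2 / 2 by field.
by rewrite divr_ge0 ?sqr_ge0.
Qed.

Lemma exp_decay_damped : exp_decay g.
Proof.
have mg : cmeasurable g.
  apply: cmeasurableM; first exact: cintegrable_measurable (cfun_integrable iu iv).
  by have [] := exp_decay_gauss (@ltr01 R).
split=> // r r0; have i1 := @rintegrableZ _ _ _ mu (expR (r ^+ 2 / 2)) _ i0.
apply: (@rintegrable_le _ _ _ mu _ _ _ i1).
  apply: measurable_funM; first exact: measurable_normc.
  exact: measurable_expR_abs.
by move=> t; rewrite ger0_norm ?mulr_ge0 ?normc_ge0 ?expR_ge0 ?damped_bound.
Qed.

Lemma laplace_damped_growth z :
  normc (laplace g z) <= Rintegral mu setT (cmod_fun u v) * expR (normc z ^+ 2 / 2).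
Proof.
apply: le_trans (normc_cint (laplace_integrable z exp_decay_damped)) _.
rewrite mulrC -RintegralZl //; apply: le_Rintegral => //.
- exact: cintegrable_normc (laplace_integrable z exp_decay_damped).
- exact: (@rintegrableZ _ _ _ mu _ _ i0).
move=> t _; rewrite normcM.
apply: (@le_trans _ _ (normc (g t) * expR (normc z * `|t|))); last exact: damped_bound.
rewrite ler_wpM2l ?normc_ge0 //; apply: le_trans (normc_cexp_le _ _) _.
by rewrite ler_expR ler_wpM2r // normc_geRe.
Qed.

(** Majorises [laplace g] on the whole strip where the real part is at most [|y|] in absolute value;
    the estimate at one real point thus yields estimates for pairs of points. *)
Definition abs_laplace (y : R) := Rintegral mu setT (fun t => normc (g t) * expR (`|y| * `|t|)).

Lemma laplace_le_abs z (y : R) : `|Re z| <= `|y| -> normc (laplace g z) <= abs_laplace y.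
Proof.
move=> zy; apply: le_trans (normc_cint (laplace_integrable z exp_decay_damped)) _.
apply: le_Rintegral => //.
- exact: cintegrable_normc (laplace_integrable z exp_decay_damped).
- by have [_] := exp_decay_damped; apply.
move=> t _; rewrite normcM ler_wpM2l ?normc_ge0 //.
apply: le_trans (normc_cexp_le _ _) _.
by rewrite ler_expR ler_wpM2r.
Qed.

Lemma fourier_abs_ge0 s : 0 <= fourier_abs u v s.
Proof. exact: sqrtr_ge0. Qed.

Lemma window_fourier_integrable y : rintegrable mu (fun s => fourier_abs u v s * window y s).
Proof.
have [h _] := fhat_convolution iu iv y.
have h1 := @rintegrableZ _ _ _ mu (Num.sqrt (2 * pi))^-1 _ (cintegrable_normc h).
move: h1; congr (rintegrable _ _); apply/funext => s.
rewrite normcM normc_fhat normc_real ger0_norm ?expR_ge0 // -mulrA mulKf //.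
by rewrite gt_eqF // sqrtr_gt0 mulr_gt0 // pi_gt0.
Qed.

Lemma laplace_le_window y :
  normc (laplace g (0 -i* y)) <= Rintegral mu setT (fun s => fourier_abs u v s * window y s).
Proof.
have [h e] := fhat_convolution iu iv y.
have sp : 0 < Num.sqrt (2 * pi) :> R by rewrite sqrtr_gt0 mulr_gt0 // pi_gt0.
rewrite -(ler_pM2l sp) -RintegralZl //; last exact: window_fourier_integrable.
have -> : Num.sqrt (2 * pi) * normc (laplace g (0 -i* y)) =
    normc ((Num.sqrt (2 * pi))%:C * laplace g (0 -i* y)).
  by rewrite normcM normc_real gtr0_norm.
rewrite e; apply: le_trans (normc_cint h) _; rewrite le_eqVlt; apply/orP; left; apply/eqP.
apply: eq_Rintegral => s _.
by rewrite normcM normc_fhat normc_real ger0_norm ?expR_ge0 // mulrA.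
Qed.

(** Integrability of the windowed transform gives measurability, and multiplying by the inverse of
    the window keeps it. *)
Lemma measurable_fourier_abs : measurable_fun [set: T] (fourier_abs u v).
Proof.
have h := rintegrable_measurable (window_fourier_integrable 0).
have -> : fourier_abs u v = (fun s => (fourier_abs u v s * window 0 s) * expR (s ^+ 2 / 2)).
  apply/funext => s; rewrite -mulrA /window -expRD subr0.
  by rewrite mulNr addNr expR0 mulr1.
apply: measurable_funM => //; apply: (measurableT_comp (@measurable_expR R)).
by apply: measurable_funM => //; apply: measurable_funX.
Qed.

Lemma EFin_Rintegral (h : R -> R) : rintegrable mu h ->
  (Rintegral mu setT h)%:E = (\int[mu]_t (h t)%:E)%E.
Proof. by move=> ih; rewrite fineK //; exact: (integrable_fin_num _ ih). Qed.

(** The first factor is at most an integral over [s], the second is an integral over [t]. Their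
    product is a double integral whose integrand is dominated by that of the Beurling integral
    through [exponent_bound]; this also explains the factor [expR 4]. *)
Lemma abs_laplace_bound y d : 0 < d -> d <= 1 ->
  ((normc (laplace g (0 -i* y)) * abs_laplace y)%:E <=
   (expR 4)%:E * beurling_integral u v (1 - d / (1 + y ^+ 2)))%E.
Proof.
move=> d0 d1; set lam := 1 - _.
have iH : rintegrable mu (fun t => normc (g t) * expR (`|y| * `|t|)).
  by have [_] := exp_decay_damped; apply.
have iW := window_fourier_integrable y.
have H0 : 0 <= abs_laplace y.
  by apply: Rintegral_ge0 => t _; rewrite mulr_ge0 ?normc_ge0 ?expR_ge0.
have mf := measurable_fourier_abs.
have mc : measurable_fun [set: T] (cmod_fun u v) := rintegrable_measurable i0.
pose F (p : T * T) : \bar R :=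
  (cmod_fun u v p.2 * fourier_abs u v p.1 * expR (lam * `|p.2 * p.1|))%:E.
have F0 p : (0 <= F p)%E.
  by rewrite lee_fin !mulr_ge0 ?expR_ge0 ?fourier_abs_ge0 ?sqrtr_ge0.
have mF : measurable_fun setT F.
  apply/measurable_EFinP; apply: measurable_funM; first apply: measurable_funM.
  - exact: (measurableT_comp mc (@measurable_snd _ _ T T)).
  - exact: (measurableT_comp mf (@measurable_fst _ _ T T)).
  apply: (measurableT_comp (@measurable_expR R)); apply: measurable_funM => //.
  apply: measurableT_comp => //; apply: measurable_funM.
    exact: (@measurable_snd _ _ T T).
  exact: (@measurable_fst _ _ T T).
have mFs s : measurable_fun setT (fun t : T => F (s, t)).
  exact: (measurableT_comp mF (@pair1_measurable _ _ T T s)).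
have mI : measurable_fun [set: T] (fun s => \int[mu]_t F (s, t))%E.
  exact: (@measurable_fun_fubini_tonelli_F _ _ T T R mu F mF F0).
have -> : beurling_integral u v lam = (\int[mu]_s \int[mu]_t F (s, t))%E by [].
apply: (@le_trans _ _ ((Rintegral mu setT (fun s => fourier_abs u v s * window y s) * abs_laplace y)%:E)).
  by rewrite lee_fin ler_wpM2r // laplace_le_window.
rewrite EFinM EFin_Rintegral // -ge0_integralZr //; last 2 first.
- exact: measurable_int _ iW.
- by move=> s _; rewrite lee_fin mulr_ge0 ?expR_ge0 ?fourier_abs_ge0.
rewrite -ge0_integralZl //; last first.
- by move=> s _; apply: integral_ge0.
apply: ge0_le_integral => //.
- by move=> s _; rewrite mule_ge0 // lee_fin ?mulr_ge0 ?expR_ge0 ?fourier_abs_ge0.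
- by apply: emeasurable_funM => //; exact: measurable_int _ iW.
- exact: emeasurable_funM.
move=> s _; rewrite EFin_Rintegral // -!ge0_integralZl //; last 3 first.
- exact: measurable_int _ iH.
- by move=> t _; rewrite lee_fin mulr_ge0 ?normc_ge0 ?expR_ge0.
- by rewrite lee_fin mulr_ge0 ?expR_ge0 ?fourier_abs_ge0.
apply: ge0_le_integral => //.
- by move=> t _; rewrite mule_ge0 // lee_fin !mulr_ge0 ?normc_ge0 ?expR_ge0 ?fourier_abs_ge0.
- by apply: emeasurable_funM => //; exact: measurable_int _ iH.
- exact: emeasurable_funM.
move=> t _; rewrite -!EFinM lee_fin normc_damped /window.
have -> : fourier_abs u v s * expR (- (s - y) ^+ 2 / 2) *
   (cmod_fun u v t * expR (- t ^+ 2 / 2) * expR (`|y| * `|t|)) =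
   cmod_fun u v t * fourier_abs u v s *
   expR (- (s - y) ^+ 2 / 2 + (- t ^+ 2 / 2 + `|y| * `|t|)) by rewrite !expRD; ring.
rewrite mulrCA ler_wpM2l ?mulr_ge0 ?fourier_abs_ge0 ?sqrtr_ge0 // -expRD ler_expR.
exact: exponent_bound.
Qed.

End PointwiseBound.

(** * Uniqueness of the Fourier transform of an integrable function *)

Section FourierUniqueness.
Variable R : realType.
Local Notation mu := (@lebesgue_measure R).
Local Notation T := (measurableTypeR R).

(* A function with vanishing transform is orthogonal to every polynomial in
   [sin (e (t - x))]; the iterates of this cubic turn the sine into its sign,
   which tends to the sign of [t - x] as [e] goes to 0. *)
Definition sign_step (s : R) := (3 * s - s ^+ 3) / 2.

Lemma sign_step_itv s : 0 <= s <= 1 -> s <= sign_step s <= 1.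
Proof.
move=> /andP[s0 s1]; rewrite /sign_step; apply/andP; split.
  have : 0 <= s * (1 - s) * (1 + s) by rewrite !mulr_ge0 // ?subr_ge0 // addr_ge0.
  by rewrite !exprS expr0; lra.
have : 0 <= (1 - s) ^+ 2 * (2 + s) by rewrite mulr_ge0 ?sqr_ge0 // addr_ge0.
by rewrite !exprS expr0; lra.
Qed.

Lemma sign_stepN s : sign_step (- s) = - sign_step s.
Proof. by rewrite /sign_step; ring. Qed.

Lemma iter_sign_stepN n s : iter n sign_step (- s) = - iter n sign_step s.
Proof. by elim: n => //= n ->; rewrite sign_stepN. Qed.

Lemma iter_sign_step_itv n s : 0 <= s <= 1 -> s <= iter n sign_step s <= 1.
Proof.
move=> s01; elim: n => [|n /andP[h1 h2]] /=; first by case/andP: s01 => _ ->; rewrite lexx.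
have /sign_step_itv/andP[h3 ->] : 0 <= iter n sign_step s <= 1.
  by rewrite h2 andbT; case/andP: s01 => s0 _; apply: le_trans h1.
by rewrite andbT (le_trans h1).
Qed.

Lemma iter_sign_step_bound n s : `|s| <= 1 -> `|iter n sign_step s| <= 1.
Proof.
have pos t : 0 <= t <= 1 -> `|iter n sign_step t| <= 1.
  move=> t01; have /andP[h1 h2] := iter_sign_step_itv n t01.
  by rewrite ger0_norm // (le_trans _ h1) //; case/andP: t01.
have [s0|/ltW s0] := leP 0 s; first by move=> s1; apply: pos; rewrite s0 -(ger0_norm s0).
move=> s1; rewrite -[s]opprK iter_sign_stepN normrN; apply: pos.
by rewrite oppr_ge0 s0 -(ler0_norm s0).
Qed.

Lemma iter_sign_step_cvg_pos s : 0 < s <= 1 -> iter n sign_step s @[n --> \oo] --> (1 : R).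
Proof.
move=> /andP[s0 s1]; have s01 : 0 <= s <= 1 by rewrite ltW.
have itv n := iter_sign_step_itv n s01.
(* the distance to the fixed point [1] contracts by the factor [1 - s / 2] *)
have contr n : 1 - iter n sign_step s <= (1 - s / 2) ^+ n.
  elim: n => [|n IH] /=; first by rewrite expr0 gerBl ltW.
  have /andP[h1 h2] := itv n; set t := iter n sign_step s in h1 h2 IH *.
  apply: (@le_trans _ _ ((1 - s / 2) * (1 - t))); last first.
    by rewrite exprS ler_wpM2l //; move: s1; lra.
  have -> : 1 - sign_step t = (1 - t) * (1 - (t + t ^+ 2) / 2) by rewrite /sign_step; field.
  rewrite mulrC ler_wpM2r ?subr_ge0 //; have := sqr_ge0 t; move: h1; lra.
apply/cvgrPdist_le => e e0.
have : (1 - s / 2) ^+ n @[n --> \oo] --> (0 : R).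
  by apply: cvg_expr; rewrite ger0_norm; move: s0 s1; lra.
move=> /cvgrPdist_le /(_ e e0); apply: filterS => n; rewrite sub0r normrN => h.
have /andP[_ h2] := itv n; rewrite ger0_norm ?subr_ge0 //.
by apply: le_trans (contr n) _; apply: le_trans h; exact: ler_norm.
Qed.

Lemma iter_sign_step_cvg s : `|s| <= 1 -> iter n sign_step s @[n --> \oo] --> Num.sg s.
Proof.
rewrite ler_norml => s1; case: (ltrgtP s 0) => s0.
- rewrite ltr0_sg // -[s]opprK; under eq_fun do rewrite iter_sign_stepN.
  apply: cvgN; apply: iter_sign_step_cvg_pos; move: s0 s1; lra.
- by rewrite gtr0_sg //; apply: iter_sign_step_cvg_pos; move: s0 s1; lra.
- rewrite s0 sgr0; have -> : (fun n => iter n sign_step 0) = (fun=> 0).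
    by apply/funext; elim=> //= n ->; rewrite /sign_step; ring.
  exact: cvg_cst.
Qed.

Definition sign_poly n : {poly R[i]} :=
  iter n (fun p => (3 / 2) *: p - 2^-1 *: p ^+ 3) 'X.

Lemma sign_polyE n s : (sign_poly n).[s%:C] = (iter n sign_step s)%:C.
Proof.
elim: n => [|n IH] /=; first by rewrite hornerX.
rewrite hornerD hornerN !hornerZ horner_exp IH /sign_step; set t := iter n _ s.
rewrite fmorph_div rmorphB rmorphM rmorphXn /= !rmorph_nat; ring.
Qed.

Variable phi : R -> R[i].
Hypothesis iphi : cintegrable mu phi.
Hypothesis phi0 : forall y : R, laplace phi (0 -i* y) = 0.

Definition csin (e x t : R) : R[i] := (sin (e * (t - x)))%:C.

Lemma csinE e x t : csin e x t = (2 * 'i)^-1 *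
  (cexp (0 -i* (e * x)) * cexp ((0 +i* e) * t%:C) - cexp (0 +i* (e * x)) * cexp ((0 -i* e) * t%:C)).
Proof.
have i2 : 2 * 'i != 0 :> R[i] by rewrite mulf_neq0 ?pnatr_eq0 // eq_complex /= oner_eq0 andbF.
apply: (mulfI i2); rewrite mulVKf // -!cexpD /csin mulrBr.
have -> : 0 -i* (e * x) + (0 +i* e) * t%:C = 0 +i* (e * t - e * x).
  by apply: complex_eq; rewrite /=; ring.
have -> : 0 +i* (e * x) + (0 -i* e) * t%:C = 0 -i* (e * t - e * x).
  by apply: complex_eq; rewrite /=; ring.
by move: (e * t - e * x) => w; apply: complex_eq; rewrite /= expR0 ?cosN ?sinN; ring.
Qed.

(** Multiplication by [csin e x] shifts the frequency by [e] in both directions, so the induction on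
    the polynomial has to range over all frequencies [y]. *)
Lemma poly_sin_vanish (P : {poly R[i]}) e x y :
  cintegrable mu (fun t => phi t * P.[csin e x t] * cexp ((0 -i* y) * t%:C)) /\
  cint mu (fun t => phi t * P.[csin e x t] * cexp ((0 -i* y) * t%:C)) = 0.
Proof.
have phase z : cintegrable mu (fun t => phi t * cexp ((0 -i* z) * t%:C)).
  apply: (@cintegrable_le _ _ _ mu _ _ _ (cintegrable_normc iphi)).
    by apply: cmeasurableM; [exact: (cintegrable_measurable iphi)|exact: cmeasurable_expZ].
  by move=> t; rewrite normcM phase_normc mulr1 lexx.
elim/poly_ind: P y => [|P c IH] y.
  have -> : (fun t => phi t * (0 : {poly R[i]}).[csin e x t] * cexp ((0 -i* y) * t%:C)) = (fun=> 0).
    by apply/funext => t; rewrite horner0 mulr0 mul0r.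
  by split; [exact: cintegrable0|exact: cint0].
pose G z t := phi t * P.[csin e x t] * cexp ((0 -i* z) * t%:C).
have e1 : (fun t => phi t * (P * 'X + c%:P).[csin e x t] * cexp ((0 -i* y) * t%:C)) =
  (fun t => (2 * 'i)^-1 * cexp (0 -i* (e * x)) * G (y - e) t +
     (- (2 * 'i)^-1 * cexp (0 +i* (e * x)) * G (y + e) t +
      c * (phi t * cexp ((0 -i* y) * t%:C)))).
  apply/funext => t; rewrite hornerMXaddC /G {2}csinE.
  have -> : (0 -i* (y - e)) * t%:C = (0 +i* e) * t%:C + (0 -i* y) * t%:C.
    by apply: complex_eq; rewrite /=; ring.
  have -> : (0 -i* (y + e)) * t%:C = (0 -i* e) * t%:C + (0 -i* y) * t%:C.
    by apply: complex_eq; rewrite /=; ring.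
  by rewrite !cexpD; ring.
have [i1 z1] := IH (y - e); have [i2 z2] := IH (y + e).
rewrite -/(G _) in i1 z1; rewrite -/(G _) in i2 z2.
have j1 := cintegrableZ ((2 * 'i)^-1 * cexp (0 -i* (e * x))) i1.
have j2 := cintegrableZ (- (2 * 'i)^-1 * cexp (0 +i* (e * x))) i2.
have j3 := cintegrableZ c (phase y).
rewrite e1; split; first exact: cintegrableD j1 (cintegrableD j2 j3).
rewrite cintD //; last exact: cintegrableD.
rewrite cintD // !cintZ // z1 z2 !mulr0 !add0r.
by have := phi0 y; rewrite /laplace => ->; rewrite mulr0.
Qed.

Lemma vanish_limit (F_ : nat -> R -> R) (F : R -> R) :
  (forall n t, `|F_ n t| <= 1) -> (forall t, F_ n t @[n --> \oo] --> F t) ->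
  (forall n, cintegrable mu (fun t => phi t * (F_ n t)%:C)) ->
  (forall n, cint mu (fun t => phi t * (F_ n t)%:C) = 0) ->
  cintegrable mu (fun t => phi t * (F t)%:C) /\ cint mu (fun t => phi t * (F t)%:C) = 0.
Proof.
move=> F1 FF iF zF; have [pR pI] := iphi.
have ReE (G : R -> R) : (fun t => Re (phi t * (G t)%:C)) = (fun t => Re (phi t) * G t).
  by apply/funext => t; rewrite ReM /= mulr0 subr0.
have ImE (G : R -> R) : (fun t => Im (phi t * (G t)%:C)) = (fun t => Im (phi t) * G t).
  by apply/funext => t; rewrite ImM /= mulr0 add0r.
have part (U : R -> R) : rintegrable mu U -> (forall n, rintegrable mu (fun t => U t * F_ n t)) ->
    (forall n, Rintegral mu setT (fun t => U t * F_ n t) = 0) ->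
    rintegrable mu (fun t => U t * F t) /\ Rintegral mu setT (fun t => U t * F t) = 0.
  move=> iU iUF zU.
  have cvU t : U t * F_ n t @[n --> \oo] --> U t * F t by apply: cvgM; [exact: cvg_cst|exact: FF].
  have mUF n : measurable_fun [set: T] (fun t => U t * F_ n t) := rintegrable_measurable (iUF n).
  have mU : measurable_fun [set: T] (fun t => U t * F t).
    exact: (@measurable_fun_cvg _ T R setT (fun n t => U t * F_ n t) _ mUF (fun t _ => cvU t)).
  have bU n t : `|U t * F_ n t| <= `|U t| by rewrite normrM ler_piMr.
  split.
    apply: (@rintegrable_le _ _ _ mu _ _ mU (rintegrable_norm iU)) => t.
    rewrite normrM ler_piMr //.
    have cn : `|F_ n t| @[n --> \oo] --> `|F t| by apply: cvg_norm; exact: FF.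
    rewrite -(cvg_lim _ cn) //; apply: limr_le; first exact: cvgP cn.
    by apply: nearW => n.
  have := @Rintegral_dominated _ _ _ mu _ _ _ mUF mU (rintegrable_norm iU) bU cvU.
  under eq_fun do rewrite zU; move=> c0.
  by have := cvg_unique _ c0 (cvg_cst 0); apply.
have [i1 z1] : rintegrable mu (fun t => Re (phi t) * F t) /\
    Rintegral mu setT (fun t => Re (phi t) * F t) = 0.
  apply: part => // n; first by have [h _] := iF n; rewrite -ReE.
  by have := congr1 (@Re R) (zF n); rewrite /= ReE.
have [i2 z2] : rintegrable mu (fun t => Im (phi t) * F t) /\
    Rintegral mu setT (fun t => Im (phi t) * F t) = 0.
  apply: part => // n; first by have [_ h] := iF n; rewrite -ImE.
  by have := congr1 (@Im R) (zF n); rewrite /= ImE.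
by split; [split; rewrite ?ReE ?ImE|apply: complex_eq; rewrite /= ?ReE ?ImE].
Qed.

Lemma sign_sin_vanish e x :
  cintegrable mu (fun t => phi t * (Num.sg (sin (e * (t - x))))%:C) /\
  cint mu (fun t => phi t * (Num.sg (sin (e * (t - x))))%:C) = 0.
Proof.
have E n : (fun t => phi t * (iter n sign_step (sin (e * (t - x))))%:C) =
    (fun t => phi t * (sign_poly n).[csin e x t] * cexp ((0 -i* 0) * t%:C)).
  apply/funext => t; rewrite sign_polyE.
  have -> : (0 -i* 0) * t%:C = 0 by apply: complex_eq; rewrite /=; ring.
  by rewrite cexp0 mulr1.
apply: (vanish_limit (F_ := fun n t => iter n sign_step (sin (e * (t - x))))).
- by move=> n t; apply: iter_sign_step_bound; rewrite sin_max.
- by move=> t; apply: iter_sign_step_cvg; rewrite sin_max.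
- by move=> n; rewrite E; have [] := poly_sin_vanish (sign_poly n) e x 0.
- by move=> n; rewrite E; have [] := poly_sin_vanish (sign_poly n) e x 0.
Qed.

Lemma sg_sin (w : R) : `|w| < pi -> Num.sg (sin w) = Num.sg w.
Proof.
rewrite ltr_norml => /andP[w1 w2]; case: (ltrgtP w 0) => w0.
- have s0 : sin w < 0 by rewrite -oppr_gt0 -sinN sin_gt0_pi // oppr_gt0 w0 ltrNl.
  by rewrite !ltr0_sg.
- have s0 : 0 < sin w by rewrite sin_gt0_pi // w0.
  by rewrite !gtr0_sg.
- by rewrite w0 sin0.
Qed.

Lemma sign_vanish x :
  cintegrable mu (fun t => phi t * (Num.sg (t - x))%:C) /\
  cint mu (fun t => phi t * (Num.sg (t - x))%:C) = 0.
Proof.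
apply: (vanish_limit (F_ := fun n t => Num.sg (sin (n.+1%:R^-1 * (t - x))))).
- by move=> n t; rewrite normr_sg; case: (_ != 0) => //=; rewrite ler01.
- move=> t; apply: cvg_near_cst.
  (* For fixed [t] the angle [(t - x) / (n + 1)] is eventually below [pi] in absolute value, and
     there the sine has the sign of its argument; the sequence is eventually constant. *)
  have [n _ hn] : \forall n \near \oo, `|t - x| / pi < n.+1%:R.
    have := archi_boundP (divr_ge0 (normr_ge0 (t - x)) (pi_ge0 R)); set m := Num.bound _ => h.
    by exists m => // k /= mk; apply: lt_le_trans h _; rewrite ler_nat leqW.
  exists n => // k /hn h; rewrite sg_sin.
    by rewrite sgrM gtr0_sg ?invr_gt0 // mul1r.
  rewrite normrM gtr0_norm ?invr_gt0 // mulrC ltr_pdivrMr //.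
  by rewrite -ltr_pdivrMl ?pi_gt0 // mulrC.
- by move=> n; have [] := sign_sin_vanish n.+1%:R^-1 x.
- by move=> n; have [] := sign_sin_vanish n.+1%:R^-1 x.
Qed.

(** The function [(1 - sg (t - x)) / 2] is the indicator of the half line up to [x], except at [x].
    All integrals of [U] over such half lines therefore vanish, and Lebesgue differentiation gives
    [U = 0] almost everywhere. *)
Lemma half_line_ae0 (U : R -> R) : rintegrable mu U -> Rintegral mu setT U = 0 ->
  (forall x, rintegrable mu (fun t => U t * Num.sg (t - x))) ->
  (forall x, Rintegral mu setT (fun t => U t * Num.sg (t - x)) = 0) ->
  {ae mu, forall t, U t = 0}.
Proof.
move=> iU zU iS zS.
have zero x : Rintegral mu `]-oo, x] U = 0.
  have iH : rintegrable mu (fun t => 2^-1 * (U t - U t * Num.sg (t - x))).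
    by apply: rintegrableZ; apply: rintegrableB.
  have zH : Rintegral mu setT (fun t => 2^-1 * (U t - U t * Num.sg (t - x))) = 0.
    rewrite RintegralZl //; last exact: rintegrableB.
    have := @RintegralB _ _ _ mu _ _ _ measurableT iU (iS x).
    by rewrite zU zS subrr => ->; rewrite mulr0.
  rewrite -zH Rintegral_mkcond; congr fine; apply: ae_eq_integral => //.
  - apply/measurable_EFinP; apply/(measurable_restrictT _ _).1 => //.
    apply: measurable_funTS; exact: rintegrable_measurable iU.
  - exact: measurable_int _ iH.
  (* The integrands differ at most at [t = x], where the sign is 0. *)
  exists [set x]; split; [exact: measurable_set1|exact: lebesgue_measure_set1|].
  move=> t /= ht; apply: contrapT => tx; apply: ht => _; congr EFin.
  rewrite patchE; case: ifPn => [|]; rewrite ?inE ?notin_setE /= in_itv /=.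
    move=> tle; rewrite ltr0_sg; first by field.
    by rewrite subr_lt0 lt_neqAle tle andbT; apply/eqP.
  move=> /negP; rewrite -ltNge => lt; by rewrite gtr0_sg ?subr_gt0 // mulr1 subrr mulr0.
have iK y : mu.-integrable `]-oo, y] (EFin \o U) by apply: integrableS iU.
have lU : locally_integrable [set: R] U by apply: open_integrable_locally => //; exact: openT.
have := FTC1Ny iK lU; apply: filterS; first exact: (ae_filter_ringOfSetsType mu).
move=> x [_ <-].
have -> : (fun x => \int[mu]_(t in [set` `]-oo, x]]) U t) = (fun=> 0) by apply/funext => y; exact: zero.
by rewrite derive1_cst.
Qed.

Lemma laplace_unique_ae : {ae mu, forall t, phi t = 0}.
Proof.
have ReE x : (fun t => Re (phi t * (Num.sg (t - x))%:C)) = (fun t => Re (phi t) * Num.sg (t - x)).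
  by apply/funext => t; rewrite ReM /= mulr0 subr0.
have ImE x : (fun t => Im (phi t * (Num.sg (t - x))%:C)) = (fun t => Im (phi t) * Num.sg (t - x)).
  by apply/funext => t; rewrite ImM /= mulr0 add0r.
have z0 : cint mu phi = 0.
  rewrite -(phi0 0) /laplace; apply: (@eq_cint _ _ _ mu) => t.
  have -> : (0 -i* 0) * t%:C = 0 by apply: complex_eq; rewrite /=; ring.
  by rewrite cexp0 mulr1.
have hR : {ae mu, forall t, Re (phi t) = 0}.
  apply: half_line_ae0 => [||x|x]; first by have [] := iphi.
  - by have := congr1 (@Re R) z0.
  - by have [[]] := sign_vanish x; rewrite ReE.
  - by have [_ /(congr1 (@Re R))] := sign_vanish x; rewrite /= ReE.
have hI : {ae mu, forall t, Im (phi t) = 0}.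
  apply: half_line_ae0 => [||x|x]; first by have [] := iphi.
  - by have := congr1 (@Im R) z0.
  - by have [[]] := sign_vanish x; rewrite ImE.
  - by have [_ /(congr1 (@Im R))] := sign_vanish x; rewrite /= ImE.
move: hR hI; apply: filterS2; first exact: (ae_filter_ringOfSetsType mu).
by move=> t h1 h2; apply: complex_eq.
Qed.

End FourierUniqueness.

(** * Transforms of polynomials times Gaussians *)

Section PolynomialGaussian.
Variable R : realType.
Local Notation mu := (@lebesgue_measure R).
Local Notation T := (measurableTypeR R).
Implicit Types (p q : {poly R[i]}) (z w : R[i]).

(** Over the interval from [- (n + 1)] to [n + 1] the integral is a difference of two boundary
    values, which decay exponentially. *)
Lemma Rintegral_derive_eq0 (F dF : R -> R) (K : R) : (forall x : R, is_derive x 1 F (dF x)) ->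
  continuous dF -> rintegrable mu dF -> (forall x, `|F x| <= K * expR (- `|x|)) ->
  Rintegral mu setT dF = 0.
Proof.
move=> dFF cdF idF FK.
have K0 : 0 <= K by have := le_trans (normr_ge0 _) (FK 0); rewrite pmulr_lge0 ?expR_gt0.
have cF : continuous F.
  by move=> x; apply: differentiable_continuous; apply/derivable1_diffP; have [] := dFF x.
pose I (n : nat) := [set` `[- n.+1%:R, n.+1%:R : R]].
have FTC n : Rintegral mu (I n) dF = F n.+1%:R - F (- n.+1%:R).
  have n0 : - n.+1%:R < n.+1%:R :> R by rewrite (@lt_trans _ _ 0) // oppr_lt0.
  rewrite /Rintegral (@continuous_FTC2 _ dF F _ _ n0) //.
  - exact: continuous_subspaceT.
  - split; first by move=> x _; have [] := dFF x.
      by apply: cvg_at_right_filter; exact: cF.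
    by apply: cvg_at_left_filter; exact: cF.
  - by move=> x _; rewrite derive1E; have [_] := dFF x.
have cvI : Rintegral mu setT (dF \_ (I n)) @[n --> \oo] --> Rintegral mu setT dF.
  have mdF : measurable_fun [set: T] dF := rintegrable_measurable idF.
  apply: (@Rintegral_dominated _ _ _ mu _ _ _ _ mdF (rintegrable_norm idF)).
  - move=> n; apply/(measurable_restrictT _ _).1; first exact: measurable_itv.
    exact: measurable_funTS.
  - by move=> n x; rewrite patchE; case: ifP => _ //; rewrite normr0.
  - move=> x; apply: cvg_near_cst; have := archi_boundP (normr_ge0 x); set m := Num.bound _ => h.
    exists m => // k /= mk; rewrite patchE ifT //; apply/mem_set; rewrite /I /= in_itv /= -ler_norml.
    by rewrite ltW // (lt_le_trans h) // ler_nat leqW.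
have cv0 : Rintegral mu setT (dF \_ (I n)) @[n --> \oo] --> (0 : R).
  have e n : Rintegral mu setT (dF \_ (I n)) = F n.+1%:R - F (- n.+1%:R).
    by rewrite -FTC [RHS]Rintegral_mkcond.
  under eq_fun do rewrite e.
  have b n : `|F n.+1%:R - F (- n.+1%:R)| <= 2 * K * expR (-1) ^+ n.
    have h1 := FK n.+1%:R; have h2 := FK (- n.+1%:R).
    have h3 : expR (- n.+1%:R : R) <= expR (-1) ^+ n.
      by rewrite -expRM_natl ler_expR mulrN1 lerN2 ler_nat.
    have h4 : K * expR (- n.+1%:R) <= K * expR (-1) ^+ n by rewrite ler_wpM2l.
    apply: le_trans (ler_normB _ _) _; move: h1 h2 h4; rewrite normrN normr_nat; lra.
  apply/cvgr0Pnorm_le => e' e0.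
  have : 2 * K * expR (-1) ^+ n @[n --> \oo] --> (0 : R).
    rewrite -(mulr0 (2 * K)); apply: cvgM; first exact: cvg_cst.
    by apply: cvg_expr; rewrite ger0_norm ?expR_ge0 // -[ltRHS]expR0 ltr_expR oppr_lt0.
  move=> /cvgr0Pnorm_le /(_ e' e0); apply: filterS => n h.
  by apply: le_trans (b n) _; apply: le_trans h; exact: ler_norm.
exact: cvg_unique cvI cv0.
Qed.

Definition poly_gauss (a : R) p (t : R) : R[i] := p.[t%:C] * (gaussian a t)%:C.

Lemma gauss_exp_bound (a r t : R) : 0 < a ->
  gaussian a t * expR (r * `|t|) <= expR (r ^+ 2 / (2 * a)).
Proof.
move=> a0; rewrite -expRD ler_expR -(real_normK (num_real t)) -subr_ge0.
have -> : r ^+ 2 / (2 * a) - (- (a * `|t| ^+ 2) / 2 + r * `|t|) = (r - a * `|t|) ^+ 2 / (2 * a).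
  by field; rewrite gt_eqF.
by rewrite divr_ge0 ?sqr_ge0 // mulr_ge0 // ltW.
Qed.

(** As [|t| <= expR |t|], one more factor [t] costs one unit of the rate [r]; hence the induction
    over all [r]. *)
Lemma poly_gauss_bound (a : R) p (r : R) : 0 < a ->
  exists K, forall t, normc (poly_gauss a p t) * expR (r * `|t|) <= K.
Proof.
move=> a0; elim/poly_ind: p r => [|p c IH] r.
  by exists 0 => t; rewrite /poly_gauss horner0 mul0r normc0 mul0r.
have [K hK] := IH (r + 1); exists (K + normc c * expR (r ^+ 2 / (2 * a))) => t.
have g0 : 0 <= gaussian a t by exact: expR_ge0.
rewrite /poly_gauss hornerMXaddC mulrDl.
apply: (@le_trans _ _ ((normc (p.[t%:C] * t%:C * (gaussian a t)%:C) +
    normc (c * (gaussian a t)%:C)) * expR (r * `|t|))).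
  by rewrite ler_wpM2r ?expR_ge0 // le_normcD.
rewrite mulrDl lerD //; last first.
  by rewrite normcM normc_real (ger0_norm g0) -mulrA ler_wpM2l ?normc_ge0 // gauss_exp_bound.
apply: le_trans (hK t); rewrite /poly_gauss !normcM !normc_real mulrDl expRD mul1r.
have h : `|t| <= expR `|t| by apply: le_trans (expR_ge1Dx _); rewrite lerDr.
set A := normc _; set B := `|gaussian a t|; set E := expR (r * `|t|).
have -> : A * `|t| * B * E = A * B * E * `|t| by ring.
rewrite [leRHS]mulrA; apply: ler_wpM2l h.
by rewrite /A /B /E !mulr_ge0 ?normc_ge0 ?expR_ge0.
Qed.

Variable a : R.
Hypothesis a0 : 0 < a.

Lemma exp_decay_poly_gauss p : exp_decay (poly_gauss a p).
Proof.
have mg : cmeasurable (poly_gauss a p).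
  apply: cmeasurableM; last by have [] := exp_decay_gauss a0.
  elim/poly_ind: p => [|p c IH].
    by under eq_fun do rewrite horner0; apply: cmeasurable_cst.
  under eq_fun do rewrite hornerMXaddC.
  have h : cmeasurable (fun t : R => p.[t%:C] * t%:C).
    by apply: cmeasurableM => //; apply: cmeasurable_real; exact: measurable_id.
  case: h => h1 h2; split.
    by under eq_fun do rewrite ReD; apply: measurable_funD.
  by under eq_fun do rewrite ImD; apply: measurable_funD.
(* One half of the Gaussian absorbs the polynomial and the exponential, the other half remains as an
   integrable majorant. *)
split=> // r r0; have a2 : 0 < a / 2 by rewrite divr_gt0.
have [K hK] := poly_gauss_bound p r a2.
have [ig _] := Rintegral_gauss 0 a2.
apply: (@rintegrable_le _ _ _ mu _ _ _ (@rintegrableZ _ _ _ mu K _ ig)).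
  by apply: measurable_funM; [exact: measurable_normc|exact: measurable_expR_abs].
move=> t; rewrite ger0_norm ?mulr_ge0 ?normc_ge0 ?expR_ge0 // subr0.
have -> : normc (poly_gauss a p t) = normc (poly_gauss (a / 2) p t) * gaussian (a / 2) t.
  rewrite /poly_gauss !normcM !normc_real !ger0_norm ?expR_ge0 // -mulrA -expRD.
  by congr (_ * expR _); field.
by rewrite mulrAC ler_wpM2r ?expR_ge0.
Qed.

Lemma is_derive_gaussian (t : R) : is_derive t 1 (gaussian a) (- a * t * gaussian a t).
Proof.
have -> : gaussian a = (fun s => expR (- (a / 2) * s ^+ 2)).
  by apply/funext => s; rewrite /gaussian; congr expR; ring.
have h := @is_derive_comp _ expR (fun s => - (a / 2) * s ^+ 2) t _ _ (is_derive_expR _)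
  (is_derive_fZ (- (a / 2)) (is_derive_fX 2 t)).
by apply: is_derive_eq; rewrite /= expr1 mulrC; congr (_ * _); field.
Qed.

(** The polynomial factor of the derivative of [p] times the Gaussian of parameter [a]. *)
Definition gauss_deriv p : {poly R[i]} := p^`() - a%:C *: ('X * p).

Lemma is_derive_poly_gauss p z w (t : R) : is_derive t 1
  (fun s : R => Re (w * (poly_gauss a p s * cexp (z * s%:C))))
  (Re (w * (poly_gauss a (gauss_deriv p + z *: p) t * cexp (z * t%:C)))).
Proof.
elim/poly_ind: p w => [|p c IH] w.
  have -> : (fun s : R => Re (w * (poly_gauss a 0 s * cexp (z * s%:C)))) = cst 0.
    by apply/funext => s; rewrite /poly_gauss horner0 !mul0r mulr0.
  rewrite /gauss_deriv deriv0 mulr0 !scaler0 subrr addr0 /poly_gauss horner0 !mul0r mulr0.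
  exact: is_derive_cst.
have -> : (fun s : R => Re (w * (poly_gauss a (p * 'X + c%:P) s * cexp (z * s%:C)))) =
    (fun s => s * Re (w * (poly_gauss a p s * cexp (z * s%:C))) +
              gaussian a s * Re (w * c * cexp (s%:C * z))).
  apply/funext => s; rewrite -!ReZ -ReD; congr Re.
  by rewrite /poly_gauss hornerMXaddC [z * _]mulrC; ring.
have h := is_derive_fD (is_derive_fM (is_derive_id t (1 : R)) (IH w))
  (is_derive_fM (is_derive_gaussian t) (is_derive_cexp z (w * c) t)).
apply: is_derive_eq; rewrite mul1r -!ReZ -!ReD; congr Re.
rewrite /poly_gauss /gauss_deriv !rmorphM rmorphN derivD derivM derivX derivC.
rewrite !(hornerD, hornerN, hornerZ, hornerM, hornerX, hornerC) [z * _]mulrC.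
ring.
Qed.

(** The integrand is the derivative of [poly_gauss a p t * cexp (z * t%:C)], which vanishes at
    infinity. In effect, differentiation becomes multiplication by [- z]. *)
Lemma laplace_gauss_deriv p z : laplace (poly_gauss a (gauss_deriv p + z *: p)) z = 0.
Proof.
have dF w t := is_derive_poly_gauss p z w t.
set P := gauss_deriv p + z *: p in dF *.
have iP := laplace_integrable z (exp_decay_poly_gauss P).
have [K hK] := poly_gauss_bound p (`|Re z| + 1) a0.
(* The weight [w] lets one real statement yield both parts: [w = 1] gives the real part and
   [w = - 'i] the imaginary one. *)
have zero w : Rintegral mu setT (fun t => Re (w * (poly_gauss a P t * cexp (z * t%:C)))) = 0.
  apply: (Rintegral_derive_eq0 (K := normc w * K) (dF w)).
  - move=> t; apply: differentiable_continuous; apply/derivable1_diffP.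
    by have [] := is_derive_poly_gauss P z w t.
  - by have [] := cintegrableZ w iP.
  - move=> t; apply: le_trans (normc_geRe _) _; rewrite normcM normcM -[leRHS]mulrA.
    apply: ler_wpM2l; rewrite ?normc_ge0 // expRN ler_pdivlMr ?expR_gt0 //.
    apply: (le_trans _ (hK t)); rewrite -mulrA; apply: ler_wpM2l; rewrite ?normc_ge0 //.
    rewrite mulrDl expRD mul1r; apply: ler_wpM2r; rewrite ?expR_ge0 //.
    exact: normc_cexp_le.
rewrite /laplace; apply: complex_eq => /=.
  by have := zero 1; under eq_Rintegral do rewrite mul1r.
have := zero (- 'i); rewrite /=.
under eq_Rintegral do rewrite ReM /= oppr0 mul0r sub0r mulNr mul1r opprK.
by [].
Qed.

Lemma laplaceD g h z : exp_decay g -> exp_decay h ->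
  laplace (fun t => g t + h t) z = laplace g z + laplace h z.
Proof.
move=> dg dh; rewrite /laplace -cintD; try exact: laplace_integrable.
by apply: (@eq_cint _ _ _ mu) => t; rewrite mulrDl.
Qed.

Lemma laplaceZ (c : R[i]) g z : exp_decay g -> laplace (fun t => c * g t) z = c * laplace g z.
Proof.
move=> dg; rewrite /laplace -cintZ; last exact: laplace_integrable.
by apply: (@eq_cint _ _ _ mu) => t; rewrite mulrA.
Qed.

(** Horner induction on [q]: constants come from the Gaussian itself, and multiplication by [z] from
    [- gauss_deriv]. With uniqueness this inverts the transform with no inversion formula. *)
Lemma laplace_poly_gauss q :
  exists p, forall z, laplace (poly_gauss a p) z = q.[z] * cexp ((2 * a)^-1%:C * z ^+ 2).
Proof.
elim/poly_ind: q => [|q c [p hp]].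
  exists 0 => z; rewrite horner0 mul0r /laplace -[RHS](@cint0 _ _ _ mu).
  by apply: (@eq_cint _ _ _ mu) => t; rewrite /poly_gauss horner0 !mul0r.
have s0 : (Num.sqrt (2 * pi / a))%:C != 0 :> R[i].
  by rewrite -normc_eq0 normc_real normr_eq0 gt_eqF // sqrtr_gt0 divr_gt0 // mulr_gt0 // pi_gt0.
exists ((c / (Num.sqrt (2 * pi / a))%:C)%:P - gauss_deriv p) => z.
have one : laplace (poly_gauss a 1) z = (Num.sqrt (2 * pi / a))%:C * cexp ((2 * a)^-1%:C * z ^+ 2).
  rewrite -(laplace_gauss z a0); apply: (@eq_cint _ _ _ mu) => t.
  by rewrite /poly_gauss hornerC mul1r.
have dd := exp_decay_poly_gauss.
have dz : laplace (poly_gauss a (gauss_deriv p)) z = - (z * laplace (poly_gauss a p) z).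
  apply/eqP; rewrite -addr_eq0 -(laplaceZ _ _ (dd p)); apply/eqP.
  have := laplace_gauss_deriv p z; rewrite /laplace => <-.
  rewrite -(@cintD _ _ _ mu); first last.
  - have := cintegrableZ z (laplace_integrable z (dd p)); congr (cintegrable _ _).
    by apply/funext => t; rewrite mulrA.
  - exact: laplace_integrable.
  by apply: (@eq_cint _ _ _ mu) => t; rewrite /poly_gauss (hornerD (gauss_deriv p)) hornerZ; ring.
have -> : poly_gauss a ((c / (Num.sqrt (2 * pi / a))%:C)%:P - gauss_deriv p) =
    (fun t => c / (Num.sqrt (2 * pi / a))%:C * poly_gauss a 1 t + (-1) * poly_gauss a (gauss_deriv p) t).
  by apply/funext => t; rewrite /poly_gauss hornerD hornerN !hornerC; ring.
have dZ (k : R[i]) g : exp_decay g -> exp_decay (fun t => k * g t).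
  move=> [mg ig]; split; first by apply: cmeasurableM => //; exact: cmeasurable_cst.
  move=> r r0; have := @rintegrableZ _ _ _ mu (normc k) _ (ig r r0); congr (rintegrable _ _).
  by apply/funext => t; rewrite normcM mulrA.
rewrite laplaceD ?laplaceZ ?one ?dz ?hp; try exact: dd; try (apply: dZ; exact: dd).
by rewrite mulrA divfK // hornerMXaddC; ring.
Qed.

End PolynomialGaussian.

(** * Identification of the function and conclusion *)

Section BeurlingTheorem.
Variable R : realType.
Local Notation mu := (@lebesgue_measure R).
Local Notation T := (measurableTypeR R).

Lemma Re_horner_real (p : {poly R[i]}) (t : R) :
  Re p.[t%:C] = (\poly_(k < size p) Re p`_k).[t].
Proof.
rewrite horner_coef horner_poly Re_sum; apply: eq_bigr => k _.
by rewrite -rmorphXn mulrC ReZ mulrC.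
Qed.

Lemma Im_horner_real (p : {poly R[i]}) (t : R) :
  Im p.[t%:C] = (\poly_(k < size p) Im p`_k).[t].
Proof.
rewrite horner_coef horner_poly.
rewrite (big_morph (@Im R) (@ImD R) (erefl : Im 0 = 0)); apply: eq_bigr => k _.
by rewrite -rmorphXn ImM /= mulr0 add0r mulrC.
Qed.

Variables (u v : R -> R) (N : R).
Hypothesis iu : mu.-integrable setT (EFin \o u).
Hypothesis iv : mu.-integrable setT (EFin \o v).
Local Notation g := (damped u v).

Definition hermite_type := exists2 a : R, 0 < a &
  exists p q : {poly R},
    {ae mu, forall x : R, u x = p.[x] * gaussian a x /\ v x = q.[x] * gaussian a x}.

Lemma polynomial_bound (C delta : R) : 0 < delta ->
  (forall lam : R, 1 - delta < lam -> lam < 1 ->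
     (beurling_integral u v lam <= (C * (1 - lam) `^ (- N))%:E)%E) ->
  exists B M, 0 <= B /\ forall y : R,
    normc (laplace g (0 -i* y)) * abs_laplace u v y <= B * (1 + y ^+ 2) ^+ M.
Proof.
(* At each [y] the hypothesis is used at [lam = 1 - d / (1 + y ^+ 2)]. Taking [d] at most
   [delta / 2] keeps [lam] in its range for every [y], and [d <= 1] is what [exponent_bound] asks
   for. *)
move=> delta0 hC; pose d := Num.min 1 (delta / 2).
have d0 : 0 < d by rewrite lt_min ltr01 divr_gt0.
have d1 : d <= 1 by rewrite ge_min lexx.
have dd : d <= delta / 2 by rewrite ge_min lexx orbT.
pose M := Num.bound `|N|; have NM : N <= M%:R.
  by apply: le_trans (ler_norm N) _; apply/ltW/archi_boundP.
exists (expR 4 * (`|C| / d ^+ M)), M; split.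
  by rewrite mulr_ge0 ?expR_ge0 // divr_ge0 // exprn_ge0 // ltW.
move=> y; have y1 : 1 <= 1 + y ^+ 2 by rewrite lerDl sqr_ge0.
have y0 : 0 < 1 + y ^+ 2 by apply: lt_le_trans y1.
pose e := d / (1 + y ^+ 2); have e0 : 0 < e by rewrite divr_gt0.
have e1 : e <= d by rewrite ler_pdivrMr // ler_peMr // ltW.
have := abs_laplace_bound iu iv y d0 d1; rewrite -/e => h1.
have := hC (1 - e); rewrite subKr => h2.
have {}h2 := h2 ltac:(move: e1 dd delta0; lra) ltac:(move: e0; lra).
rewrite -lee_fin; apply: le_trans h1 _.
apply: (@le_trans _ _ ((expR 4)%:E * (C * e `^ (- N))%:E)%E).
  by rewrite lee_pmul2l // lte_fin expR_gt0.
rewrite -EFinM lee_fin -!mulrA ler_wpM2l ?expR_ge0 //.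
apply: (@le_trans _ _ (`|C| * e `^ (- N))); first by rewrite ler_wpM2r ?powR_ge0 ?ler_norm.
apply: ler_wpM2l => //.
have ei : 1 <= e^-1 by rewrite invf_ge1 // (le_trans e1).
have -> : (d ^+ M)^-1 * (1 + y ^+ 2) ^+ M = e^-1 `^ M%:R.
  by rewrite powR_mulrn ?invr_ge0 ?(ltW e0) // /e invf_div expr_div_n mulrC.
have -> : e `^ (- N) = e^-1 `^ N.
  by rewrite -(powR_inv1 (ltW e0)) -powRrM mulN1r.
exact: ler_powR.
Qed.

Lemma zero_hermite : {ae mu, forall t, g t = 0} -> hermite_type.
Proof.
move=> g0; exists 1 => //; exists 0, 0; move: g0; apply: filterS.
  exact: (ae_filter_ringOfSetsType mu).
move=> t /eqP; rewrite mulf_eq0 => /orP[]/eqP.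
  by case=> -> ->; rewrite !horner0 !mul0r.
by case=> /eqP; rewrite gt_eqF // expR_gt0.
Qed.

(** A nonzero polynomial is bounded below far out, so [abs_laplace] grows at most like [y^(2 M)]. It
    also dominates [y^k / k!] times the absolute moment of order [k] of [g], and with [k = 2 M + 1]
    that moment must vanish. *)
Lemma transform_poly_ae0 (q : {poly R[i]}) (B : R) M : q != 0 ->
  (forall y : R, laplace g (0 -i* y) = q.[y%:C]) ->
  (forall y : R, normc (laplace g (0 -i* y)) * abs_laplace u v y <= B * (1 + y ^+ 2) ^+ M) ->
  {ae mu, forall t, g t = 0}.
Proof.
move=> q0 hq hB; have [d [Y [d0 hd]]] := poly_lower_bound q0.
pose k := (2 * M).+1.
have idg := exp_decay_damped iu iv.
have ik := cintegrable_normc (decay_pow_integrable k idg).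
pose mk := Rintegral mu setT (fun t => normc (g t * t%:C ^+ k)).
have mk0 : 0 <= mk by apply: Rintegral_ge0 => t _; exact: normc_ge0.
have Hk y : 0 <= y -> y ^+ k / k`!%:R * mk <= abs_laplace u v y.
  move=> y0; rewrite /mk -RintegralZl //; apply: le_Rintegral => //.
  - exact: (@rintegrableZ _ _ _ mu _ _ ik).
  - by have [_] := idg; apply.
  move=> t _; rewrite normcM normcX normc_real mulrCA ler_wpM2l ?normc_ge0 //.
  have := expR_ge_pow k (mulr_ge0 (normr_ge0 y) (normr_ge0 t)).
  by rewrite exprMn (ger0_norm y0) mulrAC.
have kp : 0 < k`!%:R :> R by rewrite ltr0n fact_gt0.
have bound y : Num.max Y 1 <= y -> mk * y <= B * 2 ^+ M * k`!%:R / d.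
  rewrite ge_max => /andP[Yy y1]; have y0 : 0 < y by apply: lt_le_trans y1.
  have h1 : d * (y ^+ k / k`!%:R * mk) <= B * (1 + y ^+ 2) ^+ M.
    apply: (le_trans _ (hB y)); rewrite hq; apply: ler_pM; rewrite ?(ltW d0) ?hd //.
      by rewrite mulr_ge0 // divr_ge0 ?exprn_ge0 ?(ltW y0) ?(ltW kp).
    exact: Hk (ltW y0).
  have B0 : 0 <= B.
    have pM : 0 < (1 + y ^+ 2) ^+ M by rewrite exprn_gt0 // ltr_pwDl ?sqr_ge0.
    rewrite -(pmulr_lge0 _ pM); apply: le_trans h1.
    apply: mulr_ge0; first exact: ltW.
    by rewrite mulr_ge0 // divr_ge0 ?exprn_ge0 ?(ltW y0) ?(ltW kp).
  have h2 : B * (1 + y ^+ 2) ^+ M <= B * (2 * y ^+ 2) ^+ M.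
    rewrite ler_wpM2l //; apply: lerXn2r; rewrite ?nnegrE.
    - by rewrite addr_ge0 ?sqr_ge0.
    - by rewrite mulr_ge0 ?sqr_ge0.
    - have : 1 <= y ^+ 2 by rewrite exprn_ege1.
      by lra.
  have h3 : d * (y * y ^+ (2 * M) / k`!%:R * mk) <= B * (2 ^+ M * y ^+ (2 * M)).
    by move: (le_trans h1 h2); rewrite exprMn -exprM {1}/k exprS.
  have yM : 0 < y ^+ (2 * M) by rewrite exprn_gt0.
  have c0 : 0 < y ^+ (2 * M) / k`!%:R by rewrite divr_gt0.
  rewrite ler_pdivlMr // -(ler_pM2r c0).
  have -> : mk * y * d * (y ^+ (2 * M) / k`!%:R) = d * (y * y ^+ (2 * M) / k`!%:R * mk) by ring.
  apply: le_trans h3 _; rewrite le_eqVlt; apply/orP; left; apply/eqP.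
  by field; rewrite gt_eqF.
have mkz : mk = 0.
  apply/eqP; rewrite eq_le mk0 andbT leNgt; apply/negP => mkp.
  set D := B * _ * _ / _ in bound.
  have := bound (Num.max (Num.max Y 1) ((D + 1) / mk)).
  rewrite le_max lexx => /(_ isT); set y := Num.max _ _ => h.
  have : (D + 1) / mk <= y by rewrite le_max lexx orbT.
  by rewrite ler_pdivrMr // mulrC; move: h; lra.
have z0 : {ae mu, forall t, g t * t%:C ^+ k = 0}.
  have mg : measurable_fun [set: T] (EFin \o (fun t => normc (g t * t%:C ^+ k))).
    exact: measurable_int _ ik.
  have [ae0 _] := @ae_eq_integral_abs _ T R mu setT measurableT _ mg.
  have int0 : (\int[mu]_t `|(EFin \o (fun t : R => normc (g t * t%:C ^+ k)%R)) t| = 0)%E.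
    transitivity (\int[mu]_t (normc (g t * t%:C ^+ k)%R)%:E)%E.
      by apply: eq_integral => t _; rewrite /= ger0_norm ?normc_ge0.
    by rewrite -EFin_Rintegral // -/mk mkz.
  have := ae0 int0; apply: filterS.
  by move=> t /(_ I) /= [] /eqP; rewrite normc_eq0 => /eqP.
have nz : {ae mu, forall t : R, t != 0}.
  exists [set 0]; split; [exact: measurable_set1|exact: lebesgue_measure_set1|].
  by move=> t /= /negP; rewrite negbK => /eqP.
move: z0 nz; apply: filterS2; first exact: (ae_filter_ringOfSetsType mu).
move=> t /eqP; rewrite mulf_eq0 => /orP[/eqP //|]; rewrite expf_eq0 /= => /eqP[] -> .
by rewrite eqxx.
Qed.
Lemma damped_poly_gauss (a : R) (p : {poly R[i]}) t : g t = poly_gauss a p t ->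
  cfun u v t = p.[t%:C] * (gaussian (a - 1) t)%:C.
Proof.
have c0 : (gaussian 1 t)%:C != 0 :> R[i].
  by rewrite fmorph_eq0 gt_eqF // expR_gt0.
move=> h; apply: (mulIf c0); rewrite -/(damped u v t) h /poly_gauss -mulrA -rmorphM /=.
rewrite /gaussian -expRD; congr (_ * (expR _)%:C).
by field.
Qed.

Lemma gauss_hermite (a : R) (p : {poly R[i]}) : 1 < a ->
  {ae mu, forall t, g t = poly_gauss a p t} -> hermite_type.
Proof.
move=> a1 hg; exists (a - 1); first by rewrite subr_gt0.
exists (\poly_(k < size p) Re p`_k), (\poly_(k < size p) Im p`_k).
move: hg; apply: filterS; first exact: (ae_filter_ringOfSetsType mu).
move=> t /damped_poly_gauss h; rewrite -Re_horner_real -Im_horner_real.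
have := congr1 (@Re R) h; have := congr1 (@Im R) h.
by rewrite ReM ImM /= !mulr0 subr0 add0r.
Qed.

(** Undamping gives [f = p] times the Gaussian of parameter [a - 1]. For [a <= 1] that factor is at
    least 1, so [|f|] is at least a positive constant on a half line, against integrability. *)
Lemma gauss_width (a : R) (p : {poly R[i]}) : p != 0 ->
  {ae mu, forall t, g t = poly_gauss a p t} -> 1 < a.
Proof.
move=> p0 hg; rewrite ltNge; apply/negP => a1.
have [d [Y [d0 hd]]] := poly_lower_bound p0.
have ic := cmod_integrable iu iv.
have mc : measurable_fun [set: T] (EFin \o cmod_fun u v) := measurable_int _ ic.
pose I := Rintegral mu setT (cmod_fun u v).
have bound (n : nat) : d * n%:R <= I.
  rewrite -lee_fin EFin_Rintegral //.
  pose D := [set` `[Y, Y + n%:R : R]].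
  have mD : measurable (D : set T) by exact: measurable_itv.
  apply: (@le_trans _ _ (\int[mu]_(t in D) (cmod_fun u v t)%:E)%E); last first.
    by apply: ge0_subset_integral => // t _; rewrite lee_fin sqrtr_ge0.
  apply: (@le_trans _ _ (\int[mu]_(t in D) (cst d%:E t))%E).
    have muD : mu D = n%:R%:E.
      have -> : mu D = (if (Y < Y + n%:R)%R then (Y + n%:R)%:E - Y%:E else 0)%E.
        by have := lebesgue_measure_itv `[Y, Y + n%:R]; rewrite /= lte_fin.
      rewrite -EFinB [Y + _ - Y]addrC addKr; case: ifP => // /negbT.
      by rewrite -leNgt gerDl => n0; congr EFin; apply/eqP; rewrite eq_le n0 ler0n.
    have := @integral_cst _ _ _ mu D mD d%:E; rewrite [X in (_ * X)%E]muD => ->.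
    by rewrite -EFinM lexx.
  apply: ae_ge0_le_integral => //.
  - by move=> t _; rewrite lee_fin ltW.
  - by move=> t _; rewrite lee_fin sqrtr_ge0.
  - exact: measurable_funTS.
  move: hg; apply: filterS; first exact: (ae_filter_ringOfSetsType mu).
  move=> t /damped_poly_gauss h; rewrite /D /= in_itv /= => /andP[Yt _]; rewrite lee_fin.
  have -> : cmod_fun u v t = normc (cfun u v t) by [].
  rewrite h normcM normc_real ger0_norm ?expR_ge0 //; apply: le_trans (hd t Yt) _.
  rewrite ler_peMr ?normc_ge0 // -[leLHS]expR0 ler_expR divr_ge0 // oppr_ge0.
  by apply: mulr_le0_ge0; rewrite ?sqr_ge0 ?subr_le0.
have I0 : 0 <= I by have := bound 0%N; rewrite mulr0.
have := archi_boundP (divr_ge0 I0 (ltW d0)); rewrite ltr_pdivrMr // mulrC.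
by move=> /lt_le_trans /(_ (bound _)); rewrite ltxx.
Qed.

Lemma beurling_hermite (C delta : R) : 0 < delta ->
  (forall lam : R, 1 - delta < lam -> lam < 1 ->
     (beurling_integral u v lam <= (C * (1 - lam) `^ (- N))%:E)%E) -> hermite_type.
Proof.
move=> delta0 hC; have [B [M [B0 hB]]] := polynomial_bound delta0 hC.
have dg := exp_decay_damped iu iv.
have ig : cintegrable mu g.
  have := decay_pow_integrable 0 dg; congr (cintegrable mu _).
  by apply/funext => t; rewrite expr0 mulr1.
pose E z := laplace g ((0 -i* 1) * z).
have Ereal (y : R) : E y%:C = laplace g (0 -i* y).
  by rewrite /E; congr laplace; apply: complex_eq; rewrite /=; ring.
have eE : entire E := entire_scale (0 -i* 1) (entire_laplace dg).
have gE z : normc (E z) <= Rintegral mu setT (cmod_fun u v) * expR (normc z ^+ 2 / 2).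
  apply: le_trans (laplace_damped_growth iu iv _) _.
  by rewrite normcM [normc (0 -i* 1)]/= expr0n add0r sqrrN expr1n sqrtr1 mul1r.
have bE (y : R) w : `|Im w| <= `|y| -> normc (E y%:C * E w) <= B * (1 + y ^+ 2) ^+ M.
  move=> wy; apply: le_trans (hB y); rewrite normcM Ereal ler_wpM2l ?normc_ge0 //.
  apply: (laplace_le_abs iu iv); rewrite ReM /=.
  by have -> : 0 * Re w - - 1 * Im w = Im w by ring.
have [q [b hq]] := gaussian_structure eE B0 gE bE.
have [q0|q0] := eqVneq q 0.
  apply: zero_hermite; apply: laplace_unique_ae => // y.
  by rewrite -Ereal hq q0 horner0 mul0r.
have Imb := gaussian_structure_real q0 hq bE.
have bR : b = (Re b)%:C by apply: complex_eq.
case: (ltrgtP (Re b) 0) => rb.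
- pose beta := - Re b; have beta0 : 0 < beta by rewrite oppr_gt0.
  have a0 : 0 < (2 * beta)^-1 by rewrite invr_gt0 mulr_gt0.
  (* Since [laplace g z = E ('i * z)], the transform of [g] is [q] at ['i * z] times the exponential
     of [beta * z ^+ 2]; a Gaussian of parameter [a] has the exponent [(2 * a)^-1], whence
     [a = (2 * beta)^-1]. *)
  have [p hp] := laplace_poly_gauss a0 (q \Po ('i *: 'X)).
  have lg z : laplace g z = laplace (poly_gauss (2 * beta)^-1 p) z.
    have -> : laplace g z = E ('i * z).
      rewrite /E mulrA; have -> : (0 -i* 1) * 'i = 1 :> R[i]; last by rewrite mul1r.
      by apply: complex_eq; rewrite /=; ring.
    rewrite hq hp horner_comp hornerZ hornerX exprMn sqr_i mulN1r mulrN; congr (_ * cexp _).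
    by rewrite bR -mulNr -rmorphN; congr (_%:C * _); rewrite -/beta; field; rewrite gt_eqF.
  have dp := exp_decay_poly_gauss a0 p.
  have ae0 : {ae mu, forall t, g t = poly_gauss (2 * beta)^-1 p t}.
    have dN : exp_decay (fun t => (-1) * poly_gauss (2 * beta)^-1 p t).
      have := exp_decay_poly_gauss a0 (- p); congr (exp_decay _).
      by apply/funext => t; rewrite /poly_gauss hornerN mulN1r mulNr.
    have ip : cintegrable mu (fun t => g t + (-1) * poly_gauss (2 * beta)^-1 p t).
      have := @cintegrableD _ _ _ mu _ _ ig (decay_pow_integrable 0 dN); congr (cintegrable mu _).
      by apply/funext => t; rewrite expr0 mulr1.
    have := laplace_unique_ae ip.
    have zz (y : R) : laplace (fun t => g t + (-1) * poly_gauss (2 * beta)^-1 p t) (0 -i* y) = 0.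
      by rewrite laplaceD // laplaceZ // lg mulN1r subrr.
    move=> /(_ zz); apply: filterS; first exact: (ae_filter_ringOfSetsType mu).
    by move=> t /eqP; rewrite mulN1r subr_eq0 => /eqP.
  have p0 : p != 0.
    apply: contra_neq q0 => p0; apply: poly_ext => y.
    have := hq y; rewrite /E lg p0 /laplace.
    have -> : (fun t : R => poly_gauss (2 * beta)^-1 0 t * cexp ((0 -i* 1) * y * t%:C)) = (fun=> 0).
      by apply/funext => t; rewrite /poly_gauss horner0 !mul0r.
    rewrite cint0 => /esym /eqP; rewrite mulf_eq0 (negbTE (cexp_neq0 _)) orbF => /eqP ->.
    by rewrite horner0.
  exact: gauss_hermite (gauss_width p0 ae0) ae0.
(* At real points [|E y|] is at most the integral of [|g|], which excludes an exponential
   increase. *)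
- exfalso; apply: (@poly_exp_unbounded _ q (Re b) (abs_laplace u v 0) 0%N q0 rb) => y.
  rewrite expr0 mulr1; apply: le_trans (_ : normc (E y%:C) <= _); last first.
    by rewrite Ereal; apply: (laplace_le_abs iu iv); rewrite /= normr0.
  rewrite hq normcM normc_cexp bR -rmorphXn -rmorphM /=.
  by [].
(* Here [E] is a nonzero polynomial; boundedness on the line would still allow a constant, so the
   full product bound is needed. *)
- apply: zero_hermite; apply: (transform_poly_ae0 q0 _ hB) => y.
  by rewrite -Ereal hq bR rb mul0r cexp0 mulr1.
Qed.

End BeurlingTheorem.

Unset Implicit Arguments.
Local Close Scope complex_scope.

Theorem mainTheorem1 (R : realType) (u v : R -> R) (N : R) :
  (@lebesgue_measure R).-integrable setT (EFin \o u) ->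
  (@lebesgue_measure R).-integrable setT (EFin \o v) ->
  0 < N ->
  (exists C : R, exists2 delta : R, 0 < delta &
     forall lam : R, 1 - delta < lam -> lam < 1 ->
       (beurling_integral u v lam <= (C * (1 - lam) `^ (- N))%:E)%E) ->
  exists2 a : R, 0 < a &
    exists p q : {poly R},
      {ae @lebesgue_measure R, forall x : R,
         u x = p.[x] * gaussian a x /\ v x = q.[x] * gaussian a x}.
Proof.
by move=> iu iv _ [C [delta d0 hC]]; exact: (beurling_hermite iu iv d0 hC).
Qed.
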